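(* For any $\gamma\in\,]\tfrac12,\infty]$ and every integer $s\geq1$, and for each $\epsilon\in\{i,-i\}$, there exists a germ at $0$ of a holomorphically flat real analytic surface $M\subset\mathbb C^2$ of the form $z_2=\gamma^{-1}z_1\bar z_1+z_1^2+\bar z_1^2+\mathrm{h.o.t.}(z_1,\bar z_1)$ which is formally equivalent to the surface $$M_{\mathrm{nf}}:\ z_2=\big(\lambda^{\frac12}e^{\epsilon(-\operatorname{Re}z_2)^s}+\lambda^{-\frac12}e^{-\epsilon(-\operatorname{Re}z_2)^s}\big)z_1\bar z_1+z_1^2+\bar z_1^2,$$ but not analytically equivalent to it.
   Context: Here $\gamma^{-1}=0$ when $\gamma=\infty$; $\lambda,\lambda^{-1}$ are the roots of $\lambda+\lambda^{-1}=\gamma^{-2}-2$ (so $|\lambda|=1$ for $\gamma>\frac12$), and $\lambda^{\frac12}$ is chosen so that $\lambda^{\frac12}+\lambda^{-\frac12}=\gamma^{-1}$. A germ of real analytic surface $M\subset(\mathbb C^2,0)$ is holomorphically flat if it is contained in a germ of Levi-flat real analytic hypersurface of $\mathbb C^2$; equivalently, after a biholomorphic change of coordinates it is contained in $\{\operatorname{Im}z_2=0\}$. Two surfaces are analytically (resp. formally) equivalent if there is a germ of biholomorphism (resp. formal diffeomorphism) $z\mapsto f(z)$ of $(\mathbb C^2,0)$ mapping one to the other. *)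

(* Defs.v *)
From mathcomp Require Import all_boot all_algebra.
From mathcomp Require Import reals.
From mathcomp.real_closed Require Import complex.
From mathcomp Require Import mpoly.
Set Implicit Arguments.
Unset Strict Implicit.
Unset Printing Implicit Defensive.
Import GRing.Theory Num.Theory.
Local Open Scope ring_scope.
Local Open Scope complex_scope.

Definition ser (R : realType) (n : nat) := 'X_{1..n} -> R[i].

Definition tr (R : realType) (n N : nat) (a : ser R n) : {mpoly R[i][n]} :=
  \sum_(m : 'X_{1..n < N.+1}) a (bmnm m) *: 'X_[bmnm m].

Definition convergent (R : realType) (n : nat) (a : ser R n) : Prop :=
  exists C r : R, 0 < C /\ 0 < r /\
    forall m : 'X_{1..n}, `|a m| <= (C * r ^+ mdeg m)%:C.

(** Formal identity of power series: all coefficients of the expression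
    [E N] of degree <= N vanish, for every N ([E N] computed from
    degree-N truncations of the data). *)
Definition formally_zero (R : realType) (n : nat)
    (E : nat -> {mpoly R[i][n]}) : Prop :=
  forall (N : nat) (m : 'X_{1..n}), (mdeg m <= N)%N -> (E N)@_m = 0.

(** Series in the variables (z, w) where w stands for conj z.
    [cswap a] is the series of conj (a(z, conj z)) in the variables (z, w):
    coefficient at (j,i) is conj of coefficient of a at (i,j). *)
Definition swapm (m : 'X_{1..2}) : 'X_{1..2} :=
  [multinom m (rev_ord i) | i < 2].
Definition cswap (R : realType) (a : ser R 2) : ser R 2 :=
  fun m => (a (swapm m))^*.
Definition cconj (R : realType) (n : nat) (a : ser R n) : ser R n :=
  fun m => (a m)^*.

Definition formal_diffeo (R : realType) (f1 f2 : ser R 2) : Prop :=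
  f1 0%MM = 0 /\ f2 0%MM = 0 /\
  f1 (mnm1 (0 : 'I_2)) * f2 (mnm1 (1 : 'I_2))
    - f1 (mnm1 (1 : 'I_2)) * f2 (mnm1 (0 : 'I_2)) != 0.

Definition biholo (R : realType) (f1 f2 : ser R 2) : Prop :=
  formal_diffeo f1 f2 /\ convergent f1 /\ convergent f2.

(** The surface M_F : z2 = F(z1, conj z1), parametrised by z1.
    Image of M_F under (f1,f2), truncated at degree N, as series in (z, w):
    [img1] = f1(z, F), [img2] = f2(z, F), [cimg1] = conj f1 (on M),
    [cimg2] = conj f2 (on M). *)
Definition img (R : realType) (N : nat) (F f : ser R 2) : {mpoly R[i][2]} :=
  tr N f \mPo [tuple 'X_(0 : 'I_2); tr N F].
Definition cimg (R : realType) (N : nat) (F f : ser R 2) : {mpoly R[i][2]} :=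
  tr N (cconj f) \mPo [tuple 'X_(1 : 'I_2); tr N (cswap F)].

Definition maps_into_real_hyperplane (R : realType) (F f1 f2 : ser R 2) : Prop :=
  formally_zero (fun N => img N F f2 - cimg N F f2).

Definition holomorphically_flat (R : realType) (F : ser R 2) : Prop :=
  exists f1 f2 : ser R 2, biholo f1 f2 /\ maps_into_real_hyperplane F f1 f2.

(** Truncated exponential of a polynomial without constant term. *)
Definition texp (R : realType) (N : nat) (x : {mpoly R[i][2]}) : {mpoly R[i][2]} :=
  \sum_(k < N.+1) ((k`!)%:R)^-1 *: x ^+ k.

Definition maps_into_nf (R : realType) (mu eps : R[i]) (s : nat)
    (F f1 f2 : ser R 2) : Prop :=
  formally_zero (fun N =>
    let Z1 := img N F f1 in let Z2 := img N F f2 in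
    let cZ1 := cimg N F f1 in let cZ2 := cimg N F f2 in
    let x := (- (2%:R)^-1) *: (Z2 + cZ2) in
    Z2 - (mu *: texp N (eps *: x ^+ s) + mu^-1 *: texp N ((- eps) *: x ^+ s))
           * Z1 * cZ1
       - Z1 ^+ 2 - cZ1 ^+ 2).

(** F has the form gi z w + z^2 + w^2 + h.o.t. (gi = gamma^-1). *)
Definition has_form (R : realType) (gi : R) (F : ser R 2) : Prop :=
  (forall m : 'X_{1..2}, (mdeg m <= 1)%N -> F m = 0) /\
  F [multinom [tuple 1%N; 1%N]] = gi%:C /\
  F [multinom [tuple 2%N; 0%N]] = 1 /\
  F [multinom [tuple 0%N; 2%N]] = 1.

(* Main.v *)
Require Import Defs.
From HB Require Import structures.
From mathcomp Require Import all_boot all_order all_algebra.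
From mathcomp Require Import boolp classical_sets reals.
From mathcomp.real_closed Require Import complex.
From mathcomp Require Import qpoly.
From mathcomp Require Import mpoly.
From mathcomp Require Import ring lra zify.
Set Implicit Arguments.
Unset Strict Implicit.
Unset Printing Implicit Defensive.
Import Order.TTheory GRing.Theory Num.Theory.
Local Open Scope ring_scope.

(* Work with series in p, q and put x = pq; a series is diagonal if it is a power
   series in x.  Given an imaginary series Y symmetric in p, q, the real surface
   parametrised by z1 = k0 (B p + B^-1 q), z2 = -x, with
   B = lambda^(-1/4) e^(-eps x^s / 2) e^Y, is flat, and convergent if Y is.  Normalising
   it amounts to finding E antisymmetric with E(Bp, B^-1 q) - E(B^-1 p, Bq) + 2Y
   diagonal.  On the monomials p^k x^l this inverts nu^(-k) - nu^k, where
   nu = lambda^(1/4) e^(eps x^s / 2), which is at worst divisible by x^s, so a formal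
   solution exists; conversely a convergent equivalence forces the off-diagonal
   part of E(Bp, B^-1 q) to converge.

   Take Y = i t Y0.  The coefficients of E(Bp, B^-1 q) are polynomials in t of degree
   controlled by the order, so if the series converged for all t in [0, 1], a
   Baire argument and Lagrange interpolation would give a geometric bound for the
   coefficients linear in t.  On p^k these linear terms are
   2 x^(2s) / (lambda^(k/2) e^(k eps x^s) - 1), whose x^(2s + sn) coefficient
   has modulus at least (k/6)^n for odd n (it solves a Riccati equation); large k
   gives a contradiction. *)

(** The functions p and q are real on the surface, so z2 = -pq is real: this is the flatness. As z1
    is a constant times Bp + B^-1 q, series in (z1, z2) restrict to the series f(Bp, B^-1 q) with f
    symmetric, and [Y] imaginary makes B^-1 the conjugate of B. A normalisation is a real change p
    -> r p e^V, q -> r q e^-V that carries this class of functions to that of the normal form; in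
    terms of V the condition is linear exactly, not only to first order, because series in x are
    fixed by the scalings involved. Its diagonal remainder is absorbed in a change of x. Taking [Y]
    divisible by x^(2s) leaves a net gain of x^s after each division by x^s. The divergence has no
    arithmetic source: the poles in y of 1 / (L e^(k eps y) - 1), with |L| = 1, approach 0 like 1/k,
    so no common radius serves all modes. For a single t the higher powers of t could cancel this
    divergence of the linear terms, hence the detour through all t; isolating the linear term needs
    degrees in t bounded by the order. *)

(** * Formal power series in one variable *)

(** A type of its own, so that multiplication is the Cauchy product; iterated as [ps (ps K)] it
    gives series in p and q, the outer index being the exponent of p. *)
Definition ps (K : Type) : Type := nat -> K.
HB.instance Definition _ (K : Type) := gen_eqMixin (ps K).
HB.instance Definition _ (K : Type) := gen_choiceMixin (ps K).

(* The ring operations are sealed: otherwise failing unifications unfold them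
   down to the coefficients. *)
HB.lock Definition ps_add (K : comNzRingType) (f g : ps K) : ps K :=
  fun n => f n + g n.
HB.lock Definition ps_opp (K : comNzRingType) (f : ps K) : ps K :=
  fun n => - f n.
HB.lock Definition ps_mul (K : comNzRingType) (f g : ps K) : ps K :=
  fun n => \sum_(i < n.+1) f i * g (n - i)%N.

Section PsRing.
Variable K : comNzRingType.
Implicit Types f g h : ps K.

Local Notation ps_add := (@ps_add K).
Local Notation ps_opp := (@ps_opp K).
Local Notation ps_mul := (@ps_mul K).

Definition ps_zero : ps K := fun _ => 0.
Definition ps_one : ps K := fun n => (n == 0)%:R.

Lemma ps_addA : associative ps_add.
Proof. by move=> f g h; apply/funext => n; rewrite !ps_add.unlock addrA. Qed.
Lemma ps_addC : commutative ps_add.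
Proof. by move=> f g; apply/funext => n; rewrite !ps_add.unlock addrC. Qed.
Lemma ps_add0 : left_id ps_zero ps_add.
Proof. by move=> f; apply/funext => n; rewrite ps_add.unlock add0r. Qed.
Lemma ps_addN : left_inverse ps_zero ps_opp ps_add.
Proof. by move=> f; apply/funext => n; rewrite ps_add.unlock ps_opp.unlock addNr. Qed.

HB.instance Definition _ := GRing.isZmodule.Build (ps K)
  ps_addA ps_addC ps_add0 ps_addN.

(** Coefficients of products are coefficients of products of truncations, so commutativity and
    associativity are inherited from [{poly K}]. *)
Lemma coef_poly_mul (m : nat) f g n : (n <= m)%N ->
  (\poly_(i < m.+1) f i * \poly_(i < m.+1) g i)`_n = ps_mul f g n.
Proof.
move=> le_nm; rewrite coefM ps_mul.unlock; apply: eq_bigr => i _.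
by rewrite !coef_poly !ifT //; have := ltn_ord i; lia.
Qed.

Lemma ps_mulC : commutative ps_mul.
Proof.
by move=> f g; apply/funext => n; rewrite -!(@coef_poly_mul n) // mulrC.
Qed.
Lemma ps_mulA : associative ps_mul.
Proof.
have aux f g h n : ps_mul (ps_mul f g) h n =
  (\poly_(i < n.+1) f i * \poly_(i < n.+1) g i * \poly_(i < n.+1) h i)`_n.
  rewrite coefM {1}ps_mul.unlock; apply: eq_bigr => i _.
  by rewrite coef_poly_mul -1?ltnS // coef_poly ltnS leq_subr.
move=> f g h; rewrite (ps_mulC f); apply/funext => n.
by rewrite !aux; congr (nth _ (polyseq _) _); rewrite [LHS]mulrC mulrA.
Qed.
Lemma ps_mul1 : left_id ps_one ps_mul.
Proof.
move=> f; apply/funext => n; rewrite ps_mul.unlock big_ord_recl /= mul1r subn0.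
by rewrite big1 ?addr0 // => i _; rewrite mul0r.
Qed.
Lemma ps_mulDl : left_distributive ps_mul +%R.
Proof.
move=> f g h; apply/funext => n; have -> : (ps_mul f h + ps_mul g h) n = ps_mul f h n + ps_mul g h n.
  by rewrite -[LHS]/(ps_add _ _ n) ps_add.unlock.
rewrite ps_mul.unlock -big_split; apply: eq_bigr => i _.
by rewrite -[(f + g) i]/(ps_add f g i) ps_add.unlock mulrDl.
Qed.
Lemma ps_one_neq0 : ps_one != 0 :> ps K.
Proof.
apply/eqP => /(congr1 (fun f => f 0%N)) /eqP.
by rewrite /ps_one /= oner_eq0.
Qed.

HB.instance Definition _ := GRing.Zmodule_isComNzRing.Build (ps K)
  ps_mulA ps_mulC ps_mul1 ps_mulDl ps_one_neq0.

Lemma ps_addE f g n : (f + g) n = f n + g n.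
Proof. by rewrite -[LHS]/(ps_add f g n) ps_add.unlock. Qed.
Lemma ps_oppE f n : (- f) n = - f n.
Proof. by rewrite -[LHS]/(ps_opp f n) ps_opp.unlock. Qed.
Lemma ps_subE f g n : (f - g) n = f n - g n.
Proof. by rewrite ps_addE ps_oppE. Qed.
Lemma ps_0E n : (0 : ps K) n = 0. Proof. by []. Qed.
Lemma ps_mulE f g n : (f * g) n = \sum_(i < n.+1) f i * g (n - i)%N.
Proof. by rewrite -[LHS]/(ps_mul f g n) ps_mul.unlock. Qed.
Lemma ps_sumE (I : Type) (r : seq I) (P : pred I) (F : I -> ps K) n :
  (\sum_(i <- r | P i) F i) n = \sum_(i <- r | P i) F i n.
Proof. by elim/big_rec2: _ => // i x y _ <-; rewrite ps_addE. Qed.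

Definition ps_c (c : K) : ps K := fun n => if n is 0 then c else 0.
Lemma ps_c_add : additive ps_c.
Proof. by move=> a b; apply/funext => -[|n]; rewrite ps_subE //= subr0. Qed.
Lemma ps_c_mul : multiplicative ps_c.
Proof.
split=> [a b|]; last by apply/funext => -[|n].
apply/funext => n; rewrite ps_mulE; case: n => [|n]; first by rewrite big_ord1.
rewrite big_ord_recl /= mulr0 big1 ?addr0 // => i _.
by rewrite mul0r.
Qed.
HB.instance Definition _ := GRing.isAdditive.Build K (ps K) ps_c ps_c_add.
HB.instance Definition _ := GRing.isMultiplicative.Build K (ps K) ps_c ps_c_mul.

Lemma ps_mulcE c f n : (ps_c c * f) n = c * f n.
Proof.
rewrite ps_mulE big_ord_recl subn0 big1 ?addr0 // => i _.
by rewrite mul0r.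
Qed.

Definition ps_X : ps K := fun n => (n == 1)%:R.
Lemma ps_XnE k n : (ps_X ^+ k) n = (n == k)%:R.
Proof.
elim: k n => [|k IH] n; first by rewrite expr0.
rewrite exprS ps_mulE; case: n => [|n]; first by rewrite big_ord1 mul0r.
rewrite !big_ord_recl /= mul0r add0r big1 ?addr0 /bump /= => [|i _].
  by rewrite mul1r add1n subn1 IH.
by rewrite mul0r.
Qed.
Lemma ps_mulXnE k f n :
  (ps_X ^+ k * f) n = if (n < k)%N then 0 else f (n - k)%N.
Proof.
rewrite ps_mulE; case: ltnP => [lt_nk|le_kn].
  rewrite big1 // => i _; rewrite ps_XnE (_ : (i == k :> nat) = false) ?mul0r //.
  by apply/eqP; have := ltn_ord i; lia.
have lt_k : (k < n.+1)%N by [].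
rewrite (bigD1 (Ordinal lt_k)) //= ps_XnE eqxx mul1r big1 ?addr0 // => i.
by rewrite -val_eqE /= ps_XnE => /negbTE ->; rewrite mul0r.
Qed.

End PsRing.

Arguments ps_c : simpl never.

(** The product of the two lowest nonzero coefficients is a coefficient of the product. The absence
    of zero divisors is asked of the coefficients explicitly, so that the lemma iterates to
    [ps (ps K)]. *)
Lemma ps_mul_eq0 (K : comNzRingType) (f g : ps K) :
  (forall a b : K, a * b = 0 -> a = 0 \/ b = 0) ->
  f * g = 0 -> f = 0 \/ g = 0.
Proof.
move=> dom fg0; have [->|f0] := pselect (f = 0); first by left.
have [->|g0] := pselect (g = 0); first by right.
have ex (h : ps K) : h <> 0 -> exists n, `[< h n <> 0 >].
  by move=> h0; apply: contrapT => H; apply: h0; apply/funext => n;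
     apply: contrapT => hn; apply: H; exists n; apply/asboolP.
have min (h : ps K) : h <> 0 -> exists n, h n <> 0 /\ forall m, (m < n)%N -> h m = 0.
  move=> /ex h0; exists (ex_minn h0); case: ex_minnP => n /asboolP hn le.
  split=> // m lt_mn; apply: contrapT => hm.
  by have := le m (asboolT hm); lia.
have [n [fn fn0]] := min _ f0; have [m [gm gm0]] := min _ g0.
have := congr1 (fun h : ps K => h (n + m)%N) fg0.
rewrite ps_mulE; have lt_n : (n < (n + m).+1)%N by lia.
rewrite (bigD1 (Ordinal lt_n)) //= addKn big1 ?addr0 ?ps_0E.
  by case/dom.
move=> i; rewrite -val_eqE /= => i_n.
have [lt_in|] := ltnP i n; first by rewrite fn0 // mul0r.
by move=> le_ni; rewrite gm0 ?mulr0 //; have := ltn_ord i; lia.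
Qed.

(** * Series in two variables and substitution *)

Definition cst (K : comNzRingType) (c : K) : ps (ps K) := ps_c (ps_c c).
Arguments cst : simpl never.
Definition nc (K : comNzRingType) (f : ps (ps K)) : ps (ps K) :=
  f - cst (f 0%N 0%N).
(** With [psum], a truncation of f(g, h): [g] replaces p and [h] replaces q. It is correct below
    total degree [D], since the arguments have lost their constant terms. *)
Definition psum_row (K : comNzRingType) (h : ps (ps K)) D (u : ps K) : ps (ps K) :=
  \sum_(b < D) cst (u b) * nc h ^+ b.
Definition psum (K : comNzRingType) (g h : ps (ps K)) D (f : ps (ps K)) : ps (ps K) :=
  \sum_(a < D) psum_row h D (f a) * nc g ^+ a.
(* The constant terms of [g] and [h] are dropped, so that [subst g h] is a
   ring morphism unconditionally. *)
HB.lock Definition subst (K : comNzRingType) (g h f : ps (ps K)) : ps (ps K) :=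
  fun i j => psum g h (i + j).+1 f i j.

Section Bivariate.
Variable K : comNzRingType.
Notation A := (ps (ps K)).
Implicit Types f g h : A.

Local Notation cst := (@cst K).
Lemma cst_add : additive cst. Proof. by move=> a b; rewrite /cst !rmorphB. Qed.
Lemma cst_mul : multiplicative cst.
Proof. by split=> [a b|]; rewrite /cst ?rmorphM ?rmorph1. Qed.
HB.instance Definition _ := GRing.isAdditive.Build K A cst cst_add.
HB.instance Definition _ := GRing.isMultiplicative.Build K A cst cst_mul.

Definition pv : A := ps_X (ps K).
Definition qv : A := ps_c (ps_X K).

Lemma bsumE (I : Type) (r : seq I) (P : pred I) (F : I -> A) i j :
  (\sum_(k <- r | P k) F k) i j = \sum_(k <- r | P k) F k i j.
Proof. by rewrite !ps_sumE. Qed.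
Lemma bmulE f g i j : (f * g) i j =
  \sum_(a < i.+1) \sum_(b < j.+1) f a b * g (i - a)%N (j - b)%N.
Proof. by rewrite ps_mulE ps_sumE; apply: eq_bigr => a _; rewrite ps_mulE. Qed.
Lemma bcstE c i j : cst c i j = if (i == 0%N) && (j == 0%N) then c else 0.
Proof. by case: i j => [|i] [|j]. Qed.
Lemma b1E i j : (1 : A) i j = if (i == 0%N) && (j == 0%N) then 1 else 0.
Proof. by rewrite -bcstE rmorph1. Qed.
Lemma bcstM c f i j : (cst c * f) i j = c * f i j.
Proof. by rewrite /cst ps_mulcE ps_mulcE. Qed.
Lemma bmonoM f a b i j : (pv ^+ a * qv ^+ b * f) i j =
  if (i < a)%N || (j < b)%N then 0 else f (i - a)%N (j - b)%N.
Proof.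
rewrite -mulrA ps_mulXnE; case: ltnP => //= le_ai.
by rewrite -rmorphXn ps_mulcE ps_mulXnE.
Qed.
Lemma bmonoE a b i j : (pv ^+ a * qv ^+ b) i j = ((i == a) && (j == b))%:R.
Proof.
rewrite -[_ * _]mulr1 bmonoM.
have -> : (1 : A) = cst 1 by rewrite rmorph1.
rewrite bcstE; case: ifP => H.
  by rewrite (_ : (i == a) && (j == b) = false) //; lia.
by rewrite (_ : (i - a == 0)%N && _ = (i == a) && (j == b)); [case: ifP|lia].
Qed.

Section Filtration.
Variable wt : nat -> nat -> nat.
Hypothesis wtD : forall i j k l, (wt i j + wt k l <= wt (i + k) (j + l))%N.

(** Two filtrations are used: [addn] measures the order at the origin ([J]), [minn] the power of x =
    pq that divides the series ([X]). Superadditivity of the weight makes these orders add under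
    products. *)
Definition vanish d f := forall i j, (wt i j < d)%N -> f i j = 0.

Lemma vanish0 d : vanish d 0. Proof. by []. Qed.
Lemma vanishD d f g : vanish d f -> vanish d g -> vanish d (f + g).
Proof. by move=> Vf Vg i j lt; rewrite !ps_addE Vf // Vg // addr0. Qed.
Lemma vanishN d f : vanish d f -> vanish d (- f).
Proof. by move=> Vf i j lt; rewrite !ps_oppE Vf // oppr0. Qed.
Lemma vanishB d f g : vanish d f -> vanish d g -> vanish d (f - g).
Proof. by move=> Vf Vg; apply: vanishD => //; apply: vanishN. Qed.
Lemma vanish_sum d (I : Type) (r : seq I) (P : pred I) (F : I -> A) :
  (forall i, P i -> vanish d (F i)) -> vanish d (\sum_(i <- r | P i) F i).
Proof. by move=> H; elim/big_ind: _ => //; apply: vanishD. Qed.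
Lemma vanishW d e f : (e <= d)%N -> vanish d f -> vanish e f.
Proof. by move=> le Vf i j lt; apply: Vf; lia. Qed.
Lemma vanishM d e f g : vanish d f -> vanish e g -> vanish (d + e) (f * g).
Proof.
move=> Vf Vg i j lt; rewrite bmulE big1 // => a _; rewrite big1 // => b _.
have := wtD a b (i - a) (j - b); rewrite !subnKC -1?ltnS // => le.
have [/Vf->|ge] := ltnP (wt a b) d; first by rewrite mul0r.
by rewrite Vg ?mulr0 //; lia.
Qed.
Lemma vanishMl d f g : vanish d g -> vanish d (f * g).
Proof. by move=> Vg; rewrite -[d]add0n; apply: vanishM. Qed.
Lemma vanishMr d f g : vanish d f -> vanish d (f * g).
Proof. by move=> Vg; rewrite mulrC; apply: vanishMl. Qed.
Lemma vanishX d n f : vanish d f -> vanish (n * d) (f ^+ n).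
Proof.
move=> Vf; elim: n => [|n IH]; first by rewrite mul0n.
by rewrite exprS mulSn; apply: vanishM.
Qed.
Lemma vanish_exp_congr d n f g : vanish d (f - g) -> vanish d (f ^+ n - g ^+ n).
Proof. by move=> V; rewrite subrXX; apply: vanishMr. Qed.
Lemma vanish_mul_congr d f g f' g' : vanish d (f - f') -> vanish d (g - g') ->
  vanish d (f * g - f' * g').
Proof.
move=> V V'; have -> : f * g - f' * g' = (f - f') * g + f' * (g - g') by ring.
by apply: vanishD; [apply: vanishMr|apply: vanishMl].
Qed.
End Filtration.

Lemma addn_wtD i j k l : ((i + j) + (k + l) <= (i + k) + (j + l))%N.
Proof. lia. Qed.
Lemma minn_wtD i j k l : (minn i j + minn k l <= minn (i + k) (j + l))%N.
Proof. lia. Qed.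

Notation J := (vanish addn).
Notation X := (vanish minn).

Lemma J_all_eq f g : (forall d, J d (f - g)) -> f = g.
Proof.
move=> H; apply/funext => i; apply/funext => j; apply/eqP; rewrite -subr_eq0.
by have := H (i + j).+1 i j (ltnSn _); rewrite !ps_subE => ->.
Qed.

Lemma J1P f : f 0%N 0%N = 0 -> J 1 f.
Proof. by move=> H [|i] [|j]. Qed.

Lemma nc_J f : J 1 (nc f).
Proof. by apply: J1P; rewrite /nc !ps_subE bcstE /= subrr. Qed.
Lemma nc_id f : J 1 f -> nc f = f.
Proof. by move=> Jf; rewrite /nc Jf // rmorph0 subr0. Qed.

Section Subst.
Variables g h : A.

Local Notation psum_row := (psum_row h).
Local Notation psum := (psum g h).
Local Notation subst := (subst g h).
Lemma substE f i j : subst f i j = psum (i + j).+1 f i j.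
Proof. by rewrite subst.unlock. Qed.

Lemma J_pow n u : J 1 u -> J n (u ^+ n).
Proof. by move=> /(vanishX addn_wtD (n := n)); rewrite muln1. Qed.

(** The discrepancy is the part of degree at least [D] of a product of polynomials, evaluated at
    [r], hence a multiple of [r ^+ D]. *)
Lemma horner_cauchy (r : A) D (u v : ps A) : J 1 r ->
  J D ((\sum_(n < D) u n * r ^+ n) * (\sum_(n < D) v n * r ^+ n) -
       \sum_(n < D) (u * v) n * r ^+ n).
Proof.
move=> Jr; case: D => [|D] //; rewrite -!(horner_poly).
have -> : \poly_(n < D.+1) (u * v) n =
   take_poly D.+1 (\poly_(n < D.+1) u n * \poly_(n < D.+1) v n).
  apply/polyP => k; rewrite coef_take_poly coef_poly; case: ltnP => // lt_kD.
  by rewrite coef_poly_mul.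
set U := \poly_(n < D.+1) u n; set V := \poly_(n < D.+1) v n.
rewrite -hornerM -[X in X.[r] - _](poly_take_drop D.+1) hornerD addrC addKr.
rewrite hornerM hornerXn; apply: (vanishMl addn_wtD); exact: J_pow.
Qed.

Lemma psum_row_stable D E u : (D <= E)%N -> J D (psum_row E u - psum_row D u).
Proof.
move=> le_DE; have [k ->] : exists k, E = (D + k)%N by exists (E - D)%N; rewrite subnKC.
rewrite /psum_row big_split_ord /= addrAC subrr add0r.
apply: vanish_sum => b _; apply: (vanishMl addn_wtD).
by apply: (@vanishW _ (D + b)); [exact: leq_addr|exact/J_pow/nc_J].
Qed.
Lemma psum_stable D E f : (D <= E)%N -> J D (psum E f - psum D f).
Proof.
move=> le_DE; rewrite /psum.
have [k ->] : exists k, E = (D + k)%N by exists (E - D)%N; rewrite subnKC.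
rewrite big_split_ord /= addrAC; apply: vanishD.
  rewrite -sumrB; apply: vanish_sum => a _; rewrite -mulrBl.
  by apply/(vanishMr addn_wtD)/psum_row_stable/leq_addr.
apply: vanish_sum => a _; apply: (vanishMl addn_wtD).
by apply: (@vanishW _ (D + a)); [exact: leq_addr|exact/J_pow/nc_J].
Qed.
Lemma subst_psum D f : J D (subst f - psum D f).
Proof.
move=> i j lt_ijD; rewrite !ps_subE substE.
have := @psum_stable _ _ f lt_ijD i j (ltnSn _); rewrite !ps_subE => /eqP.
by rewrite subr_eq0 => /eqP ->; rewrite subrr.
Qed.

Lemma psum_rowD D u v : psum_row D (u - v) = psum_row D u - psum_row D v.
Proof.
by rewrite /psum_row -sumrB; apply: eq_bigr => b _; rewrite ps_subE rmorphB mulrBl.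
Qed.
Lemma psumD D f f' : psum D (f - f') = psum D f - psum D f'.
Proof.
by rewrite /psum -sumrB; apply: eq_bigr => a _; rewrite ps_subE psum_rowD mulrBl.
Qed.
Lemma subst_add : additive subst.
Proof.
move=> f f'; apply/funext => i; apply/funext => j.
by rewrite !(ps_subE, substE) psumD !ps_subE.
Qed.
Lemma psum_rowM D u v : J D (psum_row D u * psum_row D v - psum_row D (u * v)).
Proof.
pose cu : ps A := fun n => cst (u n); pose cv : ps A := fun n => cst (v n).
have -> : psum_row D (u * v) = \sum_(b < D) (cu * cv) b * nc h ^+ b.
  apply: eq_bigr => b _; congr (_ * _); rewrite !ps_mulE rmorph_sum.
  by apply: eq_bigr => i _; rewrite rmorphM.
exact: (horner_cauchy cu cv (nc_J h)).
Qed.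
Lemma psumM D f f' : J D (psum D f * psum D f' - psum D (f * f')).
Proof.
pose cu : ps A := fun n => psum_row D (f n).
pose cv : ps A := fun n => psum_row D (f' n).
have := @horner_cauchy _ D cu cv (nc_J g).
set T := \sum_(n < D) (cu * cv) n * _ => H.
have -> : psum D f * psum D f' - psum D (f * f') =
  (psum D f * psum D f' - T) + (T - psum D (f * f')) by ring.
apply: vanishD => //; rewrite /T /psum -sumrB; apply: vanish_sum => a _.
rewrite -mulrBl; apply: (vanishMr addn_wtD); rewrite !ps_mulE.
rewrite (_ : psum_row D _ = \sum_(i < a.+1) psum_row D (f i * f' (a - i)%N)).
  by rewrite -sumrB; apply: vanish_sum => i _; exact: psum_rowM.
rewrite /psum_row exchange_big; apply: eq_bigr => b _.
by rewrite ps_sumE rmorph_sum mulr_suml.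
Qed.
Lemma subst_cst c : subst (cst c) = cst c.
Proof.
apply/funext => i; apply/funext => j; rewrite substE /psum big_ord_recl.
rewrite big1 => [|a _]; last first.
  rewrite /psum_row big1 ?mul0r // => b _.
  by rewrite (_ : cst c _ _ = 0) ?rmorph0 ?mul0r //; rewrite /cst /=.
rewrite addr0 expr0 mulr1 /psum_row big_ord_recl expr0 mulr1 big1 ?addr0 // => b _.
by rewrite (_ : cst c _ _ = 0) ?rmorph0 ?mul0r.
Qed.
Lemma subst_mul : multiplicative subst.
Proof.
split=> [f f'|]; last by rewrite -(rmorph1 cst) subst_cst.
apply: J_all_eq => d.
have -> : subst (f * f') - subst f * subst f' =
  (subst (f * f') - psum d (f * f')) - (psum d f * psum d f' - psum d (f * f'))
  - (subst f * subst f' - psum d f * psum d f') by ring.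
apply: vanishB; first by apply: vanishB; [exact: subst_psum|exact: psumM].
by apply: (vanish_mul_congr addn_wtD); exact: subst_psum.
Qed.
HB.instance Definition _ := GRing.isAdditive.Build A A subst subst_add.
HB.instance Definition _ := GRing.isMultiplicative.Build A A subst subst_mul.

Lemma subst_J d f : J d f -> J d (subst f).
Proof.
move=> Jf; have -> : subst f = (subst f - psum d f) + psum d f by ring.
apply: vanishD; first exact: subst_psum.
apply: vanish_sum => a _; rewrite /psum_row mulr_suml; apply: vanish_sum => b _.
have [lt|ge] := ltnP (a + b) d; first by rewrite Jf // rmorph0 !mul0r.
rewrite -mulrA; apply: (vanishMl addn_wtD).
apply: (@vanishW _ (b + a)); first by rewrite addnC.
by apply: (vanishM addn_wtD); exact/J_pow/nc_J.
Qed.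
End Subst.

Lemma psum_pq D f : J D (f - psum pv qv D f).
Proof.
have ncp : nc pv = pv by apply: nc_id; exact: J1P.
have ncq : nc qv = qv by apply: nc_id; exact: J1P.
move=> i j lt; rewrite !ps_subE /psum bsumE.
have lt_i : (i < D)%N by lia.
have lt_j : (j < D)%N by lia.
rewrite (bigD1 (Ordinal lt_i)) //= big1 ?addr0 => [|a]; last first.
  rewrite -val_eqE /= => ne; rewrite /psum_row mulr_suml bsumE big1 // => b _.
  by rewrite ncp ncq -mulrA bcstM mulrC [qv ^+ _ * _]mulrC bmonoE eq_sym (negbTE ne) mul0r.
rewrite /psum_row mulr_suml bsumE (bigD1 (Ordinal lt_j)) //= big1 ?addr0 => [|b].
  by rewrite ncp ncq -mulrA bcstM [qv ^+ _ * _]mulrC bmonoE !eqxx mulr1 subrr.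
rewrite -val_eqE /= => ne.
by rewrite ncp ncq -mulrA bcstM [qv ^+ _ * _]mulrC bmonoE eqxx eq_sym (negbTE ne) mulr0.
Qed.

(** Respecting the order filtration is continuity, and polynomials in p and q are dense; a morphism
    is therefore known from its values at p and q. Composition of substitutions follows from
    this. *)
Lemma subst_uniq (Phi : {rmorphism A -> A}) f :
  (forall c, Phi (cst c) = cst c) -> (forall d u, J d u -> J d (Phi u)) ->
  Phi f = subst (Phi pv) (Phi qv) f.
Proof.
move=> Phic PhiJ; apply: J_all_eq => d.
have ncp : nc pv = pv by apply: nc_id; exact: J1P.
have ncq : nc qv = qv by apply: nc_id; exact: J1P.
have ncPp : nc (Phi pv) = Phi pv by apply/nc_id/PhiJ/J1P.
have ncPq : nc (Phi qv) = Phi qv by apply/nc_id/PhiJ/J1P.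
have -> : Phi f - subst (Phi pv) (Phi qv) f =
  Phi (f - psum pv qv d f) - (subst (Phi pv) (Phi qv) f - psum (Phi pv) (Phi qv) d f).
  have -> : psum (Phi pv) (Phi qv) d f = Phi (psum pv qv d f).
    rewrite /psum /psum_row rmorph_sum; apply: eq_bigr => a _.
    rewrite rmorphM rmorphXn ncp ncPp rmorph_sum; congr (_ * _).
    by apply: eq_bigr => b _; rewrite rmorphM rmorphXn Phic ncq ncPq.
  by rewrite rmorphB; ring.
by apply: vanishB; [exact/PhiJ/psum_pq|exact: subst_psum].
Qed.

Lemma subst_id f : subst pv qv f = f.
Proof. by rewrite -(@subst_uniq idfun). Qed.
Lemma pvE i j : pv i j = ((i == 1%N) && (j == 0%N))%:R.
Proof. by rewrite -bmonoE expr1 expr0 mulr1. Qed.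
Lemma qvE i j : qv i j = ((i == 0%N) && (j == 1%N))%:R.
Proof. by rewrite -bmonoE expr1 expr0 mul1r. Qed.
Lemma psum_mono g h D a b : (a < D)%N -> (b < D)%N ->
  psum g h D (pv ^+ a * qv ^+ b) = nc h ^+ b * nc g ^+ a.
Proof.
move=> aD bD; rewrite /psum (bigD1 (Ordinal aD)) //= big1 ?addr0 => [|a']; last first.
  rewrite -val_eqE /= => /negbTE ne; rewrite /psum_row big1 ?mul0r // => b' _.
  by rewrite bmonoE ne rmorph0 mul0r.
rewrite /psum_row (bigD1 (Ordinal bD)) //= big1 ?addr0 => [|b'].
  by rewrite bmonoE !eqxx rmorph1 mul1r.
by rewrite -val_eqE /= => /negbTE ne; rewrite bmonoE ne andbF rmorph0 mul0r.
Qed.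
Lemma subst_mono g h a b :
  subst g h (pv ^+ a * qv ^+ b) = nc h ^+ b * nc g ^+ a.
Proof.
apply: J_all_eq => d; rewrite -(@psum_mono _ _ (d + (a + b)).+1) ?ltnS; try lia.
by apply: (vanishW (d := (d + (a + b)).+1)); [lia|exact: subst_psum].
Qed.
Lemma subst_p g h : J 1 g -> subst g h pv = g.
Proof. by move=> Jg; have := subst_mono g h 1 0; rewrite !expr0 !expr1 mulr1 mul1r nc_id. Qed.
Lemma subst_q g h : J 1 h -> subst g h qv = h.
Proof. by move=> Jh; have := subst_mono g h 0 1; rewrite !expr0 !expr1 mulr1 mul1r nc_id. Qed.

Lemma subst_comp g h g' h' f : J 1 g -> J 1 h ->
  subst g' h' (subst g h f) = subst (subst g' h' g) (subst g' h' h) f.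
Proof.
move=> Jg Jh; pose Phi : {rmorphism A -> A} := subst g' h' \o subst g h.
have <- : Phi pv = subst g' h' g by congr (subst g' h' _); exact: subst_p.
have <- : Phi qv = subst g' h' h by congr (subst g' h' _); exact: subst_q.
rewrite -(@subst_uniq Phi f) // => [c|d u Ju].
  by rewrite -[LHS]/(subst g' h' (subst g h (cst c))) !subst_cst.
by apply: (@subst_J g' h'); apply: subst_J.
Qed.

(** Any superadditive weight is allowed: [J] serves for truncations, [X] for the contraction
    estimates of the linear equation. *)
Lemma subst_congr wt d g h g' h' f :
  (forall i j k l, (wt i j + wt k l <= wt (i + k) (j + l))%N) ->
  vanish wt d (g - g') -> vanish wt d (h - h') -> J 1 g -> J 1 h -> J 1 g' -> J 1 h' ->
  vanish wt d (subst g h f - subst g' h' f).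
Proof.
move=> wtD Vg Vh Jg Jh Jg' Jh' i j lt; rewrite !ps_subE !substE -!ps_subE.
move: i j lt (i + j).+1 => i j lt D; rewrite -[_ i j]/((psum g h D f - psum g' h' D f) i j).
move: i j lt; rewrite -/(vanish _ _ _) /psum -sumrB; apply: vanish_sum => a _.
rewrite !nc_id //; apply: (vanish_mul_congr wtD); last exact: vanish_exp_congr.
rewrite /psum_row -sumrB; apply: vanish_sum => b _; rewrite !nc_id //.
apply: (vanish_mul_congr wtD); last exact: vanish_exp_congr.
by rewrite subrr.
Qed.

Definition xv : A := pv * qv.
Lemma bxM d f i j :
  (xv ^+ d * f) i j = if (minn i j < d)%N then 0 else f (i - d)%N (j - d)%N.
Proof. by rewrite exprMn bmonoM gtn_min. Qed.
(** Division by x^d; monomials that x^d does not divide are dropped, which makes it total. *)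
Definition shx d f : A := fun i j => f (i + d)%N (j + d)%N.
Lemma shxK d f : X d f -> xv ^+ d * shx d f = f.
Proof.
move=> Xf; apply/funext => i; apply/funext => j; rewrite bxM.
by case: ltnP => [/Xf->//|]; rewrite leq_min /shx => /andP[? ?]; rewrite !subnK.
Qed.
Lemma xv_inj d f g : xv ^+ d * f = xv ^+ d * g -> f = g.
Proof.
move=> e; apply/funext => i; apply/funext => j.
have := congr1 (fun u : A => u (i + d)%N (j + d)%N) e; rewrite /= !bxM !addnK.
by rewrite (_ : (_ < d)%N = false) //; lia.
Qed.
Lemma X_xM d e f : X e f -> X (d + e) (xv ^+ d * f).
Proof.
by move=> Xf; apply: (vanishM minn_wtD) => // i j lt; rewrite -[xv ^+ d]mulr1 bxM lt.
Qed.
Lemma X_mulx_inv d e f : X (d + e) (xv ^+ d * f) -> X e f.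
Proof.
move=> H i j lt; have := H (i + d)%N (j + d)%N.
by rewrite bxM !addnK (_ : (_ < d)%N = false) => [->|] //; lia.
Qed.

Lemma J_p : J 1 pv. Proof. by apply: J1P; rewrite pvE. Qed.
Lemma J_q : J 1 qv. Proof. by apply: J1P; rewrite qvE. Qed.
Lemma J_x : J 1 xv. Proof. exact: (vanishMl addn_wtD) J_q. Qed.

Definition swap := subst qv pv.
Lemma swap_add : additive swap. Proof. exact: subst_add. Qed.
Lemma swap_mul : multiplicative swap. Proof. exact: subst_mul. Qed.
HB.instance Definition _ := GRing.isAdditive.Build A A swap swap_add.
HB.instance Definition _ := GRing.isMultiplicative.Build A A swap swap_mul.
Lemma swap_p : swap pv = qv. Proof. exact/subst_p/J_q. Qed.
Lemma swap_q : swap qv = pv. Proof. exact/subst_q/J_p. Qed.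
Lemma swap_x : swap xv = xv.
Proof. by rewrite rmorphM /= swap_p swap_q mulrC. Qed.
Lemma swapE f i j : swap f i j = f j i.
Proof.
have := @subst_psum qv pv _ f i j (ltnSn _); rewrite -/(swap f) ps_subE ps_subE.
move/eqP; rewrite subr_eq0 => /eqP ->.
have := @psum_pq (i + j).+1 f j i; rewrite addnC ltnSn ps_subE ps_subE => /(_ isT).
move/eqP; rewrite subr_eq0 => /eqP ->.
have ncp : nc pv = pv by apply: nc_id; exact: J1P.
have ncq : nc qv = qv by apply: nc_id; exact: J1P.
rewrite /psum ncp ncq [LHS]bsumE [RHS]bsumE. apply: eq_bigr => a _.
rewrite /psum_row ncp ncq. rewrite ![in LHS]mulr_suml. rewrite ![in RHS]mulr_suml. rewrite [LHS]bsumE [RHS]bsumE; apply: eq_bigr => b _.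
rewrite -[in LHS]mulrA -[in RHS]mulrA [LHS]bcstM [RHS]bcstM. congr (_ * _).
rewrite [LHS]bmonoE. rewrite [X in _ = X j i]mulrC [RHS]bmonoE andbC //.
Qed.
Lemma swapK f : swap (swap f) = f.
Proof. by apply/funext => i; apply/funext => j; rewrite !swapE. Qed.
Lemma swap_subst g h f : J 1 g -> J 1 h ->
  swap (subst g h f) = subst (swap g) (swap h) f.
Proof. exact: subst_comp. Qed.

End Bivariate.

Notation J := (vanish addn).
Notation X := (vanish minn).

(** * Exponential, logarithm and diagonal series *)

Section ExpLog.
Variable K : numFieldType.
Notation A := (ps (ps K)).
Implicit Types f g h u : A.
Notation p := (@pv K).
Notation q := (@qv K).
Notation x := (@xv K).
Notation cst := (@cst K).

(** The Euler operator p d/dp + q d/dq. It is a derivation that kills only constants, so identities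
    between exponentials are proved by applying it and comparing constant terms. *)
Definition theta f : A := fun i j => (i + j)%:R * f i j.
Definition theta_inv f : A := fun i j => f i j / (i + j)%:R.

Lemma theta_add : additive theta.
Proof.
move=> f g; apply/funext => i; apply/funext => j.
by rewrite !ps_subE /theta !ps_subE mulrBr.
Qed.
HB.instance Definition _ := GRing.isAdditive.Build A A theta theta_add.
Lemma thetaM f g : theta (f * g) = theta f * g + f * theta g.
Proof.
apply/funext => i; apply/funext => j.
rewrite !ps_addE /theta !bmulE mulr_sumr -big_split; apply: eq_bigr => a _ /=.
rewrite mulr_sumr -big_split; apply: eq_bigr => b _ /=.
have -> : (i + j)%:R = (a + b)%:R + ((i - a) + (j - b))%:R :> K.
  by rewrite -natrD; congr (_%:R); have := ltn_ord a; have := ltn_ord b; lia.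
ring.
Qed.
Lemma theta_cst c : theta (cst c) = 0.
Proof.
apply/funext => i; apply/funext => j; rewrite /theta bcstE.
by case: i j => [|i] [|j]; rewrite ?mul0r ?mulr0.
Qed.
Lemma theta_J d f : J d f -> J d (theta f).
Proof. by move=> Jf i j lt; rewrite /theta Jf // mulr0. Qed.
Lemma theta_eq0 f : theta f = 0 -> f = cst (f 0%N 0%N).
Proof.
move=> e; apply/funext => i; apply/funext => j; rewrite bcstE.
case: ifP => [/andP[/eqP-> /eqP->] //|ne].
have /eqP := congr1 (fun u : A => u i j) e; rewrite /theta !ps_0E mulf_eq0 pnatr_eq0.
by rewrite addn_eq0 ne => /eqP.
Qed.
Lemma theta_invK f : J 1 f -> theta (theta_inv f) = f.
Proof.
move=> Jf; apply/funext => i; apply/funext => j; rewrite /theta /theta_inv.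
have [e|ne] := eqVneq (i + j)%N 0%N; first by rewrite e mul0r Jf ?e.
by rewrite mulrCA divff ?mulr1 // pnatr_eq0.
Qed.
Lemma theta_inv_J f : J 1 (theta_inv f).
Proof. by apply: J1P; rewrite /theta_inv invr0 mulr0. Qed.

Lemma thetaXn f n : theta (f ^+ n.+1) = cst n.+1%:R * theta f * f ^+ n.
Proof.
elim: n => [|n IH]; first by rewrite expr1 expr0 rmorph1 mul1r mulr1.
by rewrite exprS thetaM IH !rmorph_nat -[in RHS]natr1 [f ^+ n.+1]exprS; ring.
Qed.

(** One-variable series are embedded as series in p, so that [bapp c f], the sum of the c_n f^n, is
    a substitution and inherits its rules. *)
Definition uni (c : nat -> K) : A := fun i j => if j == 0%N then c i else 0.
Definition bapp (c : nat -> K) f : A := subst f 0 (uni c).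
Lemma J0 d : J d (0 : A). Proof. by []. Qed.
Lemma bapp_psum c f d : J 1 f -> J d (bapp c f - \sum_(k < d) cst (c k) * f ^+ k).
Proof.
move=> Jf; have -> : \sum_(k < d) cst (c k) * f ^+ k = psum f 0 d (uni c).
  rewrite /psum; apply: eq_bigr => k _; rewrite !nc_id //; congr (_ * _).
  have d0 : (0 < d)%N by apply: leq_ltn_trans (ltn_ord k).
  rewrite /psum_row (bigD1 (Ordinal d0)) //= big1 ?addr0 => [|b].
    by rewrite expr0 mulr1.
  by rewrite -val_eqE /= /uni => /negbTE ->; rewrite rmorph0 mul0r.
exact: subst_psum.
Qed.
Lemma bapp00 c f : J 1 f -> bapp c f 0%N 0%N = c 0%N.
Proof.
move=> Jf; have := @bapp_psum c f 1 Jf 0%N 0%N isT.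
rewrite !ps_subE big_ord1 expr0 mulr1 => /eqP; rewrite subr_eq0 => /eqP ->.
by rewrite bcstE.
Qed.
Lemma subst_bapp g h c f : J 1 f -> subst g h (bapp c f) = bapp c (subst g h f).
Proof.
move=> Jf; have e : subst g h (0 : A) = 0 by exact: rmorph0.
rewrite /bapp -[in RHS]e.
by apply: (subst_comp _ _ _ Jf); exact: vanish0.
Qed.

Definition bexp := bapp (fun k => (k`!)%:R^-1).

Lemma theta_bexp f : J 1 f -> theta (bexp f) = theta f * bexp f.
Proof.
move=> Jf; apply: J_all_eq => d.
pose T n := \sum_(k < n) cst (k`!)%:R^-1 * f ^+ k.
have JT n : J n (bexp f - T n) by exact: bapp_psum.
have eT : theta (T d.+1) = theta f * T d.
  rewrite /T big_ord_recl raddfD /= expr0 mulr1 theta_cst add0r raddf_sum mulr_sumr /=.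
  apply: eq_bigr => k _; rewrite thetaM theta_cst mul0r add0r /bump /= add1n thetaXn.
  have <- : cst (k.+1`!)%:R^-1 * cst k.+1%:R = cst (k`!)%:R^-1.
    by rewrite -rmorphM factS natrM invfM mulrAC mulVf ?mul1r // pnatr_eq0.
  ring.
have -> : theta (bexp f) - theta f * bexp f =
    theta (bexp f - T d.+1) - theta f * (bexp f - T d).
  by rewrite raddfB /= eT; ring.
apply: vanishB; last exact/(vanishMl addn_wtD)/JT.
by apply: (vanishW (d := d.+1)) => //; exact/theta_J/JT.
Qed.
Lemma thetaN f : theta (- f) = - theta f. Proof. exact: raddfN. Qed.
Lemma thetaD f g : theta (f + g) = theta f + theta g. Proof. exact: raddfD. Qed.
Lemma bexp_00 f : J 1 f -> bexp f 0%N 0%N = 1.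
Proof. by move=> Jf; rewrite /bexp bapp00 // invr1. Qed.
Lemma theta1 : theta 1 = 0.
Proof. by rewrite -(rmorph1 cst) theta_cst. Qed.
Lemma b00M f g : (f * g) 0%N 0%N = f 0%N 0%N * g 0%N 0%N.
Proof. by rewrite bmulE !big_ord1. Qed.
Lemma J1N f : J 1 f -> J 1 (- f). Proof. exact: vanishN. Qed.
Lemma bexpNK f : J 1 f -> bexp (- f) * bexp f = 1.
Proof.
move=> Jf; have JNf := J1N Jf; rewrite [LHS]theta_eq0.
  by rewrite b00M !bexp_00 // mulr1 rmorph1.
rewrite thetaM. rewrite (theta_bexp Jf). rewrite (theta_bexp JNf). rewrite thetaN. ring.
Qed.
Lemma bexpD f g : J 1 f -> J 1 g -> bexp (f + g) = bexp f * bexp g.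
Proof.
move=> Jf Jg; have JD := vanishD Jf Jg.
have e : bexp (f + g) * bexp (- f) * bexp (- g) = 1.
  rewrite [LHS]theta_eq0; first by rewrite !b00M !bexp_00 ?mulr1 ?rmorph1 //; exact: J1N.
  have [JNf JNg] := (J1N Jf, J1N Jg).
  rewrite !thetaM (theta_bexp JD) (theta_bexp JNf) (theta_bexp JNg).
  by rewrite !thetaN thetaD; ring.
rewrite -[LHS]mulr1 -(bexpNK Jf) -[LHS]mulr1 -(bexpNK Jg).
transitivity ((bexp (f + g) * bexp (- f) * bexp (- g)) * (bexp f * bexp g)); first by ring.
by rewrite e mul1r.
Qed.
Lemma bexp_eqcst f c : J 1 f -> bexp f = cst c -> f = 0.
Proof.
move=> Jf e; have := theta_bexp Jf; rewrite e theta_cst => /esym t0.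
have /(congr1 (fun u => u * bexp (- f))) := t0.
rewrite -e mul0r -mulrA [bexp f * _]mulrC bexpNK // mulr1 => /theta_eq0 ->.
by rewrite Jf // rmorph0.
Qed.
Lemma bexp0 : bexp 0 = 1.
Proof.
rewrite [LHS]theta_eq0; first by rewrite bexp_00 // rmorph1.
by rewrite (theta_bexp (J0 (d := 1))) raddf0 mul0r.
Qed.
Lemma bexpMn f n : J 1 f -> bexp (f *+ n) = bexp f ^+ n.
Proof.
move=> Jf; have Jn m : J 1 (f *+ m).
  by elim: m => [|m IH]; rewrite ?mulr0n ?mulrS //; apply: vanishD.
elim: n => [|n IH]; first by rewrite mulr0n bexp0.
by rewrite mulrS bexpD // IH exprS.
Qed.

Definition binv f : A := let c := (f 0%N 0%N)^-1 in
  cst c * bapp (fun=> 1) (1 - cst c * f).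
Lemma geo_uni : (1 - p) * uni (fun=> 1) = 1.
Proof.
apply/funext => i; apply/funext => j.
have := bmonoM (uni (fun=> 1)) 1 0 i j; rewrite expr1 expr0 mulr1 => e.
rewrite mulrBl mul1r !ps_subE e /uni b1E ltn0 orbF.
by case: i j {e} => [|i] [|j]; rewrite ?subr0 ?subrr //= ?subn0 ?subr0 ?subrr.
Qed.
Lemma binvJ f : f 0%N 0%N != 0 -> J 1 (1 - cst (f 0%N 0%N)^-1 * f).
Proof.
move=> f0; apply: J1P; rewrite !ps_subE bcstM mulVf // b1E /=.
by rewrite subrr.
Qed.
Lemma mulbV f : f 0%N 0%N != 0 -> f * binv f = 1.
Proof.
move=> f0; rewrite /binv; set c := _^-1.
have Ju : J 1 (1 - cst c * f) by exact: binvJ.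
have := congr1 (subst (1 - cst c * f) 0) geo_uni.
rewrite rmorphM rmorphB /= rmorph1 subst_p // -/(bapp _ _) => e; rewrite -[RHS]e; ring.
Qed.
Lemma binv_00 f : f 0%N 0%N != 0 -> binv f 0%N 0%N = (f 0%N 0%N)^-1.
Proof.
move=> f0; have := congr1 (fun u : A => u 0%N 0%N) (mulbV f0).
rewrite /= b00M b1E /= => e.
by apply: (mulfI f0); rewrite e mulfV.
Qed.
Lemma bmul_cancel f g h : f 0%N 0%N != 0 -> f * g = f * h -> g = h.
Proof.
move=> f0 e; rewrite -[g]mul1r -[h]mul1r -(mulbV f0) mulrAC e; ring.
Qed.

(** The Euler primitive of the logarithmic derivative. Division by the degree only decreases
    coefficients and keeps the diagonal, so convergence and diagonality come directly from those of
    the quotient. *)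
Definition blog f : A := theta_inv (theta f * binv f).
Lemma blog_J f : J 1 (blog f). Proof. exact: theta_inv_J. Qed.
Lemma theta00 f : J 1 (theta f).
Proof. by apply: J1P; rewrite /theta mul0r. Qed.
Lemma blogK f : f 0%N 0%N = 1 -> bexp (blog f) = f.
Proof.
move=> f1; have f0 : f 0%N 0%N != 0 by rewrite f1 oner_eq0.
have Jl := @blog_J f; have JN := J1N Jl.
have e : bexp (- blog f) * f = 1.
  rewrite [LHS]theta_eq0; first by rewrite b00M bexp_00 // f1 mulr1 rmorph1.
  rewrite thetaM (theta_bexp JN) thetaN theta_invK; last first.
    by apply: (vanishMr addn_wtD); exact: theta00.
  transitivity (bexp (- blog f) * theta f * (1 - f * binv f)); first by ring.
  by rewrite mulbV // subrr mulr0.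
by rewrite -[LHS]mulr1 -e mulrA [bexp _ * _]mulrC bexpNK // mul1r.
Qed.
Lemma bexp_inj f g : J 1 f -> J 1 g -> bexp f = bexp g -> f = g.
Proof.
move=> Jf Jg e; apply/eqP; rewrite -subr_eq0; apply/eqP.
have JN := J1N Jg; apply: (@bexp_eqcst _ 1); first exact: vanishB.
by rewrite bexpD // e mulrC bexpNK // rmorph1.
Qed.

Definition diag f := forall i j, i != j -> f i j = 0.
Lemma diag_cst c : diag (cst c).
Proof. by move=> [|i] [|j] //; rewrite bcstE. Qed.
Lemma diagD f g : diag f -> diag g -> diag (f + g).
Proof. by move=> df dg i j ne; rewrite !ps_addE df // dg // addr0. Qed.
Lemma diagN f : diag f -> diag (- f).
Proof. by move=> df i j ne; rewrite !ps_oppE df // oppr0. Qed.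
Lemma diagB f g : diag f -> diag g -> diag (f - g).
Proof. by move=> df dg; apply/diagD/diagN. Qed.
Lemma diag0 : diag 0. Proof. by []. Qed.
Lemma diag1 : diag 1. Proof. by rewrite -(rmorph1 cst); exact: diag_cst. Qed.
Lemma diag_sum (I : Type) (r : seq I) (P : pred I) (F : I -> A) :
  (forall i, P i -> diag (F i)) -> diag (\sum_(i <- r | P i) F i).
Proof. by move=> H; elim/big_ind: _ => //; exact: diagD. Qed.
Lemma diagM f g : diag f -> diag g -> diag (f * g).
Proof.
move=> df dg i j ne; rewrite bmulE big1 // => a _; rewrite big1 // => b _.
have [e|nab] := eqVneq (a : nat) b; last by rewrite df // mul0r.
by rewrite dg ?mulr0 //; have := ltn_ord a; have := ltn_ord b; lia.
Qed.
Lemma diagX f n : diag f -> diag (f ^+ n).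
Proof. by move=> df; elim: n => [|n IH]; [exact: diag1|rewrite exprS; exact: diagM]. Qed.
Lemma diag_x : diag x.
Proof.
move=> i j ne; rewrite -[x]mulr1 -[x]expr1 bxM b1E.
by case: ifP => // H; case: ifP => // H'; lia.
Qed.
Lemma diag_theta f : diag f -> diag (theta f).
Proof. by move=> df i j ne; rewrite /theta df // mulr0. Qed.
Lemma diag_theta_inv f : diag f -> diag (theta_inv f).
Proof. by move=> df i j ne; rewrite /theta_inv df // mul0r. Qed.
Lemma diag_nc f : diag f -> diag (nc f).
Proof. by move=> df; apply: diagB => //; exact: diag_cst. Qed.
Lemma diag_bapp c f : diag f -> diag (bapp c f).
Proof.
move=> df i j ne; rewrite /bapp substE.
move: i j ne (i + j).+1 => i j ne D; move: i j ne; rewrite -/(diag _).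
apply: diag_sum => a _; apply: diagM; last exact/diagX/diag_nc.
by apply: diag_sum => b _; apply: diagM; [exact: diag_cst|exact/diagX/diag_nc/diag0].
Qed.
Lemma diag_binv f : diag f -> diag (binv f).
Proof.
move=> df; apply: diagM; first exact: diag_cst.
by apply: diag_bapp; apply: diagB; [exact: diag1|apply: diagM => //; exact: diag_cst].
Qed.
Lemma diag_blog f : diag f -> diag (blog f).
Proof.
move=> df; apply: diag_theta_inv; apply: diagM; last exact: diag_binv.
exact: diag_theta.
Qed.
(** Each power x^a goes to (gh)^a = x^a. Diagonal series thus behave as scalars for [swap] and for
    all the scalings used later. *)
Lemma subst_diag f g h : J 1 g -> J 1 h -> g * h = x -> diag f -> subst g h f = f.
Proof.
move=> Jg Jh e df; rewrite -[RHS]subst_id; apply: J_all_eq => d.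
have aux u v : J 1 u -> J 1 v -> u * v = x ->
    psum u v d f = \sum_(a < d) cst (f a a) * x ^+ a.
  move=> Ju Jv euv; apply: eq_bigr => a _.
  rewrite /psum_row (bigD1 a) //= big1 => [|b]; last first.
    by rewrite -val_eqE /= => ne; rewrite df ?rmorph0 ?mul0r // eq_sym.
  by rewrite addr0 !nc_id // -euv exprMn; ring.
have Jp : J 1 p by apply: J1P.
have Jq : J 1 q by apply: J1P.
have -> : subst g h f - subst p q f =
  (subst g h f - psum g h d f) - (subst p q f - psum p q d f).
  by rewrite (aux g h) // (aux p q) //; ring.
by apply: vanishB; exact: subst_psum.
Qed.

Variable phi : {rmorphism K -> K}.
Definition bmap f : A := fun i j => phi (f i j).
Lemma bmap_add : additive bmap.
Proof.
move=> f g; apply/funext => i; apply/funext => j.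
by rewrite !ps_subE /bmap !ps_subE rmorphB.
Qed.
Lemma bmap_mul : multiplicative bmap.
Proof.
split=> [f g|]; apply/funext => i; apply/funext => j.
  rewrite /bmap !bmulE rmorph_sum; apply: eq_bigr => a _.
  by rewrite rmorph_sum; apply: eq_bigr => b _; rewrite rmorphM.
by rewrite /bmap !b1E; case: ifP => _; [exact: rmorph1|exact: rmorph0].
Qed.
HB.instance Definition _ := GRing.isAdditive.Build A A bmap bmap_add.
HB.instance Definition _ := GRing.isMultiplicative.Build A A bmap bmap_mul.
Lemma bmap_cst c : bmap (cst c) = cst (phi c).
Proof.
apply/funext => i; apply/funext => j; rewrite /bmap !bcstE.
by case: ifP; rewrite ?rmorph0.
Qed.
Lemma bmap_p : bmap p = p.
Proof. by apply/funext => i; apply/funext => j; rewrite /bmap pvE rmorph_nat. Qed.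
Lemma bmap_q : bmap q = q.
Proof. by apply/funext => i; apply/funext => j; rewrite /bmap qvE rmorph_nat. Qed.
Lemma bmap_x : bmap x = x.
Proof. by rewrite rmorphM /= bmap_p bmap_q. Qed.
Lemma bmap_nc f : bmap (nc f) = nc (bmap f).
Proof. by rewrite /nc rmorphB /= bmap_cst. Qed.
Lemma bmap_vanish wt d f : vanish wt d f -> vanish wt d (bmap f).
Proof. by move=> Vf i j lt; rewrite /bmap Vf // rmorph0. Qed.
Lemma bmap_diag f : diag f -> diag (bmap f).
Proof. by move=> df i j ne; rewrite /bmap df // rmorph0. Qed.
Lemma bmap_subst g h f : bmap (subst g h f) = subst (bmap g) (bmap h) (bmap f).
Proof.
apply/funext => i; apply/funext => j; rewrite {1}/bmap !substE.
rewrite -[LHS]/(bmap (psum g h (i + j).+1 f) i j); congr (_ i j).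
rewrite /psum /psum_row rmorph_sum; apply: eq_bigr => a _.
rewrite rmorphM rmorphXn rmorph_sum /= bmap_nc !mulr_suml; apply: eq_bigr => b _.
by rewrite rmorphM rmorphXn /= bmap_cst bmap_nc.
Qed.
Lemma bmap_bexp f : bmap (bexp f) = bexp (bmap f).
Proof.
rewrite /bexp /bapp bmap_subst rmorph0; congr (subst _ _ _).
apply/funext => i; apply/funext => j; rewrite /bmap /uni.
by case: ifP; rewrite ?rmorph0 // fmorphV rmorph_nat.
Qed.

End ExpLog.

(** Agreement below weight d improves to agreement up to d, so the iterates stabilise at each
    weight. The comparison with the iterates is what transfers norm bounds and polynomial dependence
    on a parameter to the fixed point. *)
Lemma contraction_fix (T U : Type) (u0 : U) (wt : T -> nat) (F : (T -> U) -> T -> U) :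
  (forall d f g, (forall t, (wt t < d)%N -> f t = g t) ->
     forall t, (wt t <= d)%N -> F f t = F g t) ->
  exists2 f, F f = f & forall n t, (wt t < n)%N -> f t = iter n F (fun=> u0) t.
Proof.
move=> HF; pose it n := iter n F (fun=> u0).
have stab n k : forall t, (wt t < n)%N -> it (n + k)%N t = it n t.
  elim: n => [//|n IH] t lt; rewrite addSn /it !iterS.
  exact: (HF n).
pose f t := it (wt t).+1 t.
have fE n t : (wt t < n)%N -> f t = it n t.
  by move=> lt; rewrite /f -(stab _ (n - (wt t).+1)%N) // subnKC.
exists f => //; apply/funext => t.
rewrite (fE (wt t).+1) // /it iterS; apply: (HF (wt t)) => // t' lt'.
exact: fE.
Qed.

(** * Weighted norms and convergence *)

Section Norm.
Variable K : numFieldType.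
Notation A := (ps (ps K)).
Implicit Types f g h u : A.
Notation p := (@pv K).
Notation q := (@qv K).
Notation x := (@xv K).
Notation cst := (@cst K).

(** A weighted l^1 norm cut off to a square of side [D]: it is a finite sum, so no completeness of
    [K] is involved, and convergence is a bound uniform in [D]. *)
Definition bnorm D (r : K) f : K := \sum_(i < D) \sum_(j < D) `|f i j| * r ^+ (i + j).

Definition conv f := exists r M : K, 0 < r /\ forall D, bnorm D r f <= M.

Section Fixed.
Variables (D : nat) (r : K).
Hypothesis r0 : 0 <= r.
Notation N := (bnorm D r).

Lemma bnorm_ge0 f : 0 <= N f.
Proof.
by apply: sumr_ge0 => i _; apply: sumr_ge0 => j _; rewrite mulr_ge0 // exprn_ge0.
Qed.
Lemma bnormD f g : N (f + g) <= N f + N g.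
Proof.
rewrite -big_split; apply: ler_sum => i _; rewrite -big_split; apply: ler_sum => j _ /=.
by rewrite -mulrDl ler_wpM2r ?exprn_ge0 // !ps_addE ler_normD.
Qed.
Lemma bnorm0 : N 0 = 0.
Proof. by rewrite /bnorm big1 // => i _; rewrite big1 // => j _; rewrite normr0 mul0r. Qed.
Lemma bnormN f : N (- f) = N f.
Proof.
by apply: eq_bigr => i _; apply: eq_bigr => j _; rewrite !ps_oppE normrN.
Qed.
Lemma bnorm_sum n (F : 'I_n -> A) : N (\sum_i F i) <= \sum_i N (F i).
Proof.
elim/big_rec2: _ => [|i y u _ le]; first by rewrite bnorm0.
by apply: le_trans (bnormD _ _) _; rewrite lerD2l.
Qed.
Lemma bnormM f g : N (f * g) <= N f * N g.
Proof.
pose F i j := `|f i j| * r ^+ (i + j); pose G i j := `|g i j| * r ^+ (i + j).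
pose conv2 i j : K := \sum_(a < i.+1) \sum_(b < j.+1) F a b * G (i - a)%N (j - b)%N.
have F0 i j : 0 <= F i j by rewrite mulr_ge0 ?exprn_ge0.
have G0 i j : 0 <= G i j by rewrite mulr_ge0 ?exprn_ge0.
apply: (@le_trans _ _ (\sum_(i < D) \sum_(j < D) conv2 i j)).
  apply: ler_sum => i _; apply: ler_sum => j _; rewrite bmulE.
  apply: (@le_trans _ _ ((\sum_(a < i.+1) \sum_(b < j.+1) `|f a b| * `|g (i - a)%N (j - b)%N|) * r ^+ (i + j))).
    rewrite ler_wpM2r ?exprn_ge0 //; apply: le_trans (ler_norm_sum _ _ _) _.
    apply: ler_sum => a _; apply: le_trans (ler_norm_sum _ _ _) _.
    by apply: ler_sum => b _; rewrite normrM.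
  rewrite mulr_suml; apply: ler_sum => a _; rewrite mulr_suml; apply: ler_sum => b _.
  rewrite /F /G mulrACA -exprD le_eqVlt; apply/orP; left; apply/eqP.
  by congr (_ * _ ^+ _); have := ltn_ord a; have := ltn_ord b; lia.
(* The truncated Cauchy product is part of the product of the truncated sums. It is applied in each
   of the two indices in turn. *)
have cauchy (s t : nat -> K) : (forall i, 0 <= s i) -> (forall i, 0 <= t i) ->
    \sum_(i < D) \sum_(a < i.+1) s a * t (i - a)%N <= (\sum_(i < D) s i) * (\sum_(i < D) t i).
  move=> s0 t0; rewrite -[leRHS]mul1r.
  have E (n : nat) (w : nat -> K) : (\poly_(i < n) w i).[1] = \sum_(i < n) w i.
    by rewrite horner_poly; apply: eq_bigr => i _; rewrite expr1n mulr1.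
  rewrite mul1r -!E -hornerM.
  set P := _ * _; rewrite (horner_coef_wide (n := (D + D).+1) 1); last first.
    apply: leq_trans (size_polyMleq _ _) _; apply: leq_trans (leq_pred _) _.
    exact: leqW (leq_add (size_poly _ _) (size_poly _ _)).
  rewrite -(big_mkord xpredT (fun i => P`_i * 1 ^+ i)) (big_cat_nat (n := D)) //=; last by lia.
  rewrite big_mkord; apply: ler_wpDr.
    apply: sumr_ge0 => i _; rewrite expr1n mulr1 /P coefM; apply: sumr_ge0 => a _.
    by rewrite !coef_poly; case: ifP; case: ifP; rewrite ?mulr0 ?mul0r // mulr_ge0.
  apply: ler_sum => i _; rewrite expr1n mulr1 /P coefM; apply: ler_sum => a _.
  rewrite !coef_poly !ifT //; first by have := ltn_ord i; have := ltn_ord a; lia.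
  by have := ltn_ord i; have := ltn_ord a; lia.
have -> : N f = \sum_(a < D) \sum_(b < D) F a b by [].
have -> : N g = \sum_(a < D) \sum_(b < D) G a b by [].
apply: (@le_trans _ _ (\sum_(i < D) \sum_(a < i.+1) (\sum_(b < D) F a b) * (\sum_(b < D) G (i - a)%N b))).
  apply: ler_sum => i _; rewrite exchange_big /=; apply: ler_sum => a _.
  exact: cauchy.
by apply: (cauchy (fun a => \sum_(b < D) F a b) (fun a => \sum_(b < D) G a b)) => i;
  apply: sumr_ge0.
Qed.
Lemma bnormX f n : (0 < n)%N -> N (f ^+ n) <= N f ^+ n.
Proof.
case: n => // n _; elim: n => [|n IH]; first by rewrite !expr1.
rewrite exprS [leRHS]exprS; apply: le_trans (bnormM _ _) _.
by rewrite ler_wpM2l // bnorm_ge0.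
Qed.
Lemma bnorm_cst c : N (cst c) <= `|c|.
Proof.
case: (posnP D) => [D0|D0]; first by rewrite /bnorm D0 big_ord0.
rewrite /bnorm (bigD1 (Ordinal D0)) //= (bigD1 (Ordinal D0)) //= bcstE /= expr0 mulr1.
rewrite big1 => [|j]; last by rewrite -val_eqE /= => /negbTE e; rewrite bcstE e normr0 mul0r.
rewrite big1 ?addr0 // => i; rewrite -val_eqE /= => /negbTE e.
by rewrite big1 // => j _; rewrite bcstE e normr0 mul0r.
Qed.
Lemma bnorm1 : N 1 <= 1.
Proof. by have := bnorm_cst 1; rewrite rmorph1 normr1. Qed.
Lemma bnormX' f n c : N f <= c -> N (f ^+ n) <= c ^+ n.
Proof.
move=> le; case: n => [|n]; first by rewrite !expr0 bnorm1.
by apply: le_trans (bnormX _ _) _ => //; rewrite lerXn2r ?nnegrE ?bnorm_ge0 // (le_trans (bnorm_ge0 _) le).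
Qed.
Lemma bnorm_nc f : N (nc f) <= N f.
Proof.
apply: ler_sum => i _; apply: ler_sum => j _; rewrite ler_wpM2r ?exprn_ge0 //.
rewrite /nc !ps_subE bcstE; case: ifP => [/andP[/eqP-> /eqP->]|]; last by rewrite subr0.
by rewrite subrr normr0.
Qed.
Lemma bnorm_congr f g : J (D + D) (f - g) -> N f = N g.
Proof.
move=> H; apply: eq_bigr => i _; apply: eq_bigr => j _; congr (`|_| * _).
have := H i j; rewrite !ps_subE => e; apply/eqP; rewrite -subr_eq0 e //.
by have := ltn_ord i; have := ltn_ord j; lia.
Qed.
(** Coefficients in the square of side [D] have total degree less than [D + D], whence the larger
    truncation on the right. *)
Lemma bnorm_subst g h f c : N (nc g) <= c -> N (nc h) <= c ->
  N (subst g h f) <= bnorm (D + D) c f.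
Proof.
move=> leg leh; rewrite (@bnorm_congr _ (psum g h (D + D) f)); last exact: subst_psum.
have c0 : 0 <= c := le_trans (bnorm_ge0 _) leg.
apply: le_trans (bnorm_sum _) _; apply: ler_sum => a _.
rewrite /psum_row mulr_suml; apply: le_trans (bnorm_sum _) _; apply: ler_sum => b _.
apply: le_trans (bnormM _ _) _; rewrite addnC exprD mulrA.
apply: ler_pM; rewrite ?bnorm_ge0 //; last exact: bnormX'.
apply: le_trans (bnormM _ _) _; apply: ler_pM; rewrite ?bnorm_ge0 //.
  exact: bnorm_cst.
exact: bnormX'.
Qed.
Lemma bnorm_p : N p <= r.
Proof.
rewrite /bnorm; case: (ltnP 1 D) => [D1|D1]; last first.
  rewrite big1 // => i _; rewrite big1 // => j _.
  by rewrite pvE (_ : _ && _ = false) ?normr0 ?mul0r //; have := ltn_ord i; lia.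
have D0 : (0 < D)%N by lia.
rewrite (bigD1 (Ordinal D1)) //= (bigD1 (Ordinal D0)) //= pvE /= normr1 mul1r expr1.
rewrite big1 => [|j]; last by rewrite -val_eqE /= => /negbTE e; rewrite pvE e normr0 mul0r.
rewrite big1 ?addr0 // => i; rewrite -val_eqE /= => /negbTE e.
by rewrite big1 // => j _; rewrite pvE e normr0 mul0r.
Qed.
Lemma bnorm_q : N q <= r.
Proof.
rewrite /bnorm; case: (ltnP 1 D) => [D1|D1]; last first.
  rewrite big1 // => i _; rewrite big1 // => j _.
  by rewrite qvE (_ : _ && _ = false) ?normr0 ?mul0r //; have := ltn_ord j; lia.
have D0 : (0 < D)%N by lia.
rewrite (bigD1 (Ordinal D0)) //= (bigD1 (Ordinal D1)) //= qvE /= normr1 mul1r expr1.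
rewrite big1 => [|j]; last by rewrite -val_eqE /= => /negbTE e; rewrite qvE e andbF normr0 mul0r.
rewrite big1 ?addr0 // => i; rewrite -val_eqE /= => /negbTE e.
by rewrite big1 // => j _; rewrite qvE e normr0 mul0r.
Qed.
Lemma bnorm_scale k f c : 0 <= c <= 1 -> J k f ->
  bnorm D (c * r) f <= c ^+ k * N f.
Proof.
move=> /andP[c0 c1] Jf; rewrite mulr_sumr; apply: ler_sum => i _.
rewrite mulr_sumr; apply: ler_sum => j _.
have [lt|ge] := ltnP (i + j) k; first by rewrite Jf // normr0 !mul0r mulr0.
rewrite exprMn mulrCA ler_wpM2r ?mulr_ge0 ?exprn_ge0 //.
by rewrite ler_wiXn2l.
Qed.
End Fixed.

Lemma bnorm_le D r r' f : 0 <= r -> r <= r' -> bnorm D r f <= bnorm D r' f.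
Proof.
move=> r0 le; apply: ler_sum => i _; apply: ler_sum => j _.
by rewrite ler_wpM2l // lerXn2r ?nnegrE // (le_trans r0).
Qed.

(** The order of a numeric field is only partial, so r r' / (r + r') takes the place of a
    minimum. *)
Lemma common_r (r r' : K) : 0 < r -> 0 < r' -> exists s, [/\ 0 < s, s <= r & s <= r'].
Proof.
move=> r0 r'0; have s0 : 0 < r + r' by rewrite addr_gt0.
exists (r * r' / (r + r')); split; first by rewrite divr_gt0 // mulr_gt0.
  by rewrite ler_pdivrMr // ler_pM2l // ler_wpDl // ltW.
by rewrite ler_pdivrMr // mulrC ler_pM2l // ler_wpDr // ltW.
Qed.

Lemma conv2 f g : conv f -> conv g ->
  exists r M, [/\ 0 < r, forall D, bnorm D r f <= M & forall D, bnorm D r g <= M].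
Proof.
move=> [r [M [r0 Hf]]] [r' [M' [r'0 Hg]]].
have [s [s0 sr sr']] := common_r r0 r'0; exists s, (M + M').
have M0 : 0 <= M by apply: le_trans (Hf 0%N); rewrite bnorm_ge0 // ltW.
have M'0 : 0 <= M' by apply: le_trans (Hg 0%N); rewrite bnorm_ge0 // ltW.
split=> // D.
  by apply: le_trans (bnorm_le _ _ (ltW s0) sr) _; rewrite ler_wpDr.
by apply: le_trans (bnorm_le _ _ (ltW s0) sr') _; rewrite ler_wpDl.
Qed.

Lemma convD f g : conv f -> conv g -> conv (f + g).
Proof.
move=> cf cg; have [r [M [r0 Hf Hg]]] := conv2 cf cg; exists r, (M + M).
by split=> // D; apply: le_trans (bnormD _ (ltW r0) _ _) _; rewrite lerD.
Qed.
Lemma convN f : conv f -> conv (- f).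
Proof. by move=> [r [M [r0 H]]]; exists r, M; split=> // D; rewrite bnormN. Qed.
Lemma convB f g : conv f -> conv g -> conv (f - g).
Proof. by move=> cf /convN; exact: convD. Qed.
Lemma convM f g : conv f -> conv g -> conv (f * g).
Proof.
move=> cf cg; have [r [M [r0 Hf Hg]]] := conv2 cf cg; exists r, (M * M).
have r0' := ltW r0; split=> // D; apply: le_trans (bnormM _ r0' _ _) _ => //.
by rewrite ler_pM // bnorm_ge0.
Qed.
Lemma conv_cst c : conv (cst c).
Proof. by exists 1, `|c|; split=> // D; exact: bnorm_cst. Qed.
Lemma conv0 : conv 0. Proof. by rewrite -(rmorph0 cst); exact: conv_cst. Qed.
Lemma conv1 : conv 1. Proof. by rewrite -(rmorph1 cst); exact: conv_cst. Qed.
Lemma convX f n : conv f -> conv (f ^+ n).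
Proof. by move=> cf; elim: n => [|n IH]; [exact: conv1|rewrite exprS; exact: convM]. Qed.
Lemma conv_p : conv p.
Proof. by exists 1, 1; split=> // D; exact: bnorm_p. Qed.
Lemma conv_q : conv q.
Proof. by exists 1, 1; split=> // D; exact: bnorm_q. Qed.
Lemma conv_x : conv x. Proof. exact: convM conv_p conv_q. Qed.
Lemma conv_nc f : conv f -> conv (nc f).
Proof. by move=> cf; apply: convB => //; exact: conv_cst. Qed.

Lemma conv_subst g h f : conv g -> conv h -> conv f -> conv (subst g h f).
Proof.
move=> /conv_nc cg /conv_nc ch [rf [Mf [rf0 Hf]]].
have [r [M [r0 Hg Hh]]] := conv2 cg ch.
have M0 : 0 <= M by apply: le_trans (Hg 0%N); rewrite bnorm_ge0 // ltW.
have s0 : 0 < M + rf by rewrite ltr_wpDl.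
(* Shrinking the radius by this factor, at most 1, multiplies the norm of a series without constant
   term by at most [c], and c M <= rf puts both arguments inside the domain of [f]. *)
pose c := rf / (M + rf).
have c01 : 0 <= c <= 1.
  by rewrite divr_ge0 ?(ltW rf0) ?(ltW s0) //= ler_pdivrMr // mul1r ler_wpDl.
have cM : c * M <= rf.
  by rewrite /c mulrAC ler_pdivrMr // ler_pM2l // ler_wpDr // ltW.
have cr0 : 0 < c * r by rewrite mulr_gt0 // divr_gt0.
exists (c * r), Mf; split=> // D.
have aux u : J 1 u -> (forall D, bnorm D r u <= M) -> bnorm D (c * r) u <= rf.
  move=> Ju Hu; apply: le_trans (bnorm_scale _ (ltW r0) c01 Ju) _.
  by rewrite expr1 (le_trans _ cM) // ler_wpM2l //; case/andP: c01.
apply: le_trans (bnorm_subst (ltW cr0) f (c := rf) _ _) (Hf _).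
  by apply: aux => //; exact: nc_J.
by apply: aux => //; exact: nc_J.
Qed.

Lemma conv_bound f : conv f <-> exists C r, 0 < C /\ 0 < r /\
  forall i j, `|f i j| <= C * r ^+ (i + j).
Proof.
split=> [[r [M [r0 H]]]|[C [r [C0 [r0 H]]]]].
  have M0 : 0 <= M by apply: le_trans (H 0%N); rewrite bnorm_ge0 // ltW.
  exists (M + 1), r^-1; split; first by rewrite ltr_wpDl.
  split=> [|i j]; first by rewrite invr_gt0.
  rewrite exprVn ler_pdivlMr ?exprn_gt0 //.
  have ltD : (i < (i + j).+1)%N by lia.
  have ltD' : (j < (i + j).+1)%N by lia.
  apply: (@le_trans _ _ M); last by rewrite lerDl.
  apply: le_trans (H (i + j).+1).
  rewrite /bnorm (bigD1 (Ordinal ltD)) //= (bigD1 (Ordinal ltD')) //= -addrA lerDl.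
  rewrite addr_ge0 ?sumr_ge0 // => k _; last rewrite ?sumr_ge0 // => [l _];
    by rewrite mulr_ge0 // exprn_ge0 // ltW.
(* At half the radius each of the two geometric sums is at most 2. *)
exists (2 * r)^-1, (C * 4); have r20 : 0 < 2 * r by rewrite mulr_gt0.
split=> [|D]; first by rewrite invr_gt0.
have gs n : \sum_(i < n) (2^-1 : K) ^+ i <= 2.
  suff e : \sum_(i < n) (2^-1 : K) ^+ i = 2 - 2 * 2^-1 ^+ n.
    by rewrite e lerBlDr lerDl mulr_ge0 // exprn_ge0 // invr_ge0.
  elim: n => [|n IH]; first by rewrite big_ord0 expr0; ring.
  by rewrite big_ord_recr /= IH exprS; field.
apply: (@le_trans _ _ (\sum_(i < D) \sum_(j < D) C * (2^-1 ^+ i * 2^-1 ^+ j))).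
  apply: ler_sum => i _; apply: ler_sum => j _.
  apply: (@le_trans _ _ (C * r ^+ (i + j) * (2 * r)^-1 ^+ (i + j))).
    by rewrite ler_wpM2r // exprn_ge0 // invr_ge0 ltW.
  rewrite -mulrA -exprMn -exprD invfM mulrCA divff ?gt_eqF // mulr1 //.
have -> : \sum_(i < D) \sum_(j < D) C * (2^-1 ^+ i * 2^-1 ^+ j) =
    C * ((\sum_(i < D) (2^-1 : K) ^+ i) * (\sum_(j < D) 2^-1 ^+ j)).
  rewrite mulr_suml mulr_sumr; apply: eq_bigr => i _.
  by rewrite !mulr_sumr; apply: eq_bigr => j _.
rewrite ler_pM2l //; have -> : (4 : K) = 2 * 2 by rewrite -natrM.
have s0 : 0 <= \sum_(i < D) (2^-1 : K) ^+ i.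
  by apply: sumr_ge0 => i _; rewrite exprn_ge0 // invr_ge0.
exact: ler_pM.
Qed.

Lemma conv_le f g : (forall i j, `|g i j| <= `|f i j|) -> conv f -> conv g.
Proof.
move=> H /conv_bound [C [r [C0 [r0 Hf]]]]; apply/conv_bound; exists C, r.
by split=> //; split=> // i j; apply: le_trans (H _ _) _.
Qed.

Lemma conv_uni c : (forall n, `|c n| <= 1) -> conv (@uni K c).
Proof.
move=> H; apply/conv_bound; exists 1, 1; split=> //; split=> // i j.
by rewrite expr1n mulr1 /uni; case: ifP => // _; rewrite normr0.
Qed.
Lemma conv_bexp f : conv f -> conv (bexp f).
Proof.
move=> cf; apply: conv_subst => //; first exact: conv0.
apply: conv_uni => n; rewrite normfV normr_nat invf_le1 ?ltr0n ?fact_gt0 //.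
by rewrite ler1n fact_gt0.
Qed.
Lemma conv_binv f : conv f -> conv (binv f).
Proof.
move=> cf; apply: convM; first exact: conv_cst.
apply: conv_subst; [|exact: conv0|by apply: conv_uni => n; rewrite normr1].
by apply: convB; [exact: conv1|apply: convM => //; exact: conv_cst].
Qed.
Lemma conv_theta f : conv f -> conv (theta f).
Proof.
move=> /conv_bound [C [r [C0 [r0 Hf]]]]; apply/conv_bound; exists C, (2 * r).
split=> //; split=> [|i j]; first by rewrite mulr_gt0.
rewrite /theta normrM normr_nat exprMn mulrCA.
apply: ler_pM => //; rewrite ?ler0n // -natrX ler_nat; exact/ltnW/ltn_expl.
Qed.
Lemma conv_blog f : conv f -> conv (blog f).
Proof.
move=> cf; apply: (@conv_le (theta f * binv f)); last first.
  by apply: convM; [exact: conv_theta|exact: conv_binv].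
move=> i j; rewrite /theta_inv normrM normfV normr_nat.
have [->|ne] := eqVneq (i + j)%N 0%N; first by rewrite invr0 mulr0.
by rewrite ler_pdivrMr ?ltr0n ?lt0n // ler_peMr // ler1n lt0n.
Qed.
Lemma conv_bmap (phi : {rmorphism K -> K}) f :
  (forall c, `|phi c| = `|c|) -> conv f -> conv (bmap phi f).
Proof. by move=> H; apply: conv_le => i j; rewrite H. Qed.
Lemma conv_shift f g : conv f -> f = p * g -> conv g.
Proof.
move=> /conv_bound [C [r [C0 [r0 Hf]]]] e; apply/conv_bound; exists (C * r), r.
split; first by rewrite mulr_gt0.
split=> // i j; have := Hf i.+1 j; rewrite e.
have := bmonoM g 1 0 i.+1 j; rewrite expr1 expr0 mulr1 /= subn1 subn0 => -> /=.
by rewrite addSn exprS mulrA.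
Qed.
Lemma conv_shift_q f g : conv f -> f = q * g -> conv g.
Proof.
move=> /conv_bound [C [r [C0 [r0 Hf]]]] e; apply/conv_bound; exists (C * r), r.
split; first by rewrite mulr_gt0.
split=> // i j; have := Hf i j.+1; rewrite e.
have := bmonoM g 0 1 i j.+1; rewrite expr1 expr0 mul1r /= subn1 subn0 => -> /=.
by rewrite addnS exprS mulrA.
Qed.

End Norm.

(** * Inverse functions *)

Section Inverse.
Variable K : numFieldType.
Notation A := (ps (ps K)).
Implicit Types f g h u v : A.
Notation p := (@pv K).
Notation q := (@qv K).
Notation x := (@xv K).
Notation cst := (@cst K).

Lemma J_exp_congr d n u u' : J 1 u -> J 1 u' -> J d (u - u') ->
  J (d + n) (u ^+ n.+1 - u' ^+ n.+1).
Proof.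
move=> Ju Ju' Jd; rewrite subrXX; apply: (vanishM addn_wtD) => //.
apply: vanish_sum => i _.
apply: (vanishW (d := ((n.+1.-1 - i) + i)%N)); first by have := ltn_ord i; lia.
by apply: (vanishM addn_wtD); exact: J_pow.
Qed.

Lemma J_mono_congr d a b u u' v v' : J 1 u -> J 1 u' -> J 1 v -> J 1 v' ->
  J d (u - u') -> J d (v - v') -> (2 <= a + b)%N ->
  J d.+1 (v ^+ b * u ^+ a - v' ^+ b * u' ^+ a).
Proof.
move=> Ju Ju' Jv Jv' Hu Hv ab.
have -> : v ^+ b * u ^+ a - v' ^+ b * u' ^+ a =
  (v ^+ b - v' ^+ b) * u ^+ a + v' ^+ b * (u ^+ a - u' ^+ a) by ring.
apply: vanishD.
  case: b ab => [|b] ab; first by rewrite !expr0 subrr mul0r.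
  apply: (vanishW (d := ((d + b) + a)%N)); first by lia.
  by apply: (vanishM addn_wtD); [exact: J_exp_congr|exact: J_pow].
case: a ab => [|a] ab; first by rewrite !expr0 subrr mulr0.
apply: (vanishW (d := (b + (d + a))%N)); first by lia.
by apply: (vanishM addn_wtD); [exact: J_pow|exact: J_exp_congr].
Qed.

Lemma nc_subr d u v : J d (u - v) -> J d (nc u - nc v).
Proof.
case: d => [//|d] H; have e : u 0%N 0%N = v 0%N 0%N.
  by have := H 0%N 0%N isT; rewrite !ps_subE => /eqP; rewrite subr_eq0 => /eqP.
by rewrite /nc e opprB addrA subrK.
Qed.

(** Every monomial of [f] has degree at least two, and replacing one factor leaves another of
    positive order: hence one order is gained, and the inversion below is a contraction. *)
Lemma subst_congr2 d u v u' v' f : J 2 f -> J d (u - u') -> J d (v - v') ->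
  J d.+1 (subst u v f - subst u' v' f).
Proof.
move=> Jf /nc_subr Hu /nc_subr Hv i j lt; rewrite !ps_subE !substE -!ps_subE.
move: i j lt (i + j).+1 => i j lt D; move: i j lt; rewrite -/(vanish _ _ _).
rewrite /psum -sumrB; apply: vanish_sum => a _.
rewrite /psum_row !mulr_suml -sumrB; apply: vanish_sum => b _.
have [lt|ge] := ltnP (a + b) 2; first by rewrite Jf // rmorph0 !mul0r subrr.
rewrite -!mulrA -mulrBr; apply: (vanishMl addn_wtD).
by apply: J_mono_congr => //; exact: nc_J.
Qed.

Theorem inverse_near_id n1 n2 : J 2 n1 -> J 2 n2 -> exists I1 I2,
  [/\ J 1 I1, J 1 I2, I1 + subst I1 I2 n1 = p, I2 + subst I1 I2 n2 = q
    & conv n1 -> conv n2 -> conv I1 /\ conv I2].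
Proof.
move=> J1n J2n.
(* The boolean selects the component, so that a pair of series is a single function, as
   [contraction_fix] requires. *)
pose T := (bool * nat * nat)%type.
pose fst_ (I : T -> K) : A := fun i j => I (true, i, j).
pose snd_ (I : T -> K) : A := fun i j => I (false, i, j).
pose G (I : T -> K) (t : T) : K :=
  if t.1.1 then (p - subst (fst_ I) (snd_ I) n1) t.1.2 t.2
  else (q - subst (fst_ I) (snd_ I) n2) t.1.2 t.2.
pose wt (t : T) := (t.1.2 + t.2)%N.
have [I GI HI] : exists2 I, G I = I &
    forall n t, (wt t < n)%N -> I t = iter n G (fun=> 0) t.
  apply: contraction_fix => d f g H t le.
  have Hf : J d (fst_ f - fst_ g).
    by move=> i j lt; rewrite !ps_subE /fst_ H ?subrr.
  have Hs : J d (snd_ f - snd_ g).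
    by move=> i j lt; rewrite !ps_subE /snd_ H ?subrr.
  have := @subst_congr2 d _ _ _ _ n1 J1n Hf Hs t.1.2 t.2.
  have := @subst_congr2 d _ _ _ _ n2 J2n Hf Hs t.1.2 t.2.
  rewrite /wt in le; rewrite ltnS le !ps_subE => /(_ isT)/eqP; rewrite subr_eq0 => /eqP e2.
  move=> /(_ isT)/eqP; rewrite subr_eq0 => /eqP e1.
  by rewrite /G !ps_subE e1 e2.
have e1 : fst_ I = p - subst (fst_ I) (snd_ I) n1.
  by apply/funext => i; apply/funext => j; rewrite -[in LHS]GI.
have e2 : snd_ I = q - subst (fst_ I) (snd_ I) n2.
  by apply/funext => i; apply/funext => j; rewrite -[in LHS]GI.
have Jp : J 1 p by apply: J1P.
have Jq : J 1 q by apply: J1P.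
exists (fst_ I), (snd_ I); split.
- rewrite e1; apply: vanishB => //; apply: (vanishW (d := 2)) => //; exact: subst_J.
- rewrite e2; apply: vanishB => //; apply: (vanishW (d := 2)) => //; exact: subst_J.
- by rewrite {1}e1 subrK.
- by rewrite {1}e2 subrK.
move=> c1 c2; have [r [M [r0 H1 H2]]] := conv2 c1 c2.
have M0 : 0 <= M by apply: le_trans (H1 0%N); rewrite bnorm_ge0 // ltW.
have s0 : 0 < 4 * M + 2 * r by rewrite ltr_wpDl ?mulr_ge0 // mulr_gt0.
(* Chosen for 2 s <= r and 4 s M <= r^2. At radius s the bound 2 s is then stable: the linear term
   contributes s, and an order-two term at most (2 s / r)^2 M <= s. *)
pose s := r ^+ 2 / (4 * M + 2 * r).
have sgt0 : 0 < s by rewrite divr_gt0 // exprn_gt0.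
have sr : 2 * s <= r.
  rewrite /s mulrA ler_pdivrMr // expr2 mulrCA ler_pM2l //.
  by rewrite ler_wpDl // mulr_ge0.
have sM : 4 * s * M <= r ^+ 2.
  have -> : 4 * s * M = r ^+ 2 * (4 * M) / (4 * M + 2 * r) by rewrite /s; ring.
  rewrite ler_pdivrMr // ler_pM2l ?exprn_gt0 //.
  by rewrite ler_wpDr // mulr_ge0 // ltW.
have bound n D : bnorm D s (fst_ (iter n G (fun=> 0))) <= 2 * s /\
                 bnorm D s (snd_ (iter n G (fun=> 0))) <= 2 * s.
  elim: n => [|n [IH1 IH2]].
    have -> : fst_ (iter 0 G (fun=> 0)) = 0 by [].
    have -> : snd_ (iter 0 G (fun=> 0)) = 0 by [].
    by rewrite bnorm0; split; rewrite mulr_ge0 // ltW.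
  rewrite iterS; set I' := iter n G _ in IH1 IH2 *.
  have -> : fst_ (G I') = p - subst (fst_ I') (snd_ I') n1 by [].
  have -> : snd_ (G I') = q - subst (fst_ I') (snd_ I') n2 by [].
  have aux m : J 2 m -> (forall D, bnorm D r m <= M) ->
      bnorm D s (subst (fst_ I') (snd_ I') m) <= s.
    move=> Jm Hm; pose c := 2 * s / r.
    have c01 : 0 <= c <= 1.
      rewrite /c ler_pdivrMr // mul1r sr andbT.
      by apply: divr_ge0; [apply: mulr_ge0 => //; exact: ltW|exact: ltW].
    have e : 2 * s = c * r by rewrite /c divfK // gt_eqF.
    apply: le_trans (bnorm_subst (ltW sgt0) m (c := 2 * s) _ _) _.
    - exact: le_trans (bnorm_nc _ (ltW sgt0) _) _.
    - exact: le_trans (bnorm_nc _ (ltW sgt0) _) _.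
    rewrite e; apply: le_trans (bnorm_scale _ (ltW r0) c01 Jm) _.
    apply: (@le_trans _ _ (c ^+ 2 * M)).
      by rewrite ler_wpM2l // exprn_ge0 //; case/andP: c01.
    have -> : c ^+ 2 * M = (4 * s * M) / r ^+ 2 * s.
      by rewrite /c; field; rewrite gt_eqF.
    rewrite -[leRHS]mul1r ler_wpM2r ?(ltW sgt0) // ler_pdivrMr ?exprn_gt0 //.
    by rewrite mul1r.
  split; apply: le_trans (bnormD _ (ltW sgt0) _ _) _; rewrite bnormN mulr2n mulrDl mul1r.
    by apply: lerD; [exact: bnorm_p (ltW sgt0)|exact: aux].
  by apply: lerD; [exact: bnorm_q (ltW sgt0)|exact: aux].
split; exists s, (2 * s); split=> // D.
  rewrite (bnorm_congr (ltW sgt0) (g := fst_ (iter (D + D) G (fun=> 0)))).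
    by case: (bound (D + D)%N D).
  by move=> i j lt; rewrite !ps_subE /fst_ (HI (D + D)%N) // subrr.
rewrite (bnorm_congr (ltW sgt0) (g := snd_ (iter (D + D) G (fun=> 0)))).
  by case: (bound (D + D)%N D).
by move=> i j lt; rewrite !ps_subE /snd_ (HI (D + D)%N) // subrr.
Qed.

(** A right inverse is again tangent to the identity and has its own right inverse, which must be
    the given map; so it is two-sided. *)
Theorem inverse_id g h : J 2 (g - p) -> J 2 (h - q) -> exists I1 I2,
  [/\ J 1 I1, J 1 I2,
      J 2 (I1 - p) /\ J 2 (I2 - q),
      (subst I1 I2 g = p /\ subst I1 I2 h = q) /\ (subst g h I1 = p /\ subst g h I2 = q)
    & conv g -> conv h -> conv I1 /\ conv I2].
Proof.
have Jp : J 1 p by apply: J1P.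
have Jq : J 1 q by apply: J1P.
have right u v : J 2 (u - p) -> J 2 (v - q) -> exists I1 I2,
   [/\ J 1 I1, J 1 I2, J 2 (I1 - p) /\ J 2 (I2 - q), subst I1 I2 u = p /\ subst I1 I2 v = q
    & conv u -> conv v -> conv I1 /\ conv I2].
  move=> Ju Jv; have [I1 [I2 [J1 J2 e1 e2 cI]]] := inverse_near_id Ju Jv.
  exists I1, I2; split=> //.
  - rewrite -e1 -e2; split; rewrite opprD addrA subrr add0r;
    by apply: vanishN; exact: subst_J.
  - by rewrite -[X in _ = X /\ _]e1 -[X in _ /\ _ = X]e2 !rmorphB /= subst_p // subst_q //
      !(addrC _ (_ - _)) !subrK.
  by move=> cu cv; apply: cI; apply: convB => //; [exact: conv_p|exact: conv_q].
move=> Jg Jh; have [I1 [I2 [J1 J2 [K1 K2] [e1 e2] cI]]] := right _ _ Jg Jh.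
have [L1 [L2 [JL1 JL2 _ [f1 f2] _]]] := right _ _ K1 K2.
have g1 : g = L1.
  by have := congr1 (subst L1 L2) e1; rewrite subst_comp // f1 f2 subst_id subst_p.
have h1 : h = L2.
  by have := congr1 (subst L1 L2) e2; rewrite subst_comp // f1 f2 subst_id subst_q.
by exists I1, I2; split=> //; split=> //; rewrite g1 h1.
Qed.

Lemma uniE c : uni c = bapp c p.
Proof.
have Jp : J 1 p by apply: J1P.
apply: J_all_eq => d i j lt; have := @bapp_psum K c p d Jp i j lt.
rewrite !ps_subE => /eqP; rewrite subr_eq0 => /eqP ->.
rewrite bsumE; have ltd : (i < d)%N by lia.
rewrite (bigD1 (Ordinal ltd)) //= bcstM; have := bmonoE K i 0 i j.
rewrite expr0 mulr1 => ->; rewrite eqxx big1 ?addr0 => [|k].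
  by rewrite /uni; case: eqP; rewrite ?mulr1 ?mulr0 subrr.
rewrite -val_eqE /= eq_sym => /negbTE ne; rewrite bcstM; have := bmonoE K k 0 i j.
by rewrite expr0 mulr1 => ->; rewrite ne mulr0.
Qed.
Lemma subst_uni g h c : J 1 g -> subst g h (uni c) = bapp c g.
Proof.
by move=> Jg; rewrite uniE subst_bapp ?subst_p //; exact: J1P.
Qed.

(** Subtracting [R0 f], the series in p + q with the same restriction to q = 0, leaves by symmetry a
    series that vanishes on both axes. It is x times a symmetric series, and the process repeats.
    This is how a symmetric series becomes a series in z1 and z2. *)
Lemma symmetric_series f : swap f = f ->
  exists u, f = subst (p + q) x u.
Proof.
move=> fs; pose R0 f : A := bapp (fun i => f i 0%N) (p + q).
pose S f : A := shx 1 (f - R0 f).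
have Jpq : J 1 (p + q) by apply: J1P; rewrite !ps_addE pvE qvE addr0.
have Jx := @J_x K.
have swpq : swap (p + q) = p + q.
  by rewrite rmorphD /= swap_p swap_q addrC.
have swR g : swap (R0 g) = R0 g.
  by rewrite /R0 [LHS]subst_bapp // -/(swap _) swpq.
have R00 g i : R0 g i 0%N = g i 0%N.
  have := @bapp_psum K (fun i => g i 0%N) (p + q) i.+1 Jpq i 0%N.
  rewrite addn0 ltnSn !ps_subE => /(_ isT)/eqP; rewrite subr_eq0 /R0 => /eqP ->.
  have coef k : ((p + q) ^+ k) i 0%N = (i == k)%:R.
    rewrite exprDn bsumE big_ord_recl /= bin0 mulr1n subn0 bmonoE eqxx andbT.
    rewrite big1 ?addr0 // => j _; rewrite -mulr_natr -(rmorph_nat cst) mulrC bcstM.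
    by rewrite bmonoE /bump /= andbF mulr0.
  rewrite bsumE (bigD1 ord_max) //= bcstM coef eqxx mulr1 big1 ?addr0 // => k.
  by rewrite -val_eqE /= eq_sym => /negbTE ne; rewrite bcstM coef ne mulr0.
have XS g : swap g = g -> X 1 (g - R0 g).
  move=> gs i j H; rewrite !ps_subE; case: j H => [|j] H; first by rewrite R00 subrr.
  have -> : i = 0%N by lia.
  have -> : g 0%N j.+1 = g j.+1 0%N by rewrite -[in LHS]gs swapE.
  have -> : R0 g 0%N j.+1 = R0 g j.+1 0%N by rewrite -[in LHS](swR g) swapE.
  by rewrite R00 subrr.
have SE g : swap g = g -> g = R0 g + x * S g.
  by move=> gs; have := shxK (XS _ gs); rewrite expr1 -/(S g) => ->; rewrite addrC subrK.
have swS g : swap g = g -> swap (S g) = S g.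
  move=> gs; apply/funext => i; apply/funext => j; rewrite swapE /S /shx.
  by rewrite -[LHS]swapE rmorphB /= swR gs.
have its n : swap (iter n S f) = iter n S f.
  by elim: n => [|n IH] //; rewrite iterS; exact: swS.
have dec n : f = \sum_(l < n) x ^+ l * R0 (iter l S f) + x ^+ n * iter n S f.
  elim: n => [|n IH]; first by rewrite big_ord0 add0r expr0 mul1r.
  rewrite [LHS]IH big_ord_recr exprSr iterS -addrA; congr (_ + _).
  by rewrite [in LHS](SE _ (its n)); ring.
(* The coefficient of x^j is the series in p + q extracted at stage j. *)
pose u : A := fun i j => iter j S f i 0%N.
exists u; apply: J_all_eq => d.
have Ju : J d (u - \sum_(l < d) q ^+ l * uni (fun i => iter l S f i 0%N)).
  move=> i j lt; rewrite ps_subE ps_subE bsumE; have ltd : (j < d)%N by lia.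
  have coef l c : (q ^+ l * uni c) i j = if j == l then c i else 0.
    have := bmonoM (uni c) 0 l i j; rewrite expr0 mul1r /= => -> ; rewrite /uni subn0.
    case: ltnP => h; first by rewrite (_ : (j == l) = false) //; lia.
    by rewrite (_ : (j - l == 0)%N = (j == l)) //; lia.
  rewrite (bigD1 (Ordinal ltd)) //= coef eqxx big1 ?addr0 ?subrr // => k.
  by rewrite -val_eqE /= eq_sym => /negbTE ne; rewrite coef ne.
have := subst_J (p + q) x Ju.
rewrite rmorphB rmorph_sum /= => H.
rewrite [X in X - _](dec d).
rewrite (eq_bigr (fun l : 'I_d => x ^+ l * R0 (iter l S f))) in H; last first.
  by move=> l _; rewrite rmorphM rmorphXn /= subst_q // subst_uni.
set T := \sum_(l < d) _ in H *.
have -> : T + x ^+ d * iter d S f - subst (p + q) x u =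
  x ^+ d * iter d S f - (subst (p + q) x u - T) by ring.
apply: vanishB => //; apply: (vanishMr addn_wtD); exact: J_pow.
Qed.

End Inverse.

(** * The linear equation *)

Section Modes.
Variable K : numFieldType.
Notation A := (ps (ps K)).
Implicit Types f g h u v : A.
Notation p := (@pv K).
Notation q := (@qv K).
Notation x := (@xv K).
Notation cst := (@cst K).

(* The part of [f] on the monomials [p^(k+j) q^j], as a series in [x = pq]. *)
Definition mode k f : A := fun i j => if i == j then f (k + j)%N j else 0.

Lemma mode_diag k f : diag (mode k f).
Proof. by move=> i j /negbTE ne; rewrite /mode ne. Qed.
Lemma mode_add k : additive (mode k).
Proof.
move=> f g; apply/funext => i; apply/funext => j; rewrite !ps_subE /mode.
by case: ifP; rewrite ?subrr // !ps_subE.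
Qed.
HB.instance Definition _ k := GRing.isAdditive.Build A A (mode k) (mode_add k).
Lemma mode_X d k f : X d f -> X d (mode k f).
Proof.
move=> Xf i j lt; rewrite /mode; case: eqP => // e; apply: Xf; lia.
Qed.
Lemma mode_J d k f : J (k + d) f -> J d (mode k f).
Proof. by move=> Jf i j lt; rewrite /mode; case: eqP => // e; apply: Jf; lia. Qed.
Lemma mode0_diag k f : (0 < k)%N -> diag f -> mode k f = 0.
Proof.
move=> k0 df; apply/funext => i; apply/funext => j; rewrite /mode.
by case: eqP => // _; apply: df; lia.
Qed.

Lemma diag_app u d i j f : diag u -> (minn i j < d)%N ->
  (u * f) i j = \sum_(a < d) u a a * (x ^+ a * f) i j.
Proof.
move=> du lt; have Xu : X d (u - \sum_(a < d) cst (u a a) * x ^+ a).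
  move=> k l ltd; rewrite !ps_subE bsumE.
  have xE a : (x ^+ a) k l = if (k == a) && (l == a) then 1 else 0.
    by rewrite exprMn bmonoE; case: ifP.
  have [e|ne] := eqVneq k l; last first.
    rewrite du // big1 ?subrr // => a _; rewrite bcstM xE.
    by rewrite (_ : _ && _ = false) ?mulr0 //; lia.
  have ltk : (k < d)%N by lia.
  subst l; rewrite (bigD1 (Ordinal ltk)) //= bcstM xE eqxx mulr1 big1 ?addr0 ?subrr // => a.
  by rewrite -val_eqE /= => ne; rewrite bcstM xE (_ : _ && _ = false) ?mulr0 //; lia.
have := (vanishMr minn_wtD f Xu) i j lt.
rewrite mulrBl !ps_subE => /eqP; rewrite subr_eq0 => /eqP ->.
by rewrite mulr_suml bsumE; apply: eq_bigr => a _; rewrite -mulrA bcstM.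
Qed.

Lemma mode_mul k u f : diag u -> mode k (u * f) = u * mode k f.
Proof.
move=> du; apply/funext => i; apply/funext => j.
have [e|ne] := eqVneq i j; last first.
  rewrite mode_diag //; apply/esym; apply: diagM => //; exact: mode_diag.
rewrite {1}/mode e eqxx (@diag_app _ j.+1) //; last lia.
rewrite (@diag_app _ j.+1) //; last lia.
apply: eq_bigr => a _; congr (_ * _); rewrite !bxM.
rewrite (_ : (minn (k + j) j < a)%N = (minn j j < a)%N); last lia.
case: ifP => // H; rewrite /mode eqxx; congr (f _ _); lia.
Qed.

Lemma mode_mono k a b : mode k (p ^+ a * q ^+ b) = if a == (k + b)%N then x ^+ b else 0.
Proof.
apply/funext => i; apply/funext => j; rewrite /mode bmonoE.
case: ifP => [/eqP ->|ne]; last first.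
  case: ifP => // _; rewrite -[x ^+ b]mulr1 bxM b1E; case: ifP => // H.
  by rewrite (_ : _ && _ = false) //; lia.
case: ifP => [/eqP->|ne]; last by rewrite !ps_0E (_ : _ && _ = false) //; lia.
rewrite -[x ^+ b]mulr1 bxM b1E; case: ifP => H.
  by rewrite (_ : _ && _ = false) //; lia.
by rewrite (_ : (_ == _) && _ = (j - b == 0)%N && (j - b == 0)%N); [case: ifP|lia].
Qed.

(** The positive modes of [f] see the monomials with more p than q, those of [swap f] the others. *)
Lemma X_modes d f : X d (mode 0 f) -> (forall k, (0 < k)%N -> X d (mode k f)) ->
  (forall k, (0 < k)%N -> X d (mode k (swap f))) -> X d f.
Proof.
move=> e0 e1 e2 i j lt.
have get k u : u (k + j)%N j = mode k u j j by rewrite /mode eqxx.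
have get' k u : u i (k + i)%N = mode k (swap u) i i by rewrite /mode eqxx swapE.
case: (ltngtP i j) => H.
- by rewrite -(subnK (ltnW H)) get' e2 ?subn_gt0 //; lia.
- by rewrite -(subnK (ltnW H)) get e1 ?subn_gt0 //; lia.
by rewrite H -[j in f j](add0n j) get e0 //; lia.
Qed.

Lemma diag_modes f : (forall k, (0 < k)%N -> mode k f = 0) ->
  (forall k, (0 < k)%N -> mode k (swap f) = 0) -> diag f.
Proof.
move=> e1 e2 i j ne.
have get k u : u (k + j)%N j = mode k u j j by rewrite /mode eqxx.
have get' k u : u i (k + i)%N = mode k (swap u) i i by rewrite /mode eqxx swapE.
case: (ltngtP i j) => H; last by rewrite H eqxx in ne.
- by rewrite -(subnK (ltnW H)) get' e2 ?subn_gt0.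
- by rewrite -(subnK (ltnW H)) get e1 ?subn_gt0.
Qed.

(** The monomial p^(k+b) q^b acquires the factor u^(k+b) v^b = u^k: scalings by series in x act
    diagonally on the modes. *)
Lemma mode_rot k u v f : diag u -> diag v -> u * v = 1 ->
  mode k (subst (u * p) (v * q) f) = u ^+ k * mode k f.
Proof.
move=> du dv uv; have Jup : J 1 (u * p) by apply: (vanishMl addn_wtD); exact: J_p.
have Jvq : J 1 (v * q) by apply: (vanishMl addn_wtD); exact: J_q.
apply: J_all_eq => d.
have H : J (k + d) (f - psum p q (k + d) f) := @psum_pq _ _ f.
set P := psum _ _ _ _ in H.
have -> : mode k (subst (u * p) (v * q) f) - u ^+ k * mode k f =
  mode k (subst (u * p) (v * q) (f - P)) - u ^+ k * mode k (f - P).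
  suff e : mode k (subst (u * p) (v * q) P) = u ^+ k * mode k P.
    by rewrite !raddfB /= e; ring.
  rewrite /P /psum !raddf_sum /= mulr_sumr; apply: eq_bigr => a _.
  rewrite /psum_row mulr_suml !raddf_sum /= mulr_sumr; apply: eq_bigr => b _.
  rewrite !(nc_id (@J_p K)) !(nc_id (@J_q K)) !rmorphM !rmorphXn /= subst_cst subst_p // subst_q //.
  rewrite !exprMn.
  have -> : cst (f a b) * (v ^+ b * q ^+ b) * (u ^+ a * p ^+ a) =
    (cst (f a b) * v ^+ b * u ^+ a) * (p ^+ a * q ^+ b) by ring.
  have -> : cst (f a b) * q ^+ b * p ^+ a = cst (f a b) * (p ^+ a * q ^+ b) by ring.
  have dc : diag (cst (f a b) * v ^+ b * u ^+ a).
    by apply: diagM; [apply: diagM; [exact: diag_cst|exact: diagX]|exact: diagX].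
  rewrite (mode_mul k _ dc) (mode_mul k _ (diag_cst _)) !mode_mono.
  case: eqP => [->|_]; last by rewrite !mulr0.
  rewrite exprD; transitivity (u ^+ k * (cst (f (k + b)%N b) * x ^+ b) * (u * v) ^+ b).
    by rewrite [(u * v) ^+ b]exprMn; ring.
  by rewrite uv expr1n mulr1.
apply: vanishB; first by apply: mode_J; exact: subst_J.
by apply: (vanishMl addn_wtD); exact: mode_J.
Qed.

End Modes.

(** * Small divisors and the perturbed linear equation *)

Section Linear.
Variable K : numFieldType.
Notation A := (ps (ps K)).
Implicit Types f g h u v : A.
Notation p := (@pv K).
Notation q := (@qv K).
Notation x := (@xv K).
Notation cst := (@cst K).

Variables (nu0 eps : K) (s : nat).
Hypotheses (nu0_neq0 : nu0 != 0) (eps_neq0 : eps != 0) (s_gt0 : (0 < s)%N).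

Definition ex (c : K) : A := cst c * x ^+ s.
Lemma ex_J c : J 1 (ex c).
Proof.
apply: (vanishMl addn_wtD); apply: (vanishW (d := s)) => //; exact/J_pow/J_x.
Qed.
Lemma ex_diag c : diag (ex c).
Proof. by apply: diagM; [exact: diag_cst|exact/diagX/diag_x]. Qed.
Lemma exN c : - ex c = ex (- c).
Proof. by rewrite /ex rmorphN; ring. Qed.
Lemma exMn c n : ex c *+ n = ex (c *+ n).
Proof. by rewrite /ex rmorphMn mulrnAl. Qed.

(* [nu ^+ 2] is the multiplier of the normal form on the leaf [x = pq]. *)
Definition nu : A := cst nu0 * bexp (ex (eps / 2)).
Definition nui : A := cst nu0^-1 * bexp (ex (- (eps / 2))).

Lemma nu_nui : nu * nui = 1.
Proof.
rewrite /nu /nui -exN; transitivity (cst (nu0 * nu0^-1) * (bexp (- ex (eps / 2)) * bexp (ex (eps / 2)))).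
  by rewrite rmorphM; ring.
by rewrite divff // rmorph1 mul1r bexpNK //; exact: ex_J.
Qed.
Lemma nui_nu : nui * nu = 1. Proof. by rewrite mulrC nu_nui. Qed.
Lemma nu_diag : diag nu.
Proof. by apply: diagM; [exact: diag_cst|exact/diag_bapp/ex_diag]. Qed.
Lemma nui_diag : diag nui.
Proof. by apply: diagM; [exact: diag_cst|exact/diag_bapp/ex_diag]. Qed.
Lemma nu_pow k : nu ^+ k = cst (nu0 ^+ k) * bexp (ex (eps / 2 *+ k)).
Proof. by rewrite /nu exprMn rmorphXn -bexpMn ?exMn //; exact: ex_J. Qed.

Lemma bexp_sub1 : exists2 G : A, J 1 (G - 1) & forall u, J 1 u ->
  bexp u = 1 + u * subst u 0 G.
Proof.
pose G : A := uni (fun n => (n.+1)`!%:R^-1).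
exists G; first by apply: J1P; rewrite !ps_subE b1E /G /uni /= invr1 subrr.
move=> u Ju; have e : uni (fun n => n`!%:R^-1) = 1 + p * G :> A.
  apply/funext => i; apply/funext => j; rewrite !ps_addE b1E.
  have := bmonoM G 1 0 i j; rewrite expr1 expr0 mulr1 => ->; rewrite /G /uni.
  case: i j => [|i] [|j]; rewrite ?addr0 ?add0r ?invr1 //= ?addr0 //.
  by rewrite subSS !subn0.
by rewrite {1}/bexp /bapp e rmorphD rmorphM rmorph1 /= subst_p.
Qed.

(** Multiplying by [nu ^+ k] turns the divisor into 1 - L e^(k eps x^s) with L = nu0^(2k). This is a
    unit if L differs from 1, and otherwise -k eps x^s times a unit. *)
Lemma small_divisor k : (0 < k)%N ->
  exists2 w, diag w & (nui ^+ k - nu ^+ k) * w = x ^+ s.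
Proof.
move=> k0; have nk : nui ^+ k * nu ^+ k = 1 by rewrite -exprMn nui_nu expr1n.
pose L := nu0 ^+ (k * 2).
have e : nu ^+ k * nu ^+ k = cst L * bexp (ex (eps *+ k)).
  rewrite -expr2 -exprM nu_pow; congr (_ * bexp (ex _)).
  by rewrite mulnC mulrnA; congr (_ *+ k); rewrite -[LHS]mulr_natr divfK // pnatr_eq0.
have fac w : (nui ^+ k - nu ^+ k) * (nu ^+ k * w) = (1 - cst L * bexp (ex (eps *+ k))) * w.
  by rewrite -e -nk; ring.
have [L1|L1] := eqVneq L 1.
  have [G JG He] := bexp_sub1; have JX := @ex_J (eps *+ k).
  set X := ex _ in JX fac *; pose H := subst X 0 G.
  have H00 : H 0%N 0%N = 1.
    have := @subst_J _ X 0 1 _ JG 0%N 0%N isT; rewrite rmorphB rmorph1 !ps_subE b1E /= => /eqP.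
    by rewrite subr_eq0 => /eqP.
  have dX : diag X by exact: ex_diag.
  exists (nu ^+ k * (cst (- (eps *+ k)^-1) * binv H)).
    apply: diagM; first exact/diagX/nu_diag.
    apply: diagM; first exact: diag_cst.
    (* [X * H] is e^X - 1, hence diagonal, and [X] is a nonzero multiple of x^s; diagonality of [H]
       is read off after cancelling x^s. *)
    apply: diag_binv => i j ne.
    have dXH : diag (X * H).
      have -> : X * H = bexp X - 1 by rewrite (He X) // addrC addKr.
      by apply: diagB; [exact: diag_bapp|exact: diag1].
    have e0 : eps *+ k != 0 by rewrite mulrn_eq0 negb_or -lt0n k0.
    have : diag (x ^+ s * H).
      have -> : x ^+ s * H = cst (eps *+ k)^-1 * (X * H).
        by rewrite /X /ex !mulrA -rmorphM mulVf // rmorph1 mul1r.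
      by apply: diagM => //; exact: diag_cst.
    move=> /(_ (i + s)%N (j + s)%N); rewrite bxM !addnK eqn_add2r ne.
    by rewrite (_ : (_ < s)%N = false) => [->|] //; lia.
  rewrite fac L1 rmorph1 mul1r He // -/H opprD addrA subrr add0r.
  have e0 : eps *+ k != 0 by rewrite mulrn_eq0 negb_or -lt0n k0.
  transitivity (cst ((eps *+ k) * (eps *+ k)^-1) * x ^+ s * (H * binv H)).
    by rewrite rmorphN rmorphM /X /ex; ring.
  by rewrite divff // mulbV ?H00 ?oner_eq0 // rmorph1 mul1r mulr1.
set u := 1 - _ in fac.
have u00 : u 0%N 0%N = 1 - L.
  by rewrite /u !ps_subE b1E bcstM bexp_00 ?mulr1 //; exact: ex_J.
exists (nu ^+ k * (binv u * x ^+ s)).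
  apply: diagM; first exact/diagX/nu_diag.
  apply: diagM; last exact/diagX/diag_x.
  apply/diag_binv/diagB; first exact: diag1.
  by apply: diagM; [exact: diag_cst|exact/diag_bapp/ex_diag].
by rewrite fac mulrA mulbV ?mul1r // u00 subr_eq0 eq_sym.
Qed.

Variable Y : A.
Hypotheses (Y_sym : swap Y = Y) (Y_X : X (s + s) Y).

Lemma Y_J : J 1 Y.
Proof. by apply: J1P; apply: Y_X; rewrite minnn addn_gt0 s_gt0. Qed.
Lemma YN_J : J 1 (- Y). Proof. exact/J1N/Y_J. Qed.

Definition B : A := nui * bexp Y.
Definition Bi : A := nu * bexp (- Y).
Lemma BBi : B * Bi = 1.
Proof.
transitivity ((nui * nu) * (bexp (- Y) * bexp Y)); first by rewrite /B /Bi; ring.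
by rewrite nui_nu bexpNK ?mul1r //; exact: Y_J.
Qed.
Lemma B_00 : B 0%N 0%N = nu0^-1.
Proof.
rewrite /B /nui !b00M (bexp_00 (@ex_J _)) (bexp_00 Y_J) bcstE /=.
by rewrite !mulr1.
Qed.
Lemma Bi_00 : Bi 0%N 0%N = nu0.
Proof.
rewrite /Bi /nu !b00M (bexp_00 (@ex_J _)) (bexp_00 YN_J) bcstE /=.
by rewrite !mulr1.
Qed.
Lemma swap_bexp u : J 1 u -> swap (bexp u) = bexp (swap u).
Proof. exact: subst_bapp. Qed.
Lemma swap_diag u : diag u -> swap u = u.
Proof. exact: (subst_diag (@J_q K) (@J_p K) (mulrC _ _)). Qed.
Lemma swap_B : swap B = B.
Proof.
by rewrite rmorphM /= swap_diag ?swap_bexp ?Y_sym //; [exact: Y_J|exact: nui_diag].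
Qed.
Lemma swap_Bi : swap Bi = Bi.
Proof.
rewrite rmorphM /= swap_diag ?swap_bexp ?raddfN /= ?Y_sym //; [exact: YN_J|exact: nu_diag].
Qed.
Lemma bexp_X u d : (0 < d)%N -> X d u -> X d (bexp u - 1).
Proof.
move=> d0 Xu; have Ju : J 1 u by apply: J1P; apply: Xu; rewrite minnn.
rewrite -bexp0; apply: (subst_congr _ minn_wtD) => //; first by rewrite subr0.
by rewrite subrr.
Qed.

(** Up to constants z1 is [beta (p + q)] and its conjugate is [betab (p + q)]. So series in (z1, z2)
    are the images under [beta] of symmetric series, and [betab] plays this role for the
    conjugates. *)
Definition beta := subst (B * p) (Bi * q).
Definition betab := subst (Bi * p) (B * q).
Lemma J_mp u : J 1 (u * p). Proof. exact/(vanishMl addn_wtD)/J_p. Qed.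
Lemma J_mq u : J 1 (u * q). Proof. exact/(vanishMl addn_wtD)/J_q. Qed.
Hint Resolve J_mp J_mq : core.
Lemma beta_x : (B * p) * (Bi * q) = x.
Proof. by transitivity (B * Bi * x); [rewrite /xv; ring|rewrite BBi mul1r]. Qed.
Lemma betab_x : (Bi * p) * (B * q) = x.
Proof. by transitivity (B * Bi * x); [rewrite /xv; ring|rewrite BBi mul1r]. Qed.
Lemma beta_diag u : diag u -> beta u = u.
Proof. exact: (subst_diag (J_mp _) (J_mq _) beta_x). Qed.
Lemma betab_diag u : diag u -> betab u = u.
Proof. exact: (subst_diag (J_mp _) (J_mq _) betab_x). Qed.
Lemma swap_scale u v f : swap u = u -> swap v = v ->
  swap (subst (u * p) (v * q) f) = subst (v * p) (u * q) (swap f).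
Proof.
move=> su sv; rewrite swap_subst // [swap f]/swap subst_comp; [|exact: J_q|exact: J_p].
by rewrite (subst_q _ (J_mq _)) (subst_p _ (J_mp _)) !rmorphM /= su sv swap_p swap_q.
Qed.
Lemma swap_beta f : swap (beta f) = betab (swap f).
Proof. exact: swap_scale swap_B swap_Bi. Qed.
Lemma swap_betab f : swap (betab f) = beta (swap f).
Proof. by rewrite -[f in LHS]swapK -swap_beta swapK. Qed.

(** [beta] for Y = 0; its conjugate [rotb] is [betab] for Y = 0. Both are diagonal in the modes. *)
Definition rot := subst (nui * p) (nu * q).
Lemma rotE : rot = subst (nui * p) (nu * q). Proof. by []. Qed.
Definition rotb := subst (nu * p) (nui * q).
Lemma swap_rot f : swap (rot f) = rotb (swap f).
Proof. exact: swap_scale (swap_diag nui_diag) (swap_diag nu_diag). Qed.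
Lemma swap_rotb f : swap (rotb f) = rot (swap f).
Proof. by rewrite -[f in LHS]swapK -swap_rot swapK. Qed.
Lemma rot_cstM c f : rot (cst c * f) = cst c * rot f.
Proof. by rewrite /rot rmorphM /= subst_cst. Qed.
Lemma rotb_cstM c f : rotb (cst c * f) = cst c * rotb f.
Proof. by rewrite /rotb rmorphM /= subst_cst. Qed.
Lemma mode_rot' k f : mode k (rot f) = nui ^+ k * mode k f.
Proof. exact: (mode_rot k f nui_diag nu_diag nui_nu). Qed.
Lemma mode_rotb k f : mode k (rotb f) = nu ^+ k * mode k f.
Proof. exact: (mode_rot k f nu_diag nui_diag nu_nui). Qed.

Lemma BX : X (s + s) (B - nui).
Proof.
have -> : B - nui = nui * (bexp Y - 1) by rewrite /B; ring.
by apply/(vanishMl minn_wtD)/bexp_X => //; lia.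
Qed.
Lemma BiX : X (s + s) (Bi - nu).
Proof.
have -> : Bi - nu = nu * (bexp (- Y) - 1) by rewrite /Bi; ring.
by apply/(vanishMl minn_wtD)/bexp_X; [lia|exact: vanishN].
Qed.
(** Both substitutions fix x, so the factor x^d of [f] comes out before the comparison and the
    orders add. *)
Lemma subst_pert d u v u' v' f : u * v = 1 -> u' * v' = 1 ->
  X (s + s) (u - u') -> X (s + s) (v - v') -> X d f ->
  X (d + (s + s)) (subst (u * p) (v * q) f - subst (u' * p) (v' * q) f).
Proof.
move=> uv uv' Xu Xv /shxK <-; rewrite !rmorphM !rmorphXn /= !rmorphM /= !subst_p // !subst_q //.
have -> : u * p * (v * q) = x by transitivity (u * v * x); [rewrite /xv; ring|rewrite uv mul1r].
have -> : u' * p * (v' * q) = x by transitivity (u' * v' * x); [rewrite /xv; ring|rewrite uv' mul1r].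
rewrite -mulrBr; apply: X_xM; apply: (subst_congr _ minn_wtD) => //.
  by rewrite -mulrBl; apply: (vanishMr minn_wtD).
by rewrite -mulrBl; apply: (vanishMr minn_wtD).
Qed.
Definition pert f := (beta f - rot f) - (betab f - rotb f).
Lemma beta_rot d f : X d f -> X (d + (s + s)) (beta f - rot f).
Proof. by apply: subst_pert; rewrite ?BBi ?nui_nu //; [exact: BX|exact: BiX]. Qed.
Lemma betab_rotb d f : X d f -> X (d + (s + s)) (betab f - rotb f).
Proof.
by apply: subst_pert; rewrite 1?mulrC ?BBi ?nui_nu //; [exact: BiX|exact: BX].
Qed.
Lemma pert_X d f : X d f -> X (d + (s + s)) (pert f).
Proof. by move=> Xf; apply: vanishB; [exact: beta_rot|exact: betab_rotb]. Qed.

Variable wh : nat -> A.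
Hypotheses (wh_diag : forall k, diag (wh k))
  (whE : forall k, (0 < k)%N -> (nui ^+ k - nu ^+ k) * wh k = x ^+ s).

(** A right inverse of [rot - rotb] on positive modes, up to the factor x^s: mode k is multiplied by
    x^s / (nui^k - nu^k), and the rest is filled in by antisymmetry. The diagonal is left unsolved
    and becomes the remainder. *)
Definition inv0 f : A := fun i j =>
  if (j < i)%N then (wh (i - j) * mode (i - j) f) j j
  else if (i < j)%N then - (wh (j - i) * mode (j - i) f) i i else 0.
Lemma inv0_anti f : swap (inv0 f) = - inv0 f.
Proof.
apply/funext => i; apply/funext => j; rewrite swapE !ps_oppE /inv0.
by case: (ltngtP i j) => H; rewrite ?opprK ?oppr0.
Qed.
Lemma mode_inv0 k f : (0 < k)%N -> mode k (inv0 f) = wh k * mode k f.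
Proof.
move=> k0; have dw : diag (wh k * mode k f) by apply: diagM => //; exact: mode_diag.
apply/funext => i; apply/funext => j; rewrite {1}/mode.
case: eqP => [->|/eqP ne]; last by rewrite dw.
by rewrite /inv0 addnK (_ : (j < k + j)%N) //; lia.
Qed.
Lemma inv0_sub f g : inv0 (f - g) = inv0 f - inv0 g.
Proof.
apply/funext => i; apply/funext => j; rewrite !ps_subE /inv0.
case: (ltngtP i j) => H; rewrite ?raddfB /= ?mulrBr ?ps_subE ?subrr //.
by rewrite opprB opprK addrC.
Qed.
Lemma inv0_X d f : X d f -> X d (inv0 f).
Proof.
move=> Xf i j lt; rewrite /inv0.
have H k l : (l < d)%N -> (wh k * mode k f) l l = 0.
  by move=> lt'; apply: (vanishMl minn_wtD (wh k) (mode_X k Xf)); rewrite minnn.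
case: (ltngtP i j) => h //; rewrite H ?oppr0 //; lia.
Qed.

Definition step f := inv0 (shx s (- Y *+ 2 - pert f)).
Lemma stepE f : step f = inv0 (shx s (- Y *+ 2 - pert f)). Proof. by []. Qed.
Definition Lam f := beta f - betab f.

Lemma rhs_X f : X (s + s) (- Y *+ 2 - pert f).
Proof.
apply: vanishB; first by rewrite mulr2n; apply: vanishD; exact: vanishN.
by apply: (@pert_X 0).
Qed.

Lemma pert_sub f g : pert (f - g) = pert f - pert g.
Proof. by rewrite /pert /beta /betab /rot /rotb !rmorphB; ring. Qed.
(** [pert] gains x^(2s) and the division costs x^s, so that x^s remains; this is where the order 2s
    of [Y] enters. *)
Lemma step_contr d f g : X d (f - g) -> X d.+1 (step f - step g).
Proof.
move=> Xfg; rewrite /step -inv0_sub; apply: inv0_X.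
have -> : shx s (- Y *+ 2 - pert f) - shx s (- Y *+ 2 - pert g) = - shx s (pert (f - g)).
  by apply/funext => i; apply/funext => j; rewrite !(ps_subE, ps_oppE, ps_addE, pert_sub) /shx !(ps_subE, ps_addE, ps_oppE); ring.
apply: vanishN => i j lt; rewrite /shx (pert_X Xfg) //; lia.
Qed.

Lemma anti_Lam_sym f : swap f = - f -> swap (Lam f) = Lam f.
Proof.
move=> af; rewrite /Lam rmorphB /= swap_beta swap_betab af /beta /betab !rmorphN; ring.
Qed.

(** The fixed point is antisymmetric, so the left side of the equation is symmetric and only its
    positive modes need to vanish. The description by iterates is kept for the dependence on the
    parameter. *)
Theorem linear_solution : exists f, [/\ swap f = - f, step f = f,
  forall n i j, (minn i j < n)%N -> f i j = iter n step 0 i j,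
  diag (Lam f + Y *+ 2) & X (s + s) (Lam f + Y *+ 2)].
Proof.
have [f ff fit] : exists2 f : A, step f = f &
    forall n i j, (minn i j < n)%N -> f i j = iter n step 0 i j.
  pose cur (F : nat * nat -> K) : A := fun i j => F (i, j).
  pose G (F : nat * nat -> K) (t : nat * nat) := step (cur F) t.1 t.2.
  have [F FE Fit] : exists2 F, G F = F & forall n t, (minn t.1 t.2 < n)%N ->
      F t = iter n G (fun=> 0) t.
    apply: contraction_fix => d F F' H [i j] le.
    have Xd : X d (cur F - cur F').
      by move=> k l lt; rewrite !ps_subE /cur H ?subrr.
    have := step_contr Xd le; rewrite /G !ps_subE => /eqP.
    by rewrite subr_eq0 => /eqP.
  exists (cur F).
    by apply/funext => i; apply/funext => j; rewrite -[in RHS]FE.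
  move=> n i j lt; rewrite [LHS](Fit n) //.
  suff <- : cur (iter n G (fun=> 0)) = iter n step 0 by [].
  by elim: (n) => // m IH; rewrite [in RHS]iterS -IH.
have af : swap f = - f by rewrite -ff inv0_anti.
have eL : Lam f = rot f - rotb f + pert f by rewrite /Lam /pert; ring.
have dg : diag (Lam f + Y *+ 2).
  have Ls : swap (Lam f + Y *+ 2) = Lam f + Y *+ 2.
    by rewrite rmorphD rmorphMn /= anti_Lam_sym // Y_sym.
  have e k : (0 < k)%N -> mode k (Lam f + Y *+ 2) = 0.
    move=> k0; have R := shxK (rhs_X f).
    have : mode k (rot f - rotb f) = mode k (- Y *+ 2 - pert f).
      rewrite raddfB /= mode_rot' mode_rotb -mulrBl -[in LHS]ff mode_inv0 //.
      rewrite mulrA whE // -mode_mul; last exact/diagX/diag_x.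
      congr (mode k _); apply/shxK/(vanishW (d := (s + s)%N)); last exact: rhs_X.
      exact: leq_addr.
    rewrite eL => H; rewrite -addrA raddfD /= H -raddfD /=.
    by rewrite (_ : _ + _ = 0) ?raddf0 // mulNrn; ring.
  by apply: diag_modes => k k0; rewrite ?Ls e.
exists f; split=> //; apply: X_modes.
(* In mode 0 the two rotations cancel; what remains comes from [pert] and [Y], both divisible by
   x^(2s). *)
- rewrite eL -addrA raddfD raddfB /= mode_rot' mode_rotb !expr0 !mul1r subrr add0r.
  apply: mode_X; apply: vanishD; first exact: (@pert_X 0).
  by rewrite mulr2n; apply: vanishD.
- by move=> k k0; rewrite mode0_diag.
by move=> k k0; rewrite swap_diag // mode0_diag.
Qed.

(** Induction on the power of x dividing both series. Mode k of the relation and of its swap are two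
    linear equations modulo x^(v+2s), with determinant nui^(2k) - nu^(2k) up to sign; solving them
    loses only x^s. The sign [sg] treats symmetric and antisymmetric series together. *)
Lemma diag_uniq_off (sg : K) d d' : sg ^+ 2 = 1 -> swap d = cst sg * d -> swap d' = cst sg * d' ->
  diag (beta d - betab d') -> (forall i, d i i = 0) -> (forall i, d' i i = 0) ->
  d = 0 /\ d' = 0.
Proof.
move=> sg2 sd sd' dr d0 d0'.
have sgsg : cst sg * cst sg = 1 by rewrite -rmorphM -expr2 sg2 rmorph1.
suff H (v : nat) : X v d /\ X v d'.
  split; apply/funext => i; apply/funext => j; have [Hd Hd'] := H (minn i j).+1;
  by [exact: Hd|exact: Hd'].
elim: v => [//|v [Xd Xd']].
set r := beta d - betab d' in dr.
have E : X (v + (s + s)) (rot d - rotb d' - r).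
  have -> : rot d - rotb d' - r = (betab d' - rotb d') - (beta d - rot d) by rewrite /r; ring.
  by apply: vanishB; [exact: betab_rotb|exact: beta_rot].
have m1 k : (0 < k)%N -> X (v + (s + s)) (nui ^+ k * mode k d - nu ^+ k * mode k d').
  move=> k0; have := mode_X k E.
  by rewrite raddfB /= (mode0_diag k0 dr) subr0 raddfB /= mode_rot' mode_rotb.
have m2 k : (0 < k)%N -> X (v + (s + s)) (nu ^+ k * mode k d - nui ^+ k * mode k d').
  move=> k0; have Es : X (v + (s + s)) (swap (rot d - rotb d' - r)).
    by move=> i j lt; rewrite swapE E // minnC.
  have := mode_X k Es.
  rewrite rmorphB /= (swap_diag dr) raddfB /= (mode0_diag k0 dr) subr0 rmorphB /=.
  rewrite swap_rot swap_rotb sd sd' rot_cstM rotb_cstM.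
  rewrite raddfB /= !(mode_mul _ _ (diag_cst _)) mode_rot' mode_rotb => /(vanishMl minn_wtD (cst sg)).
  by rewrite mulrBr !(mulrA (cst sg)) sgsg !mul1r.
have nk k : nu ^+ k * nui ^+ k = 1 by rewrite -exprMn nu_nui expr1n.
have fin k u : (0 < k)%N -> X (v + (s + s)) ((nui ^+ (k + k) - nu ^+ (k + k)) * u) -> X v.+1 u.
  move=> k0 /(vanishMl minn_wtD (wh (k + k))); rewrite mulrA [wh _ * _]mulrC whE ?addn_gt0 ?k0 //.
  rewrite addnCA => /X_mulx_inv; apply: vanishW; lia.
have md k : (0 < k)%N -> X v.+1 (mode k d).
  move=> k0; apply: (fin k) => //.
  have -> : (nui ^+ (k + k) - nu ^+ (k + k)) * mode k d =
     nui ^+ k * (nui ^+ k * mode k d - nu ^+ k * mode k d') -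
     nu ^+ k * (nu ^+ k * mode k d - nui ^+ k * mode k d').
    by rewrite !exprD; ring.
  by apply: vanishB; apply: (vanishMl minn_wtD); [exact: m1|exact: m2].
have md' k : (0 < k)%N -> X v.+1 (mode k d').
  move=> k0; apply: (fin k) => //.
  have -> : (nui ^+ (k + k) - nu ^+ (k + k)) * mode k d' =
     nu ^+ k * (nui ^+ k * mode k d - nu ^+ k * mode k d') -
     nui ^+ k * (nu ^+ k * mode k d - nui ^+ k * mode k d').
    by rewrite !exprD; ring.
  by apply: vanishB; apply: (vanishMl minn_wtD); [exact: m1|exact: m2].
have m0 u : (forall i, u i i = 0) -> mode 0 u = 0.
  by move=> u0; apply/funext => i; apply/funext => j; rewrite /mode; case: eqP => // ->.
split; apply: X_modes => [|k k0|k k0]; rewrite ?m0 ?sd ?sd' //; try exact: md; try exact: md'.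
  by rewrite (mode_mul _ _ (diag_cst _)); apply/(vanishMl minn_wtD)/md.
by rewrite (mode_mul _ _ (diag_cst _)); apply/(vanishMl minn_wtD)/md'.
Qed.

Definition off f : A := fun i j => if i == j then 0 else f i j.
Lemma off_diag f : diag (f - off f).
Proof. by move=> i j /negbTE ne; rewrite !ps_subE /off ne subrr. Qed.
Lemma off_swap (sg : K) f : swap f = cst sg * f -> swap (off f) = cst sg * off f.
Proof.
move=> sf; apply/funext => i; apply/funext => j; rewrite swapE bcstM /off eq_sym.
case: eqP => _; first by rewrite mulr0.
by rewrite -swapE sf bcstM.
Qed.

(** Diagonal parts are fixed by [beta] and [betab] and can be removed. With sg = -1 this compares
    solutions of the linear equation; with sg = 1 it shows that a real series in (z1, z2) depends on
    x only. *)
Theorem linear_uniqueness (sg : K) d d' :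
  sg ^+ 2 = 1 -> swap d = cst sg * d -> swap d' = cst sg * d' ->
  diag (beta d - betab d') -> diag d /\ diag d'.
Proof.
move=> sg2 sd sd' dr.
have [] := @diag_uniq_off sg (off d) (off d') sg2 (off_swap sd) (off_swap sd').
- have -> : beta (off d) - betab (off d') =
     (beta d - betab d') - (beta (d - off d) - betab (d' - off d')).
    by rewrite /beta /betab !rmorphB; ring.
  rewrite (beta_diag (off_diag d)) (betab_diag (off_diag d')).
  by apply: diagB => //; apply: diagB; exact: off_diag.
- by move=> i; rewrite /off eqxx.
- by move=> i; rewrite /off eqxx.
move=> e e'; split; first by have := off_diag d; rewrite e subr0.
by have := off_diag d'; rewrite e' subr0.
Qed.

End Linear.

(** * The surface and its normalisations *)

Section Jets.
Variable K : numFieldType.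
Notation A := (ps (ps K)).
Implicit Types f g h u v : A.
Notation p := (@pv K).
Notation q := (@qv K).
Notation x := (@xv K).
Notation cst := (@cst K).

Lemma jet2 f : J 3 (f - (cst (f 0%N 0%N) + cst (f 1%N 0%N) * p + cst (f 0%N 1%N) * q
   + cst (f 2%N 0%N) * p ^+ 2 + cst (f 1%N 1%N) * x + cst (f 0%N 2%N) * q ^+ 2)).
Proof.
have pE k i j : (p ^+ k) i j = ((i == k) && (j == 0%N))%:R.
  by have := bmonoE K k 0 i j; rewrite expr0 mulr1.
have qE k i j : (q ^+ k) i j = ((i == 0%N) && (j == k))%:R.
  by have := bmonoE K 0 k i j; rewrite expr0 mul1r.
have xE i j : x i j = ((i == 1%N) && (j == 1%N))%:R.
  by have := bmonoE K 1 1 i j; rewrite !expr1.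
move=> i j; rewrite !ps_subE !ps_addE !bcstM pE qE xE pvE qvE bcstE.
by case: i j => [|[|[|i]]] [|[|[|j]]] // _; rewrite /=; ring.
Qed.

Lemma subst_jet g h f : J 1 g -> J 2 h -> J 3 (subst g h f -
  (cst (f 0%N 0%N) + cst (f 1%N 0%N) * g + cst (f 0%N 1%N) * h + cst (f 2%N 0%N) * g ^+ 2)).
Proof.
move=> Jg Jh2; have Jh : J 1 h by exact: (vanishW (d := 2)).
have := subst_J g h (jet2 f); rewrite rmorphB !rmorphD /= !rmorphM /=.
rewrite !subst_cst subst_p // subst_q // => H.
rewrite -[X in J 3 X](addrNK (cst (f 1%N 1%N) * (g * h) + cst (f 0%N 2%N) * h ^+ 2)).
apply: vanishD; last first.
  apply: vanishD; apply: (vanishMl addn_wtD); first exact: (@vanishM _ _ addn_wtD 1 2).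
  by apply: (vanishW (d := 2 * 2)) => //; exact: (vanishX addn_wtD).
by apply: (eq_ind _ (J 3) H); ring.
Qed.

Lemma subst00 g h f : subst g h f 0%N 0%N = f 0%N 0%N.
Proof.
rewrite substE /psum big_ord_recl big_ord0 addr0 expr0 mulr1 /psum_row.
by rewrite big_ord_recl big_ord0 addr0 expr0 mulr1 bcstE.
Qed.

(** Moves the coefficient of x^j to q^j, turning a function of the leaf into a series in the second
    variable alone. *)
Definition dser u : A := fun i j => if i == 0%N then u j j else 0.
Lemma subst_dser g u : J 1 g -> diag u -> subst g x (dser u) = u.
Proof.
move=> Jg du; apply: J_all_eq => d.
have H1 : J d (u - \sum_(a < d) cst (u a a) * x ^+ a).
  move=> i j lt; have lt' : (minn i j < d)%N by lia.
  have := diag_app 1 du lt'; rewrite mulr1 !ps_subE => ->; rewrite bsumE.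
  by apply/eqP; rewrite subr_eq0; apply/eqP; apply: eq_bigr => a _; rewrite mulr1 bcstM.
have H2 : J d (dser u - \sum_(a < d) cst (u a a) * q ^+ a).
  move=> i j lt; rewrite !ps_subE bsumE; have ltj : (j < d)%N by lia.
  have qE k : (q ^+ k) i j = ((i == 0%N) && (j == k))%:R.
    by have := bmonoE K 0 k i j; rewrite expr0 mul1r.
  rewrite (bigD1 (Ordinal ltj)) //= bcstM qE eqxx andbT big1 ?addr0 => [|a].
    by rewrite /dser; case: eqP => _; rewrite ?mulr1 ?mulr0 subrr.
  by rewrite -val_eqE /= eq_sym => /negbTE ne; rewrite bcstM qE ne andbF mulr0.
have := subst_J g x H2; rewrite rmorphB rmorph_sum /=.
rewrite (eq_bigr (fun a : 'I_d => cst (u a a) * x ^+ a)) => [H3|a _]; last first.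
  by rewrite rmorphM rmorphXn /= subst_cst subst_q //; exact: J_x.
have -> : subst g x (dser u) - u = (subst g x (dser u) - \sum_(a < d) cst (u a a) * x ^+ a)
   - (u - \sum_(a < d) cst (u a a) * x ^+ a) by ring.
exact: vanishB.
Qed.

Lemma b_domain f g : f * g = 0 -> f = 0 \/ g = 0.
Proof.
apply: ps_mul_eq0 => a b; apply: ps_mul_eq0 => c d /eqP.
by rewrite mulf_eq0 => /orP[/eqP|/eqP]; [left|right].
Qed.
Lemma diag_xI f : diag (x * f) -> diag f.
Proof.
move=> H i j ne; have := H i.+1 j.+1; rewrite -[x]expr1 bxM eqSS ne !subn1.
by rewrite (_ : (_ < 1)%N = false) => [->|] //; lia.
Qed.
Lemma p_cancel f g : p * f = p * g -> f = g.
Proof.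
move=> /(congr1 (fun u => q * u)); rewrite !mulrA [q * p]mulrC -/(xv K) -[xv K]expr1.
exact: xv_inj.
Qed.
Lemma q_cancel f g : q * f = q * g -> f = g.
Proof.
move=> /(congr1 (fun u => p * u)); rewrite !mulrA -/(xv K) -[xv K]expr1.
exact: xv_inj.
Qed.
Lemma p_factor f : f 0%N = 0 -> exists u, f = p * u.
Proof.
move=> f0; exists (fun i j => f i.+1 j); apply/funext => i; apply/funext => j.
have := bmonoM (fun i j => f i.+1 j : K) 1 0 i j; rewrite expr1 expr0 mulr1 => ->.
by case: i => [|i]; rewrite ?f0 //= subn1 subn0.
Qed.

Variables (g h : A) (nu0 : K).
Hypotheses (nu0_neq0 : nu0 != 0) (g0 : g 0%N 0%N = nu0^-1) (h0 : h 0%N 0%N = nu0).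
(** A constant scaling makes the map tangent to the identity, and [inverse_id] applies. *)
Lemma scaled_inverse :
  (forall f, subst (g * p) (h * q) f = 0 -> f = 0) /\
  (forall f, exists u, subst (g * p) (h * q) u = f).
Proof.
have cK : cst nu0 * cst nu0^-1 = 1 by rewrite -rmorphM divff ?rmorph1.
have Jl c : J 1 (cst c * p) by exact/(vanishMl addn_wtD)/J_p.
have Jl' c : J 1 (cst c * q) by exact/(vanishMl addn_wtD)/J_q.
have Jg : J 2 (cst nu0 * (g * p) - p).
  have -> : cst nu0 * (g * p) - p = (cst nu0 * g - 1) * p by ring.
  apply: (@vanishM _ _ addn_wtD 1 1); last exact: J_p.
  by apply: J1P; rewrite !ps_subE bcstM g0 divff // b1E subrr.
have Jh : J 2 (cst nu0^-1 * (h * q) - q).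
  have -> : cst nu0^-1 * (h * q) - q = (cst nu0^-1 * h - 1) * q by ring.
  apply: (@vanishM _ _ addn_wtD 1 1); last exact: J_q.
  by apply: J1P; rewrite !ps_subE bcstM h0 mulVf // b1E subrr.
have [I1 [I2 [J1 J2 _ [[e1 e2] [e3 e4]] _]]] := inverse_id Jg Jh.
have Jgp : J 1 (g * p) by exact/(vanishMl addn_wtD)/J_p.
have Jhq : J 1 (h * q) by exact/(vanishMl addn_wtD)/J_q.
have Jgp' : J 1 (cst nu0 * (g * p)) by exact: (vanishMl addn_wtD).
have Jhq' : J 1 (cst nu0^-1 * (h * q)) by exact: (vanishMl addn_wtD).
pose D := subst (cst nu0^-1 * p) (cst nu0 * q).
pose D' := subst (cst nu0 * p) (cst nu0^-1 * q).
have DD' f : D (D' f) = f.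
  rewrite /D /D' subst_comp // !rmorphM /= !subst_cst subst_p // subst_q //.
  by rewrite !mulrA cK [cst nu0^-1 * _]mulrC cK !mul1r subst_id.
have D'D f : D' (D f) = f.
  rewrite /D /D' subst_comp // !rmorphM /= !subst_cst subst_p // subst_q //.
  by rewrite !mulrA cK [cst nu0^-1 * _]mulrC cK !mul1r subst_id.
have bE f : subst (g * p) (h * q) f = subst (cst nu0 * (g * p)) (cst nu0^-1 * (h * q)) (D f).
  rewrite /D subst_comp // !rmorphM /= !subst_cst subst_p // subst_q //.
  by rewrite !mulrA cK [cst nu0^-1 * _]mulrC cK !mul1r.
split=> [f|f].
  rewrite bE => /(congr1 (subst I1 I2)); rewrite subst_comp // e1 e2 subst_id rmorph0.
  by move=> /(congr1 D'); rewrite D'D /D' rmorph0.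
exists (D' (subst I1 I2 f)); rewrite bE DD' subst_comp // e3 e4; exact: subst_id.
Qed.

End Jets.

(** * The real surface and its equivalences with the normal form *)

Section Surface.
Variable K : numFieldType.
Notation A := (ps (ps K)).
Implicit Types f g h u v : A.
Notation p := (@pv K).
Notation q := (@qv K).
Notation x := (@xv K).
Notation cst := (@cst K).

Variable phi : {rmorphism K -> K}.
Hypotheses (phiK : involutive phi) (phi_norm : forall c, `|phi c| = `|c|).
Notation cj := (bmap phi).

Variables (nu0 eps : K) (s : nat).
Hypotheses (phi_nu0 : phi nu0 = nu0^-1) (nu0_neq0 : nu0 != 0).
Hypotheses (nu0_4 : nu0 ^+ 2 - nu0 ^- 2 != 0).
Hypotheses (phi_eps : phi eps = - eps) (eps_neq0 : eps != 0) (s_gt0 : (0 < s)%N).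

Variable Y : A.
Hypotheses (Y_sym : swap Y = Y) (Y_X : X (s + s) Y) (Y_imag : cj Y = - Y).

Notation nu := (nu nu0 eps s).
Notation nui := (nui nu0 eps s).
Notation B := (B nu0 eps s Y).
Notation Bi := (Bi nu0 eps s Y).
Notation beta := (beta nu0 eps s Y).
Notation betab := (betab nu0 eps s Y).
Notation ex := (@ex K s).

Let YJ : J 1 Y. Proof. by apply: Y_J Y_X. Qed.
Let YNJ : J 1 (- Y) := J1N YJ.
Let exJ c : J 1 (ex c). Proof. by apply: ex_J. Qed.
Let BBi' : B * Bi = 1. Proof. by apply: BBi. Qed.
Let nunui : nu * nui = 1. Proof. by apply: nu_nui. Qed.

Lemma cjK f : cj (cj f) = f.
Proof. by apply/funext => i; apply/funext => j; rewrite /bmap phiK. Qed.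
Lemma cj_swap f : cj (swap f) = swap (cj f).
Proof. by apply/funext => i; apply/funext => j; rewrite swapE /bmap swapE. Qed.
Lemma cjM f g : cj (f * g) = cj f * cj g. Proof. exact: rmorphM. Qed.
Lemma cjD f g : cj (f + g) = cj f + cj g. Proof. exact: rmorphD. Qed.
Lemma swM f g : swap (f * g) = swap f * swap g. Proof. exact: rmorphM. Qed.
Lemma swD f g : swap (f + g) = swap f + swap g. Proof. exact: rmorphD. Qed.
Lemma bM f g : beta (f * g) = beta f * beta g. Proof. exact: rmorphM. Qed.
Lemma bD f g : beta (f + g) = beta f + beta g. Proof. exact: rmorphD. Qed.
Lemma betaE : beta = subst (B * p) (Bi * q). Proof. by []. Qed.
Lemma nuE : nu = cst nu0 * bexp (ex (eps / 2)). Proof. by []. Qed.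
Lemma betabE : betab = subst (Bi * p) (B * q). Proof. by []. Qed.
Lemma nuiE : nui = cst nu0^-1 * bexp (ex (- (eps / 2))). Proof. by []. Qed.
Lemma BE : B = nui * bexp Y. Proof. by []. Qed.
Lemma phi_half : phi 2^-1 = 2^-1. Proof. by rewrite fmorphV rmorph_nat. Qed.
Lemma phi_eps2 : phi (eps / 2) = - (eps / 2).
Proof. by rewrite rmorphM phi_half phi_eps mulNr. Qed.
Lemma cj_ex c : cj (ex c) = ex (phi c).
Proof. by rewrite /ex rmorphM rmorphXn /= bmap_cst bmap_x. Qed.
Lemma cj_nu : cj nu = nui.
Proof. by rewrite rmorphM /= bmap_cst bmap_bexp cj_ex phi_nu0 phi_eps2. Qed.
Lemma cj_nui : cj nui = nu. Proof. by rewrite -cj_nu cjK. Qed.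
Lemma cj_B : cj B = Bi.
Proof. by rewrite rmorphM /= cj_nui bmap_bexp Y_imag. Qed.
Lemma cj_Bi : cj Bi = B. Proof. by rewrite -cj_B cjK. Qed.
Lemma cj_beta f : cj (beta f) = betab (cj f).
Proof.
rewrite /beta /betab bmap_subst; congr (subst _ _ _).
  by rewrite rmorphM /= cj_B bmap_p.
by rewrite rmorphM /= cj_Bi bmap_q.
Qed.
Lemma B00 : B 0%N 0%N = nu0^-1.
Proof. by apply: B_00. Qed.
Lemma Bi00 : Bi 0%N 0%N = nu0.
Proof. by apply: Bi_00. Qed.
Lemma conv_ex c : conv (ex c).
Proof. by apply: convM; [exact: conv_cst|exact/convX/conv_x]. Qed.
Lemma conv_B : conv Y -> conv B.
Proof.
move=> cY; apply: convM; last exact: conv_bexp.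
by apply: convM; [exact: conv_cst|exact/conv_bexp/conv_ex].
Qed.
Lemma conv_Bi : conv Y -> conv Bi.
Proof. by move=> cY; rewrite -cj_B; apply: conv_bmap => //; exact: conv_B. Qed.

(** The inverse determinant of the linear system that expresses p and q through z1 and its
    conjugate; with it the quadratic part of the surface is exactly that of the normal form. It is
    purely imaginary. *)
Let k0 : K := (nu0 ^+ 2 - nu0 ^- 2)^-1.
Lemma k0_neq0 : k0 != 0. Proof. by rewrite invr_eq0. Qed.
Lemma phi_k0 : phi k0 = - k0.
Proof.
rewrite /k0 fmorphV -[RHS]invrN opprB rmorphB fmorphV rmorphXn /= phi_nu0.
by rewrite -exprVn invrK -exprVn.
Qed.
(* z1 and its conjugate on the surface z2 = -pq. *)
Definition Zs : A := cst k0 * (B * p + Bi * q).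
Definition Ws : A := - cst k0 * (Bi * p + B * q).
Lemma cj_mp u : cj (u * p) = cj u * p.
Proof. by rewrite rmorphM /= bmap_p. Qed.
Lemma cj_mq u : cj (u * q) = cj u * q.
Proof. by rewrite rmorphM /= bmap_q. Qed.
Lemma cj_Z : cj Zs = Ws.
Proof.
rewrite /Zs /Ws rmorphM rmorphD /= cj_mp cj_mq cj_B cj_Bi bmap_cst phi_k0.
by rewrite rmorphN.
Qed.
Lemma cj_W : cj Ws = Zs. Proof. by rewrite -cj_Z cjK. Qed.
Lemma Z_J : J 1 Zs.
Proof. by apply/(vanishMl addn_wtD)/vanishD; [exact: J_mp|exact: J_mq]. Qed.
Lemma W_J : J 1 Ws.
Proof. by apply/(vanishMl addn_wtD)/vanishD; [exact: J_mp|exact: J_mq]. Qed.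
Lemma conv_Z : conv Y -> conv Zs.
Proof.
move=> cY; apply: convM; first exact: conv_cst.
by apply: convD; apply: convM; [exact: conv_B|exact: conv_p|exact: conv_Bi|exact: conv_q].
Qed.
Lemma conv_W : conv Y -> conv Ws.
Proof. by move=> cY; rewrite -cj_Z; apply: conv_bmap => //; exact: conv_Z. Qed.

(** Here p and q stand for z1 and its conjugate. [lin1] and [lin2] are real, and their product is
    minus the quadratic form of the surface. *)
Let lin1 : A := - (cst nu0 * q + cst nu0^-1 * p).
Let lin2 : A := cst nu0 * p + cst nu0^-1 * q.
Let Jl1 : J 1 lin1.
Proof. by apply: vanishN; apply: vanishD; apply: (vanishMl addn_wtD); [exact: J_q|exact: J_p]. Qed.
Let Jl2 : J 1 lin2.
Proof. by apply: vanishD; apply: (vanishMl addn_wtD); [exact: J_p|exact: J_q]. Qed.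
Let k0E : cst k0 * (cst nu0 ^+ 2 - cst nu0^-1 ^+ 2) = 1.
Proof. by rewrite -!rmorphXn -rmorphB -rmorphM exprVn mulVf // rmorph1. Qed.
Let nu00 : cst nu0 * cst nu0^-1 = 1.
Proof. by rewrite -rmorphM divff // rmorph1. Qed.

(** Inverts the parametrisation, so that the surface becomes a graph over z1. The combinations [g]
    and [h] of [Zs] and [Ws] cancel the linear part and are tangent to the identity. *)
Theorem surface_chart : exists J1 J2, [/\ J 1 J1, J 1 J2,
   subst J1 J2 Zs = p /\ subst J1 J2 Ws = q,
   (subst Zs Ws J1 = p /\ subst Zs Ws J2 = q) /\ (J 2 (J1 - lin1) /\ J 2 (J2 - lin2))
   & conv Y -> conv J1 /\ conv J2].
Proof.
have JZ := Z_J; have JW := W_J.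
pose g : A := - (cst nu0 * Ws + cst nu0^-1 * Zs).
pose h : A := cst nu0 * Zs + cst nu0^-1 * Ws.
have Jdev c u (t : A) : J 1 t -> u 0%N 0%N = c -> J 2 (u * t - cst c * t).
  move=> Jt e; rewrite -mulrBl; apply: (@vanishM _ _ addn_wtD 1 1) => //.
  by apply: J1P; rewrite !ps_subE bcstE e subrr.
have JB := Jdev _ _ _ (@J_p K) B00; have JB' := Jdev _ _ _ (@J_q K) B00.
have Jb := Jdev _ _ _ (@J_p K) Bi00; have Jb' := Jdev _ _ _ (@J_q K) Bi00.
have JmZ : J 2 (Zs - cst k0 * (cst nu0^-1 * p + cst nu0 * q)).
  have -> : Zs - cst k0 * (cst nu0^-1 * p + cst nu0 * q) =
     cst k0 * ((B * p - cst nu0^-1 * p) + (Bi * q - cst nu0 * q)) by rewrite /Zs; ring.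
  by apply/(vanishMl addn_wtD)/vanishD.
have JmW : J 2 (Ws + cst k0 * (cst nu0 * p + cst nu0^-1 * q)).
  have -> : Ws + cst k0 * (cst nu0 * p + cst nu0^-1 * q) =
     - cst k0 * ((Bi * p - cst nu0 * p) + (B * q - cst nu0^-1 * q)) by rewrite /Ws; ring.
  by apply/(vanishMl addn_wtD)/vanishD.
have Jg : J 2 (g - p).
  have -> : g - p = - (cst nu0 * (Ws + cst k0 * (cst nu0 * p + cst nu0^-1 * q))
      + cst nu0^-1 * (Zs - cst k0 * (cst nu0^-1 * p + cst nu0 * q)))
      + (cst k0 * (cst nu0 ^+ 2 - cst nu0^-1 ^+ 2) - 1) * p by rewrite /g; ring.
  rewrite k0E subrr mul0r addr0; apply: vanishN; apply: vanishD; exact: (vanishMl addn_wtD).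
have Jh : J 2 (h - q).
  have -> : h - q = (cst nu0 * (Zs - cst k0 * (cst nu0^-1 * p + cst nu0 * q))
      + cst nu0^-1 * (Ws + cst k0 * (cst nu0 * p + cst nu0^-1 * q)))
      + (cst k0 * (cst nu0 ^+ 2 - cst nu0^-1 ^+ 2) - 1) * q by rewrite /h; ring.
  rewrite k0E subrr mul0r addr0; apply: vanishD; exact: (vanishMl addn_wtD).
have [I1 [I2 [JI1 JI2 [D1 D2] [[e1 e2] [e3 e4]] cI]]] := inverse_id Jg Jh.
have ZE : Zs = cst k0 * (cst nu0^-1 * g + cst nu0 * h).
  transitivity (cst k0 * (cst nu0 ^+ 2 - cst nu0^-1 ^+ 2) * Zs); first by rewrite k0E mul1r.
  rewrite /g /h; ring.
have WE : Ws = - cst k0 * (cst nu0 * g + cst nu0^-1 * h).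
  transitivity (cst k0 * (cst nu0 ^+ 2 - cst nu0^-1 ^+ 2) * Ws); first by rewrite k0E mul1r.
  rewrite /g /h; ring.
have linE1 a b u v : subst u v (cst a * p + cst b * q) = cst a * subst u v p + cst b * subst u v q.
  by rewrite rmorphD !rmorphM /= !subst_cst.
have linE2 a b c u v f f' : subst u v (cst c * (cst a * f + cst b * f')) =
    cst c * (cst a * subst u v f + cst b * subst u v f').
  by rewrite rmorphM rmorphD !rmorphM /= !subst_cst.
have ZI : subst I1 I2 Zs = cst k0 * (cst nu0^-1 * p + cst nu0 * q).
  by rewrite [in LHS]ZE linE2 e1 e2.
have WI : subst I1 I2 Ws = cst (- k0) * (cst nu0 * p + cst nu0^-1 * q).
  by rewrite [in LHS]WE -rmorphN linE2 e1 e2.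
exists (subst lin1 lin2 I1), (subst lin1 lin2 I2); split; try exact: subst_J.
- rewrite -!subst_comp // ZI WI !linE2 !subst_p // !subst_q //; split.
    transitivity (cst k0 * (cst nu0 ^+ 2 - cst nu0^-1 ^+ 2) * p); last by rewrite k0E mul1r.
    by rewrite /lin1 /lin2; ring.
  transitivity (cst k0 * (cst nu0 ^+ 2 - cst nu0^-1 ^+ 2) * q); last by rewrite k0E mul1r.
  by rewrite /lin1 /lin2 rmorphN; ring.
- split.
    rewrite !subst_comp //.
    have -> : subst Zs Ws lin1 = g.
      by rewrite /lin1 rmorphN /= [_ * q + _]addrC linE1 subst_p // subst_q // /g addrC.
    have -> : subst Zs Ws lin2 = h by rewrite /lin2 linE1 subst_p // subst_q.
    by [].
  have H I (i : A) : J 1 i -> J 2 (I - i) -> J 2 (subst lin1 lin2 I - subst lin1 lin2 i).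
    by move=> Ji JI; rewrite -rmorphB; exact: subst_J.
  split; [have := H _ _ (@J_p K) D1|have := H _ _ (@J_q K) D2];
  by rewrite ?subst_p // ?subst_q.
move=> cY; have cg : conv g.
  by apply: convN; apply: convD; apply: convM; try exact: conv_cst; [exact: conv_W|exact: conv_Z].
have ch : conv h.
  by apply: convD; apply: convM; try exact: conv_cst; [exact: conv_Z|exact: conv_W].
have [c1 c2] := cI cg ch.
have cl1 : conv lin1.
  by apply: convN; apply: convD; apply: convM; try exact: conv_cst; [exact: conv_q|exact: conv_p].
have cl2 : conv lin2.
  by apply: convD; apply: convM; try exact: conv_cst; [exact: conv_p|exact: conv_q].
by split; exact: conv_subst.
Qed.

Lemma small_divisors : exists wh : nat -> A, (forall k, diag (wh k)) /\
  forall k, (0 < k)%N -> (nui ^+ k - nu ^+ k) * wh k = x ^+ s.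
Proof.
have H (k : nat) : exists w, diag w /\ ((0 < k)%N -> (nui ^+ k - nu ^+ k) * w = x ^+ s).
  case: k => [|k]; first by exists 0; split=> //; exact: diag0.
  by have [//|w dw e] := @small_divisor K nu0 eps s nu0_neq0 eps_neq0 s_gt0 k.+1; exists w.
have [wh Hwh] := choice H.
by exists wh; split=> k; case: (Hwh k).
Qed.

(* [U] and [F] are z1 and z2 along a parametrised surface, [V] and [Fb] their
   conjugates. *)
Definition nf_rel (f1 f2 U V F Fb : A) : Prop :=
  let S := subst U F f1 in let Sb := subst V Fb (cj f1) in
  let g := subst U F f2 in let gb := subst V Fb (cj f2) in
  let G := cst (- 2^-1) * (g + gb) in
  g = (cst (nu0 ^+ 2) * bexp (cst eps * G ^+ s)
       + cst (nu0 ^- 2) * bexp (cst (- eps) * G ^+ s)) * S * Sb + S ^+ 2 + Sb ^+ 2.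

Lemma J_expo c G : J 1 G -> J 1 (cst c * G ^+ s).
Proof.
move=> JG; apply: (vanishMl addn_wtD); apply: (vanishW (d := s)) => //; exact: J_pow.
Qed.

(** The relation is an identity between series, so it can be pulled back. This passes between the
    parameters (p, q) and the graph over z1, in both directions. *)
Lemma nf_transport a b f1 f2 U V F Fb : J 1 U -> J 1 V -> J 1 F -> J 1 Fb ->
  f2 0%N 0%N = 0 -> nf_rel f1 f2 U V F Fb ->
  nf_rel f1 f2 (subst a b U) (subst a b V) (subst a b F) (subst a b Fb).
Proof.
move=> JU JV JF JFb f20; rewrite /nf_rel -!subst_comp //.
set g := subst U F f2; set gb := subst V Fb (cj f2).
set S := subst U F f1; set Sb := subst V Fb (cj f1).
have JG : J 1 (cst (- 2^-1) * (g + gb)).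
  apply/(vanishMl addn_wtD)/vanishD; apply: subst_J; apply: J1P => //.
  by rewrite /bmap f20 rmorph0.
have eG : cst (- 2^-1) * (subst a b g + subst a b gb) = subst a b (cst (- 2^-1) * (g + gb)).
  by rewrite rmorphM rmorphD /= subst_cst.
rewrite eG; move: (cst _ * (g + gb)) JG => G JG {eG}.
have eE c : bexp (cst c * subst a b G ^+ s) = subst a b (bexp (cst c * G ^+ s)).
  rewrite [RHS](subst_bapp a b _ (J_expo c JG)) /bexp; congr (bapp _ _).
  by rewrite rmorphM /= rmorphXn /= subst_cst.
rewrite !eE => {1}->.
by rewrite !(rmorphD, rmorphM, rmorphXn) /= !subst_cst.
Qed.

Section Leaf.
Variable G : A.
Hypotheses (G_diag : diag G) (G_real : cj G = G) (JG : J 1 G).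
(** [nu] on the target leaf: [G], which is -Re z2 at the image point, replaces x. *)
Definition nuG : A := cst nu0 * bexp (cst (eps / 2) * G ^+ s).
Definition nuGi : A := cst nu0^-1 * bexp (cst (- (eps / 2)) * G ^+ s).
Lemma nuG_nuGi : nuG * nuGi = 1.
Proof.
have J1e := J_expo (eps / 2) JG.
transitivity (cst nu0 * cst nu0^-1 * (bexp (- (cst (eps / 2) * G ^+ s)) * bexp (cst (eps / 2) * G ^+ s))).
  by rewrite /nuG /nuGi rmorphN mulNr; ring.
by rewrite bexpNK // nu00 mul1r.
Qed.
Lemma nuG_diag : diag nuG.
Proof.
apply: diagM; first exact: diag_cst.
by apply/diag_bapp/diagM; [exact: diag_cst|exact: diagX].
Qed.
Lemma nuGi_diag : diag nuGi.
Proof.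
apply: diagM; first exact: diag_cst.
by apply/diag_bapp/diagM; [exact: diag_cst|exact: diagX].
Qed.
Lemma cj_nuG : cj nuG = nuGi.
Proof.
rewrite /nuG rmorphM /= bmap_cst phi_nu0 bmap_bexp rmorphM rmorphXn /= bmap_cst.
by rewrite phi_eps2 G_real.
Qed.
Lemma cj_nuGi : cj nuGi = nuG. Proof. by rewrite -cj_nuG cjK. Qed.
Lemma nuG2 : nuG ^+ 2 = cst (nu0 ^+ 2) * bexp (cst eps * G ^+ s).
Proof.
have J1e := J_expo (eps / 2) JG.
rewrite /nuG exprMn -rmorphXn -bexpMn //; congr (_ * bexp _).
by rewrite -mulrnAl -rmorphMn /= -[_ *+ 2]mulr_natr divfK // pnatr_eq0.
Qed.
Lemma nuGi2 : nuGi ^+ 2 = cst (nu0 ^- 2) * bexp (cst (- eps) * G ^+ s).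
Proof.
have J1e := J_expo (- (eps / 2)) JG.
rewrite /nuGi exprMn -rmorphXn -bexpMn //= exprVn; congr (_ * bexp _).
by rewrite -mulrnAl -rmorphMn /= mulNrn -[_ *+ 2]mulr_natr divfK // pnatr_eq0.
Qed.
Lemma conv_nuG : conv G -> conv nuG.
Proof.
move=> cG; apply: convM; first exact: conv_cst.
by apply/conv_bexp/convM; [exact: conv_cst|exact: convX].
Qed.
Lemma conv_nuGi : conv G -> conv nuGi.
Proof.
move=> cG; apply: convM; first exact: conv_cst.
by apply/conv_bexp/convM; [exact: conv_cst|exact: convX].
Qed.
End Leaf.

Lemma anti_diag0 (e : A) i : swap e = - e -> e i i = 0.
Proof.
move=> se; have : swap e i i = (- e) i i by rewrite se.
by rewrite swapE !ps_oppE => /eqP; rewrite -addr_eq0 -mulr2n mulrn_eq0 /= => /eqP.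
Qed.

(* The linear equation is the logarithm of the reality condition for the
   conjugacy, hence its solution is real by uniqueness. *)
Lemma solution_real e : swap e = - e -> diag (Lam nu0 eps s Y e + Y *+ 2) -> cj e = e.
Proof.
move=> se dg; have [wh [_ whE]] := small_divisors.
have dgc := bmap_diag phi dg.
have cL : cj (Lam nu0 eps s Y e + Y *+ 2) = betab (cj e) - beta (cj e) - Y *+ 2.
  rewrite /Lam rmorphD rmorphB rmorphMn /= cj_beta Y_imag mulNrn; congr (_ - _ - _).
  by rewrite -[RHS]cjK cj_beta cjK.
pose d := e - cj e.
have sdN : swap d = - d by rewrite /d rmorphB /= -cj_swap se rmorphN /=; ring.
have sd : swap d = cst (-1) * d by rewrite sdN rmorphN rmorph1 mulN1r.
have dd : diag (beta d - betab d).
  have -> : beta d - betab d = (Lam nu0 eps s Y e + Y *+ 2) + cj (Lam nu0 eps s Y e + Y *+ 2).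
    by rewrite cL /Lam /d /beta /betab !rmorphB; ring.
  exact: diagD.
have [|dz _] := linear_uniqueness nu0_neq0 eps_neq0 s_gt0 Y_X whE _ sd sd dd.
  by rewrite sqrrN expr1n.
suff : d = 0 by rewrite /d => /eqP; rewrite subr_eq0 => /eqP.
apply/funext => i; apply/funext => j; have [e_ij|ne] := eqVneq i j; last exact: dz.
by rewrite e_ij anti_diag0.
Qed.

Lemma bexp_log_real u : u 0%N 0%N = 1 -> cj u = u -> cj (blog u) = blog u.
Proof.
move=> u1 ru; have Jl := @blog_J K u.
by apply: bexp_inj; [exact: bmap_vanish|exact: Jl|rewrite -bmap_bexp blogK].
Qed.

(** The target has real coordinates P = r p e^V and Q = r q e^-V with PQ = G, and its z1 is S = k
    (mP + nQ). The linear equation makes V real and S the image under [beta] of a symmetric series,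
    hence a series in (z1, z2); the second component -G depends on z2 only. *)
Theorem formal_normalization e : swap e = - e ->
  diag (Lam nu0 eps s Y e + Y *+ 2) -> X (s + s) (Lam nu0 eps s Y e + Y *+ 2) ->
  exists f1 f2, [/\ f1 0%N 0%N = 0, f2 0%N 0%N = 0,
    f1 1%N 0%N * f2 0%N 1%N - f1 0%N 1%N * f2 1%N 0%N != 0
    & nf_rel f1 f2 Zs Ws (- x) (- x)].
Proof.
move=> se dg Xd; have re := solution_real se dg.
set del' := Lam _ _ _ _ _ + _ in dg Xd; pose del := - del'.
have ddel : diag del by exact: diagN.
have Xdel : X (s + s) del by exact: vanishN.
pose E := beta e; have cE : cj E = betab e by rewrite cj_beta re.
have Eeq : E - cj E + Y *+ 2 + del = 0 by rewrite cE /del /del' /Lam -/E; ring.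
have rdel : cj del = - del.
  have -> : del = - (E - cj E + Y *+ 2) by apply/eqP; rewrite -addr_eq0 addrC Eeq.
  by rewrite !rmorphN rmorphD rmorphB rmorphMn /= cjK Y_imag; ring.
pose d1 := shx s del.
have d1E : x ^+ s * d1 = del by apply: shxK; apply: (vanishW (d := (s + s)%N)) => //; exact: leq_addr.
have Xd1 : X s d1 by apply: (@X_mulx_inv _ s); rewrite d1E.
have dd1 : diag d1 by move=> i j ne; rewrite /d1 /shx; apply: ddel; rewrite eqn_add2r.
have rd1 : cj d1 = - d1.
  by apply: (@xv_inj _ s); rewrite -{1}(bmap_x phi) -rmorphXn -rmorphM /= d1E rdel mulrN d1E.
pose u := 1 + cst eps^-1 * d1.
have u1 : u 0%N 0%N = 1.
  by rewrite /u !ps_addE bcstM Xd1 ?mulr0 ?addr0 ?b1E //= minnn.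
have ru : cj u = u.
  by rewrite /u rmorphD rmorph1 rmorphM /= bmap_cst fmorphV phi_eps rd1 invrN rmorphN mulrNN.
have du : diag u by apply: diagD; [exact: diag1|apply: diagM => //; exact: diag_cst].
(* G = x u^(1/s) satisfies eps G^s = eps x^s + del: the diagonal remainder is absorbed into the leaf
   parameter. This uses that [del] is x^s times a series without constant term. *)
pose l := cst s%:R^-1 * blog u.
have Jl : J 1 l by apply/(vanishMl addn_wtD)/blog_J.
have dl : diag l by apply: diagM; [exact: diag_cst|exact: diag_blog].
have rl : cj l = l.
  by rewrite /l rmorphM /= bmap_cst fmorphV rmorph_nat bexp_log_real.
have sl : l *+ s = blog u.
  rewrite /l -mulrnAl -rmorphMn /= -[_ *+ s]mulr_natr mulVf ?rmorph1 ?mul1r //.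
  by rewrite pnatr_eq0 -lt0n.
pose G := x * bexp l.
have JG : J 1 G by apply/(vanishMr addn_wtD)/J_x.
have dG : diag G by apply: diagM; [exact: diag_x|exact: diag_bapp].
have rG : cj G = G by rewrite /G rmorphM /= bmap_x bmap_bexp rl.
have Gs : cst eps * G ^+ s = ex eps + del.
  rewrite /G exprMn -bexpMn // sl blogK // /u mulrDr mulr1 mulrDr.
  transitivity (ex eps + cst eps * cst eps^-1 * (x ^+ s * d1)); first by rewrite /ex; ring.
  by rewrite -rmorphM divff // rmorph1 mul1r d1E.
have Jdel : J 1 del by apply: J1P; apply: Xdel; rewrite minnn addn_gt0 s_gt0.
pose hl := cst 2^-1 * l.
have Jhl : J 1 hl by exact: (vanishMl addn_wtD).
have half2 (v : A) : (cst 2^-1 * v) *+ 2 = v.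
  by rewrite -mulrnAl -rmorphMn /= -[_ *+ 2]mulr_natr mulVf ?rmorph1 ?mul1r // pnatr_eq0.
pose r := bexp hl.
have r2 : r ^+ 2 = bexp l by rewrite -bexpMn // half2.
have rr : cj r = r by rewrite bmap_bexp /hl rmorphM /= bmap_cst phi_half rl.
have dr : diag r by apply/diag_bapp/diagM; [exact: diag_cst|exact: dl].
pose n := nuG G; pose m := nuGi G.
have nm : n * m = 1 by exact: nuG_nuGi.
have cn : cj n = m by exact: cj_nuG.
have cm : cj m = n by exact: cj_nuGi.
have dn : diag n by exact: nuG_diag.
have dm : diag m by exact: nuGi_diag.
have JE : J 1 E.
  by apply: subst_J; apply: J1P; exact: anti_diag0.
(* Its reality is exactly [Eeq]; in e^V = n B e^E the factor [n B] compares the multipliers of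
   target and source. *)
pose V := cst 2^-1 * del + Y + E.
have JV : J 1 V by apply: vanishD => //; apply: vanishD => //; exact: (vanishMl addn_wtD).
have rV : cj V = V.
  rewrite /V !rmorphD rmorphM /= bmap_cst phi_half rdel Y_imag.
  have -> : cj E = E + Y *+ 2 + del by apply/eqP; rewrite eq_sym -subr_eq0 -Eeq; apply/eqP; ring.
  rewrite -[in X in _ + (_ + X)](half2 del); ring.
have eV : bexp V = n * B * bexp E.
  have -> : n = nu * bexp (cst 2^-1 * del).
    rewrite /n /nuG nuE -mulrA -bexpD //; last exact: (vanishMl addn_wtD).
    congr (_ * bexp _); rewrite [_ * G ^+ s](_ : _ = cst 2^-1 * (cst eps * G ^+ s)).
      by rewrite Gs mulrDr /ex !rmorphM; ring.
    by rewrite rmorphM; ring.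
  have JY := YJ; have Jhd : J 1 (cst 2^-1 * del) by exact: (vanishMl addn_wtD).
  rewrite /V bexpD ?bexpD //; last exact: vanishD.
  transitivity (nu * nui * (bexp (cst 2^-1 * del) * bexp Y * bexp E)); last by rewrite BE; ring.
  by rewrite nunui mul1r.
have eVN : bexp (- V) = m * Bi * bexp (- E).
  have h1 : bexp V * (m * Bi * bexp (- E)) = 1.
    rewrite eV; transitivity ((n * m) * (B * Bi) * (bexp (- E) * bexp E)); first by ring.
    by rewrite nm BBi' bexpNK // !mulr1.
  transitivity (bexp (- V) * (bexp V * (m * Bi * bexp (- E)))); first by rewrite h1 mulr1.
  by rewrite mulrA bexpNK // mul1r.
pose P := r * p * bexp V; pose Q := r * q * bexp (- V).
have PQ : P * Q = G.
  transitivity (r ^+ 2 * x * (bexp (- V) * bexp V)); first by rewrite /P /Q /xv; ring.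
  by rewrite bexpNK // r2 mulr1 /G mulrC.
have rP : cj P = P by rewrite /P !rmorphM /= rr bmap_p bmap_bexp rV.
have rQ : cj Q = Q by rewrite /Q !rmorphM /= rr bmap_q bmap_bexp rmorphN /= rV.
pose w := n ^+ 2 - m ^+ 2.
have w00 : w 0%N 0%N != 0.
  have e0 c : (cst c * G ^+ s) 0%N 0%N = 0 by exact: (J_expo c JG).
  rewrite /w !expr2 !ps_subE !b00M /n /m /nuG /nuGi !b00M !bcstE /= !bexp_00; try exact: J_expo.
  by rewrite !mulr1 -!expr2 exprVn.
pose k := binv w; have wk : w * k = 1 by exact: mulbV.
have dk : diag k by apply/diag_binv/diagB; exact: diagX.
have ck : cj k = - k.
  apply: (bmul_cancel w00); rewrite mulrN wk.
  have -> : w = - cj w by rewrite /w rmorphB !rmorphXn /= cn cm opprB.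
  by rewrite mulNr -rmorphM wk rmorph1.
pose S := k * (m * P + n * Q).
have cS : cj S = - k * (n * P + m * Q).
  by rewrite /S (cjM k) cjD (cjM m) (cjM n) ck cn cm rP rQ.
pose Sh := k * (r * (p * bexp e + q * bexp (- e))).
have Je : J 1 e by apply: J1P; exact: anti_diag0.
have JNe := J1N Je.
have sSh : swap Sh = Sh.
  rewrite /Sh (swM k) (swM r) swD (swM p) (swM q) (swap_diag dk) (swap_diag dr).
  rewrite swap_p swap_q !swap_bexp // rmorphN /= se opprK; ring.
have bp : beta p = B * p by rewrite betaE subst_p //; exact: J_mp.
have bq : beta q = Bi * q by rewrite betaE subst_q //; exact: J_mq.
have be v : J 1 v -> beta (bexp v) = bexp (beta v) by exact: subst_bapp.
have bd v : diag v -> beta v = v by exact: beta_diag.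
have SE : S = beta Sh.
  rewrite /Sh (bM k) (bM r) bD (bM p) (bM q) (bd _ dk) (bd _ dr) bp bq (be _ Je) (be _ JNe) [beta (- e)]rmorphN -/E /= /S /P /Q eV eVN.
  transitivity (k * (r * ((n * m) * (B * p * bexp E) + (n * m) * (Bi * q * bexp (- E))))); first by ring.
  by rewrite nm !mul1r.
(* Under [beta], p + q becomes z1 / k0 and x stays -z2, which explains the rescaling in [f1]. *)
have [u' Su'] := symmetric_series sSh.
have Jpq : J 1 (p + q) by apply: vanishD; [exact: J_p|exact: J_q].
have JZ : J 1 Zs by exact: Z_J.
have Jx := @J_x K; have JNx := J1N Jx; have Jp := @J_p K; have Jq := @J_q K.
pose f1 := subst (cst k0^-1 * p) (- q) u'.
pose f2 := - subst p (- q) (dser G).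
have k0K : cst k0^-1 * cst k0 = 1 by rewrite -rmorphM mulVf ?rmorph1 // k0_neq0.
have f1E : subst Zs (- x) f1 = S.
  rewrite /f1 subst_comp; [|exact: (vanishMl addn_wtD)|exact: J1N].
  rewrite rmorphM rmorphN /= subst_cst subst_p // subst_q // opprK /Zs mulrA k0K mul1r.
  rewrite SE Su' betaE subst_comp // -betaE (bd _ (@diag_x K)).
  by rewrite bD bp bq.
have f2E : subst Zs (- x) f2 = - G.
  rewrite /f2 rmorphN /= subst_comp //; last exact: J1N.
  by rewrite subst_p // rmorphN /= subst_q // opprK subst_dser.
have f1b : subst Ws (- x) (cj f1) = cj S.
  by rewrite -f1E bmap_subst cj_Z rmorphN /= bmap_x.
have f2b : subst Ws (- x) (cj f2) = - G.
  have -> : - G = cj (subst Zs (- x) f2) by rewrite f2E rmorphN /= rG.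
  by rewrite bmap_subst cj_Z [cj (- x)]rmorphN /= bmap_x.
exists f1, f2; split.
- rewrite /f1 subst00 -(subst00 (p + q) x) -Su' /Sh !b00M !ps_addE !b00M pvE qvE /=.
  by rewrite !mul0r addr0 !mulr0.
- by rewrite /f2 ps_oppE ps_oppE subst00 /dser /= JG ?oppr0.
(* [f2] is z2 up to order two, so the Jacobian is the z1 derivative of [f1], that is k r / k0 at the
   origin. *)
- have Jx2 : J 2 x by apply: (@vanishM _ _ addn_wtD 1 1).
  have jet_f2 := @subst_jet K p (- q) (dser G) Jp.
  have f2lin i j : (i + j < 2)%N -> f2 i j = (q i j).
    have H : J 2 (subst p (- q) (dser G) + q).
      have G11 : G 1%N 1%N = 1.
        have := bxM 1 (bexp l) 1 1; rewrite expr1 /= => e1; rewrite /G e1 subnn.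
        exact: bexp_00.
      have Jd2 : J 2 (dser G - q).
        move=> [|[|i']] [|[|j']] //; rewrite !ps_subE qvE /dser /= ?subrr //.
          by rewrite JG // subrr.
        by rewrite G11 subrr.
      have := subst_J p (- q) Jd2; rewrite rmorphB /= subst_q; last exact: J1N.
      by rewrite opprK.
    move=> lt; have := H i j lt; rewrite !ps_addE => /eqP; rewrite addr_eq0 => /eqP.
    by rewrite /f2 !ps_oppE => ->; rewrite opprK.
  rewrite !f2lin // !qvE /= mulr1 mulr0 subr0.
  have f1lin : f1 1%N 0%N = k0^-1 * u' 1%N 0%N.
    have H : J 2 (u' - (cst (u' 0%N 0%N) + cst (u' 1%N 0%N) * p + cst (u' 0%N 1%N) * q)).
      have pE i j : p i j = ((i == 1%N) && (j == 0%N))%:R := pvE K i j.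
      move=> [|[|i]] [|[|j]] //; rewrite !ps_subE !ps_addE !bcstM pvE qvE bcstE /=; try (by move=> _; ring); lia.
    have := @subst_J _ (cst k0^-1 * p) (- q) _ _ H 1%N 0%N isT.
    rewrite rmorphB !rmorphD !rmorphM /= !subst_cst subst_p ?subst_q; [|exact: J1N|exact: (vanishMl addn_wtD)].
    rewrite !ps_subE !ps_addE !bcstM !ps_oppE pvE qvE bcstE /= -/f1 => /eqP.
    by rewrite subr_eq0 => /eqP ->; ring.
  rewrite f1lin mulf_neq0 // ?invr_eq0 ?k0_neq0 //.
  have Sh10 : Sh 1%N 0%N = u' 1%N 0%N.
    have H : J 2 (u' - (cst (u' 0%N 0%N) + cst (u' 1%N 0%N) * p + cst (u' 0%N 1%N) * q)).
      move=> [|[|i]] [|[|j]] //; rewrite !ps_subE !ps_addE !bcstM pvE qvE bcstE /=; try (by move=> _; ring); lia.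
    have := @subst_J _ (p + q) x _ _ H 1%N 0%N isT.
    rewrite rmorphB !rmorphD !rmorphM /= !subst_cst subst_p // subst_q // -Su'.
    rewrite !ps_subE !ps_addE !bcstM !ps_addE pvE qvE bcstE Jx2 //= => /eqP.
    by rewrite subr_eq0 => /eqP ->; ring.
  rewrite -Sh10.
  have H : J 2 (Sh - cst (k 0%N 0%N * r 0%N 0%N) * (p + q)).
    pose kr := k * r.
    have -> : Sh - cst (k 0%N 0%N * r 0%N 0%N) * (p + q) =
      (kr - cst (kr 0%N 0%N)) * (p * bexp e + q * bexp (- e)) +
      cst (kr 0%N 0%N) * (p * (bexp e - 1) + q * (bexp (- e) - 1)).
      by rewrite /Sh /kr b00M; ring.
    have Jb v : J 1 v -> J 1 (bexp v - 1).
      by move=> Jv; apply: J1P; rewrite !ps_subE bexp_00 // b1E subrr.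
    apply: vanishD.
      apply: (@vanishM _ _ addn_wtD 1 1); first exact: nc_J.
      by apply: vanishD; exact: (vanishMr addn_wtD).
    apply: (vanishMl addn_wtD); apply: vanishD; apply: (@vanishM _ _ addn_wtD 1 1) => //; exact: Jb.
  have := H 1%N 0%N isT; rewrite !ps_subE bcstM !ps_addE pvE qvE /= addr0 mulr1.
  move/eqP; rewrite subr_eq0 => /eqP ->; rewrite mulf_neq0 //.
    by rewrite /k binv_00 // invr_eq0.
  by rewrite /r bexp_00 // oner_eq0.
rewrite /nf_rel f1E f1b f2E f2b.
have -> : cst (- 2^-1) * (- G - G) = G.
  by rewrite -[RHS]half2 rmorphN; ring.
rewrite -nuG2 // -nuGi2 // -/n -/m cS /S -PQ.
have K2 : k ^+ 2 * (n ^+ 2 - m ^+ 2) ^+ 2 = 1.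
  by rewrite -exprMn mulrC wk expr1n.
(* All monomials except PQ carry the factor 1 - nm = 0, and [k] is the inverse of n^2 - m^2. *)
transitivity (- (k ^+ 2 * (n ^+ 2 - m ^+ 2) ^+ 2) * (P * Q) + k ^+ 2 * (1 - n * m) *
   ((n ^+ 2 + m ^+ 2) * (P ^+ 2 + Q ^+ 2) + (n * m * P * Q) *+ 4)).
  by rewrite K2 nm; ring.
ring.
Qed.

Lemma ps0_mul (f g : A) : (f * g) 0%N = f 0%N * g 0%N.
Proof. by rewrite ps_mulE big_ord1. Qed.
Lemma b10M f g : f 0%N 0%N = 0 -> g 0%N 0%N = 0 ->
  (f * g) 2%N 0%N = f 1%N 0%N * g 1%N 0%N /\
  (f * g) 1%N 1%N = f 1%N 0%N * g 0%N 1%N + f 0%N 1%N * g 1%N 0%N.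
Proof.
move=> f0 g0; rewrite !bmulE !big_ord_recl !big_ord0 /= !subn0 !subnn /bump /= f0 g0.
rewrite !(mul0r, mulr0, addr0, add0r) !addn0 subSS subn0.
by split=> //; rewrite addrC.
Qed.

Section Branch.
Variables (sg : K) (e U T : A) (c : K).
Hypotheses (sg2 : sg ^+ 2 = 1) (se : swap e = - e)
  (eq_e : diag (Lam nu0 eps s Y e + Y *+ 2)).
Hypotheses (U00 : U 0%N 0%N != 0) (UU : diag (U * swap U)) (cU : conv (beta U)).
Hypotheses (JT : J 1 T) (TY : diag (T *+ 2 - cst sg * Y *+ 2))
  (eqT : cst c * bexp T * beta U = cst (phi c) * bexp (- T) * cj (beta U)).
Hypothesis c_neq0 : c != 0.

(** A logarithm turns the multiplicative relation [eqT] into the linear equation for the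
    antisymmetric part of log U, with source [sg * Y] modulo diagonal series. By uniqueness that
    part is [sg * e] modulo diagonals, while log (beta U), up to a constant, converges. *)
Lemma branch_bound : exists2 v, conv v & diag (beta e - v).
Proof.
pose al := U 0%N 0%N; pose V := cst al^-1 * U.
have V00 : V 0%N 0%N = 1 by rewrite /V bcstM mulVf.
pose L := blog V; have JL : J 1 L by exact: blog_J.
have UE : U = cst al * bexp L by rewrite blogK // /V mulrA -rmorphM divff // rmorph1 mul1r.
have JbL : J 1 (beta L) by exact: subst_J.
have bexpb w : J 1 w -> beta (bexp w) = bexp (beta w) by exact: subst_bapp.
have bUE : beta U = cst al * bexp (beta L).
  by rewrite {1}UE bM bexpb //; congr (_ * _); exact: subst_cst.
have JsL : J 1 (swap L) by exact: subst_J.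
have dLL : diag (L + swap L).
  have W00 : (V * swap V) 0%N 0%N = 1 by rewrite b00M swapE V00 mulr1.
  have -> : L + swap L = blog (V * swap V).
    apply: bexp_inj; [exact: vanishD|exact: blog_J|].
    by rewrite bexpD // -swap_bexp // !blogK.
  apply: diag_blog; have -> : V * swap V = cst (al^-1 * al^-1) * (U * swap U).
    have -> : swap V = cst al^-1 * swap U by rewrite swM; congr (_ * _); exact: subst_cst.
    by rewrite rmorphM /V; ring.
  by apply: diagM => //; exact: diag_cst.
have al_phi : c * al != 0 by rewrite mulf_neq0.
(* The exponential of the left side is constant by [eqT], and a series without constant term whose
   exponential is constant vanishes. *)
have main : beta L - cj (beta L) + T *+ 2 = 0.
  have JcL : J 1 (cj (beta L)) by exact: bmap_vanish.
  have JT2 : J 1 (T *+ 2) by rewrite mulr2n; exact: vanishD.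
  have JNc := J1N JcL; have JD : J 1 (beta L - cj (beta L)) by exact: vanishD.
  apply: (@bexp_eqcst _ _ (phi (c * al) / (c * al))); first exact: vanishD.
  rewrite bexpD // bexpD // mulr2n bexpD //.
  have h : cst (c * al) * (bexp (beta L) * bexp T) = cst (phi (c * al)) * (bexp (- T) * cj (bexp (beta L))).
    move: eqT; rewrite bUE cjM bmap_cst !rmorphM => h.
    by transitivity (cst c * bexp T * (cst al * bexp (beta L))); [ring|rewrite h; ring].
  have JNT := J1N JT.
  have cc : cst (c * al)^-1 * cst (c * al) = 1 by rewrite -rmorphM mulVf // rmorph1.
  transitivity (cst (c * al)^-1 * (cst (c * al) * (bexp (beta L) * bexp T)) * (bexp (- cj (beta L)) * bexp T)).
    by rewrite -[LHS]mul1r -cc; ring.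
  rewrite h bmap_bexp.
  transitivity (cst (phi (c * al)) * cst (c * al)^-1 * (bexp (- T) * bexp T) * (bexp (- cj (beta L)) * bexp (cj (beta L)))).
    by ring.
  by rewrite !bexpNK // !mulr1 -rmorphM.
pose lam := cst 2^-1 * (L + swap L); pose d := L - lam.
have dlam : diag lam by apply: diagM => //; exact: diag_cst.
have two : cst 2^-1 * 2 = 1 :> A by rewrite -(rmorph_nat cst) -rmorphM mulVf ?rmorph1 // pnatr_eq0.
have sd : swap d = - d.
  have -> : swap d = swap L - lam.
    rewrite /d rmorphB /= /lam swM; congr (_ - _ * _); first exact: subst_cst.
    by rewrite swD swapK addrC.
  apply/eqP; rewrite -subr_eq0 opprK /d; apply/eqP.
  transitivity ((1 - cst 2^-1 * 2) * (L + swap L)); first by rewrite /lam; ring.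
  by rewrite two subrr mul0r.
have [wh [_ whE]] := small_divisors.
(* [d] and its conjugate enter the uniqueness theorem as two unknowns, so their equality is not
   presupposed. *)
pose w := cst sg * d - e; pose w' := cst sg * cj d - e.
have sw : swap w = cst (-1) * w.
  by rewrite /w rmorphB /= swM sd se (_ : swap (cst sg) = cst sg) ?rmorphN ?rmorph1; [ring|exact: subst_cst].
have sw' : swap w' = cst (-1) * w'.
  rewrite /w' rmorphB /= swM -cj_swap sd se (_ : swap (cst sg) = cst sg); last exact: subst_cst.
  by rewrite !rmorphN rmorph1 /=; ring.
have bcM (u : A) : beta (cst sg * u) = cst sg * beta u.
  by rewrite bM; congr (_ * _); exact: subst_cst.
have bcM' (u : A) : betab (cst sg * u) = cst sg * betab u.
  by rewrite betabE rmorphM /= subst_cst.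
have bB u v : beta (u - v) = beta u - beta v by exact: rmorphB.
have bB' u v : betab (u - v) = betab u - betab v by exact: rmorphB.
have bdi v : diag v -> beta v = v by exact: beta_diag.
have bdi' v : diag v -> betab v = v by exact: betab_diag.
have dr : diag (beta w - betab w').
  have -> : beta w - betab w' = - (Lam nu0 eps s Y e + Y *+ 2)
     - cst sg * (T *+ 2 - cst sg * Y *+ 2) - cst sg * (lam - cj lam)
     + cst sg * (beta L - cj (beta L) + T *+ 2) + (1 - cst sg ^+ 2) * Y *+ 2.
    rewrite /w /w' bB bB' bcM bcM' /d bB (bdi _ dlam) cj_beta rmorphB /= bB'.
    by rewrite (bdi' _ (bmap_diag phi dlam)) /Lam; ring.
  rewrite main mulr0 addr0 -rmorphXn sg2 rmorph1 subrr mul0r mul0rn addr0.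
  apply: diagB; first apply: diagB; first exact: diagN.
    by apply: diagM => //; exact: diag_cst.
  apply: diagM; first exact: diag_cst.
  by apply: diagB => //; exact: bmap_diag.
have [|dw _] := linear_uniqueness nu0_neq0 eps_neq0 s_gt0 Y_X whE _ sw sw' dr.
  by rewrite sqrrN expr1n.
exists (cst sg * beta L).
  apply: convM; first exact: conv_cst.
  have -> : beta L = blog (cst al^-1 * beta U).
    have e0 : cst al^-1 * beta U = bexp (beta L).
      by rewrite bUE mulrA -rmorphM mulVf // rmorph1 mul1r.
    by apply: bexp_inj => //; [exact: blog_J|rewrite blogK e0 // bexp_00].
  by apply: conv_blog; apply: convM => //; exact: conv_cst.
have -> : beta e - cst sg * beta L = - w + cst sg * lam * (-1).
  rewrite -(bdi w dw) /w bB bcM /d bB (bdi _ dlam); ring.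
apply: diagD; first exact: diagN.
by rewrite mulrN1; apply: diagN; apply: diagM => //; exact: diag_cst.
Qed.
End Branch.

(** Reverses the construction of [formal_normalization]: the coordinates P and Q are recovered from
    a convergent equivalence, and log (P / p), or log (P / q) if the axes are exchanged, contains
    [beta e] up to sign and explicit terms. *)
Theorem equivalence_bound e f1 f2 : swap e = - e ->
  diag (Lam nu0 eps s Y e + Y *+ 2) -> conv Y -> conv f1 -> conv f2 ->
  f1 0%N 0%N = 0 -> f2 0%N 0%N = 0 ->
  f1 1%N 0%N * f2 0%N 1%N - f1 0%N 1%N * f2 1%N 0%N != 0 ->
  nf_rel f1 f2 Zs Ws (- x) (- x) -> exists2 v, conv v & diag (beta e - v).
Proof.
move=> se eq_e cY c1 c2 f10 f20 det.
have Jx := @J_x K; have JNx := J1N Jx; have Jp := @J_p K; have Jq := @J_q K.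
have JZ : J 1 Zs by exact: Z_J.
have JW : J 1 Ws by exact: W_J.
pose Sh f := subst (cst k0 * (p + q)) (- x) f.
have Jpq : J 1 (cst k0 * (p + q)) by apply/(vanishMl addn_wtD)/vanishD.
have bp : beta p = B * p by rewrite betaE subst_p //; exact: J_mp.
have bq : beta q = Bi * q by rewrite betaE subst_q //; exact: J_mq.
have bdi v : diag v -> beta v = v by exact: beta_diag.
have cNx : cj (- x) = - x by rewrite rmorphN /= bmap_x.
have ShE f : subst Zs (- x) f = beta (Sh f).
  rewrite betaE /Sh subst_comp // -betaE; congr (subst _ _ _).
    by rewrite bM bD bp bq; congr (_ * _); rewrite betaE subst_cst.
  by apply/esym/bdi/diagN; exact: diag_x.
have sSh f : swap (Sh f) = Sh f.
  rewrite /Sh swap_subst //; congr (subst _ _ _).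
    by rewrite swM swD swap_p swap_q addrC; congr (_ * _); exact: subst_cst.
  by rewrite rmorphN /= swap_x.
rewrite /nf_rel; set S := subst Zs _ f1; set g := subst Zs _ f2.
have -> : subst Ws (- x) (cj f1) = cj S by rewrite /S bmap_subst cj_Z cNx.
have -> : subst Ws (- x) (cj f2) = cj g by rewrite /g bmap_subst cj_Z cNx.
set G := cst (- 2^-1) * _ => nf.
have Jg : J 1 g by apply: subst_J; exact: J1P.
have Jcg : J 1 (cj g) by exact: bmap_vanish.
have JG : J 1 G by apply/(vanishMl addn_wtD)/vanishD.
have rG : cj G = G.
  by rewrite /G cjM cjD cjK bmap_cst rmorphN phi_half addrC.
have rg : cj g = g.
  rewrite [in LHS]nf; have cE c : cj (bexp (cst c * G ^+ s)) = bexp (cst (phi c) * G ^+ s).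
    by rewrite bmap_bexp cjM bmap_cst rmorphXn /= rG.
  rewrite !cjD (cjM (_ * S)) (cjM _ S) cjD !(cjM (cst _)) !cE !bmap_cst !(rmorphXn cj) /= cjK.
  have h1 : phi (- eps) = eps by rewrite rmorphN /= phi_eps opprK.
  have h2 : phi (nu0 ^+ 2) = nu0 ^- 2 by rewrite rmorphXn /= phi_nu0 exprVn.
  have h3 : phi (nu0 ^- 2) = nu0 ^+ 2 by rewrite fmorphV h2 invrK.
  rewrite phi_eps h1 h2 h3.
  by rewrite [RHS]nf; ring.
(* [g] is [beta] of a symmetric series and is real, hence also [betab] of the conjugate series;
   uniqueness with sign 1 applies. *)
have gd : diag (Sh f2).
  have [wh [_ whE]] := small_divisors.
  have s1 : swap (Sh f2) = cst 1 * Sh f2 by rewrite sSh rmorph1 mul1r.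
  have s1' : swap (cj (Sh f2)) = cst 1 * cj (Sh f2) by rewrite -cj_swap sSh rmorph1 mul1r.
  have dr : diag (beta (Sh f2) - betab (cj (Sh f2))).
    by rewrite -cj_beta -ShE -/g rg subrr; exact: diag0.
  have [|//] := linear_uniqueness nu0_neq0 eps_neq0 s_gt0 Y_X whE _ s1 s1' dr.
  exact: expr1n.
have gE : g = Sh f2 by rewrite /g ShE bdi.
have GE : G = - g.
  have two : cst 2^-1 * 2 = 1 :> A by rewrite -(rmorph_nat cst) -rmorphM mulVf ?rmorph1 // pnatr_eq0.
  rewrite /G rg rmorphN; transitivity (- (cst 2^-1 * 2) * g); first by ring.
  by rewrite two mulN1r.
have dG : diag G by rewrite GE gE; exact: diagN.
(* Diagonality of [g] removes the terms z1 and z1^2 of [f2]; the Jacobian then forces the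
   coefficient of z2, which is that of x in [G], to be nonzero. *)
have G11 : G 1%N 1%N != 0.
  have Jx2 : J 2 (- x) by apply/vanishN/(@vanishM _ _ addn_wtD 1 1).
  have jet := subst_jet f2 Jpq Jx2; rewrite -/(Sh f2) in jet.
  have lin : f2 1%N 0%N = 0.
    have := jet 1%N 0%N isT; rewrite !ps_subE !ps_addE !bcstM gd // !ps_addE pvE qvE bcstE /=.
    rewrite Jx2 // expr2 (@vanishM _ _ addn_wtD 1 1 _ _ Jpq Jpq) //.
    rewrite !(mulr0, addr0, add0r, mulr1, sub0r) => /eqP; rewrite oppr_eq0 mulf_eq0.
    by rewrite (negbTE k0_neq0) orbF => /eqP.
  have pq0 : (cst k0 * (p + q)) 0%N 0%N = 0 by exact: Jpq.
  have [sq20 sq11] := b10M pq0 pq0.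
  have quad : f2 2%N 0%N = 0.
    have := jet 2%N 0%N isT; rewrite !ps_subE !ps_addE !bcstM gd // lin mul0r expr2 sq20.
    have xx : x 2%N 0%N = 0 by exact: diag_x.
    rewrite !ps_oppE xx bcstE !bcstM !ps_addE pvE qvE /=.
    rewrite !(mulr0, oppr0, addr0, add0r, mulr1, sub0r) => /eqP; rewrite oppr_eq0 !mulf_eq0.
    by rewrite (negbTE k0_neq0) !orbF => /eqP.
  have := jet 1%N 1%N isT; rewrite !ps_subE !ps_addE !bcstM lin quad !mul0r !addr0 bcstE /= add0r.
  have xx : x 1%N 1%N = 1 by have := bmonoE K 1 1 1 1; rewrite !expr1.
  rewrite !ps_oppE xx mulrN1 opprK GE gE !ps_oppE => /eqP; rewrite addr_eq0 => /eqP ->.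
  rewrite opprK; apply: contraNneq det => ->.
  by rewrite lin !mulr0 subrr.
pose n := nuG G; pose m := nuGi G.
have nm : n * m = 1 by exact: nuG_nuGi.
have cn : cj n = m by exact: cj_nuG.
have cm : cj m = n by exact: cj_nuGi.
have dn : diag n by exact: nuG_diag.
have dm : diag m by exact: nuGi_diag.
(* Inverts S = k (mP + nQ) and its conjugate; the second coordinate Q is n S + m cj S. *)
pose P := - (m * S + n * cj S).
have rP : cj P = P.
  by rewrite /P rmorphN /= cjD (cjM m) (cjM n) cjK cn cm addrC.
have PQ : P * (n * S + m * cj S) = G.
  rewrite GE nf -nuG2 // -nuGi2 // -/n -/m /P.
  transitivity (- ((n ^+ 2 + m ^+ 2) * S * cj S + (n * m) * (S ^+ 2 + cj S ^+ 2))); first by ring.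
  by rewrite nm; ring.
have [binj bsurj] := scaled_inverse nu0_neq0 B00 Bi00.
have binj' u v : beta u = beta v -> u = v.
  move=> h; apply/eqP; rewrite -subr_eq0; apply/eqP; apply: binj.
  by rewrite rmorphB /= -betaE h subrr.
(* Pulled back by [beta], mP and nQ have the diagonal product [G] and the symmetric sum [Sg]. *)
have [Pi Pi_E] := bsurj (m * P); rewrite -betaE in Pi_E.
pose Sg := (n ^+ 2 - m ^+ 2) * Sh f1.
have dnm : diag (n ^+ 2 - m ^+ 2) by apply: diagB; exact: diagX.
have sSg : swap Sg = Sg by rewrite /Sg swM sSh swap_diag.
have bSg : beta Sg = m * P + n * (n * S + m * cj S).
  rewrite /Sg bM bdi // -ShE -/S /P.
  transitivity (n ^+ 2 * S - m ^+ 2 * S + (n * m - n * m) * cj S); [|ring].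
  by rewrite subrr; ring.
have prod : Pi * (Sg - Pi) = G.
  apply: binj'; rewrite bM (bdi _ dG) Pi_E.
  have -> : beta (Sg - Pi) = n * (n * S + m * cj S).
    have -> : beta (Sg - Pi) = beta Sg - beta Pi by exact: rmorphB.
    by rewrite bSg Pi_E; ring.
  by transitivity (n * m * (P * (n * S + m * cj S))); [ring|rewrite nm mul1r PQ].
have Pi00 : Pi 0%N 0%N = 0.
  have h0 : beta Pi 0%N 0%N = Pi 0%N 0%N by exact: subst00.
  rewrite -h0 Pi_E b00M /P ps_oppE ps_oppE !ps_addE !b00M.
  have S0 : S 0%N 0%N = 0 by rewrite /S subst00.
  by rewrite /bmap S0 rmorph0 !mulr0 addr0 oppr0 mulr0.
have Sg00 : Sg 0%N 0%N = 0.
  by rewrite /Sg b00M /Sh subst00 f10 mulr0.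
have prod' : swap Pi * (Sg - swap Pi) = G.
  have := congr1 (@swap K) prod; rewrite swM (swap_diag dG) => <-.
  by congr (_ * _); rewrite rmorphB /= sSg.
(* [Pi] and [swap Pi] are roots of the same quadratic polynomial with symmetric coefficients. If
   they coincided, the vanishing p^2 coefficient of [G] would make its x coefficient vanish too. *)
have sum : Pi + swap Pi = Sg.
  have : (Pi - swap Pi) * (Sg - (Pi + swap Pi)) = 0.
    transitivity (Pi * (Sg - Pi) - swap Pi * (Sg - swap Pi)); first by ring.
    by rewrite prod prod' subrr.
  case/b_domain => /eqP; rewrite subr_eq0 => /eqP //.
  move=> sPi; have D0 : (Sg - Pi) 0%N 0%N = 0 by rewrite !ps_subE Sg00 Pi00 subr0.
  have [h20 h11] := b10M Pi00 D0; move: h20 h11; rewrite prod dG //.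
  have sD : (Sg - Pi) 0%N 1%N = (Sg - Pi) 1%N 0%N.
    have sw : swap (Sg - Pi) = Sg - Pi by rewrite rmorphB /= sSg -sPi.
    by rewrite -[in LHS]sw swapE.
  have sP : Pi 0%N 1%N = Pi 1%N 0%N by rewrite [in LHS]sPi swapE.
  rewrite sD sP => h20 h11; case/eqP: G11.
  by rewrite h11 -h20 addr0.
have prod2 : Pi * swap Pi = G by rewrite -[RHS]prod -sum; congr (_ * _); ring.
have [h20 h11] : G 2%N 0%N = Pi 1%N 0%N * Pi 0%N 1%N /\
    G 1%N 1%N = Pi 1%N 0%N * Pi 1%N 0%N + Pi 0%N 1%N * Pi 0%N 1%N.
  have sP0 : swap Pi 0%N 0%N = 0 by rewrite swapE.
  by have [] := b10M Pi00 sP0; rewrite prod2 !swapE.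
have cS : conv S.
  by apply: conv_subst => //; [exact: conv_Z|exact/convN/conv_x].
have cg : conv g.
  by apply: conv_subst => //; [exact: conv_Z|exact/convN/conv_x].
have cG : conv G by rewrite GE; exact: convN.
have cn' : conv n by exact: conv_nuG.
have cm' : conv m by exact: conv_nuGi.
have cP : conv P.
  by apply/convN/convD; apply: convM => //; exact: conv_bmap.
have cB : conv B by exact: conv_B.
have cBi : conv Bi by exact: conv_Bi.
have J1e := J_expo (eps / 2) JG.
have nE : n = cst nu0 * bexp (cst (eps / 2) * G ^+ s) by [].
have mE : m = cst nu0^-1 * bexp (- (cst (eps / 2) * G ^+ s)).
  by rewrite /m /nuGi rmorphN mulNr.
have Jex := exJ (eps / 2); have JNex := J1N Jex.
have BE' : B = cst nu0^-1 * bexp (- ex (eps / 2)) * bexp Y.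
  by rewrite BE nuiE -exN.
have BiE' : Bi = cst nu0 * bexp (ex (eps / 2)) * bexp (- Y) by [].
have G20 : G 2%N 0%N = 0 by exact: dG.
(* Exactly one linear coefficient of [Pi] survives; it tells whether the equivalence exchanges the
   axes p = 0 and q = 0. *)
have /orP[/eqP al0|/eqP be0] : (Pi 1%N 0%N == 0) || (Pi 0%N 1%N == 0).
  by rewrite -mulf_eq0 -h20 G20.
  have be1 : Pi 0%N 1%N != 0.
    by apply: contraNneq G11 => h0; rewrite h11 al0 h0 mulr0 addr0.
  have row : swap Pi 0%N * Pi 0%N = 0.
    rewrite -ps0_mul mulrC prod2; apply/funext => -[|j]; rewrite ps_0E; first exact: JG.
    exact: dG.
  have : swap Pi 0%N = 0.
    case: (@ps_mul_eq0 K _ _ _ row) => //.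
      by move=> a b /eqP; rewrite mulf_eq0 => /orP[/eqP|/eqP]; [left|right].
    by move=> /(congr1 (fun u : ps K => u 1%N)); rewrite ps_0E => /eqP; rewrite (negbTE be1).
  move=> /p_factor [U' U'E].
  pose U := swap U'; have PiE : Pi = q * U by rewrite -[LHS]swapK U'E swM swap_p.
  have U00 : U 0%N 0%N != 0.
    have : Pi 0%N 1%N = U 0%N 0%N.
      by rewrite PiE; have := bmonoM U 0 1 0 1; rewrite expr0 expr1 mul1r.
    by move=> <-.
  have bPi : beta Pi = q * (Bi * beta U) by rewrite PiE bM bq; ring.
  have cPi : cj (beta Pi) = q * (B * cj (beta U)) by rewrite bPi (cjM q) (cjM Bi) cj_Bi bmap_q.
  have nP : n * P = cj (beta Pi) by rewrite Pi_E (cjM m) cm rP.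
  have eqU : n * Bi * beta U = m * B * cj (beta U).
    apply: q_cancel; transitivity (n * beta Pi); first by rewrite bPi; ring.
    transitivity (m * (n * P)); first by rewrite Pi_E; ring.
    by rewrite nP cPi; ring.
  (* In the exchanged case n Bi = nu0^2 e^T, and [T] is -Y up to a diagonal series: the branch of
     sign -1 with constant nu0^2. *)
  pose T := cst (eps / 2) * G ^+ s + ex (eps / 2) - Y.
  have JT : J 1 T by apply: vanishB => //; exact: vanishD.
  have JNT := J1N JT.
  have nB : n * Bi = cst (nu0 ^+ 2) * bexp T.
    rewrite nE BiE' /T bexpD // ?bexpD //; last exact: vanishD.
    by rewrite rmorphXn; ring.
  have mB : m * B = cst (nu0 ^- 2) * bexp (- T).
    rewrite mE BE' /T opprB [Y - _]addrC opprD bexpD ?bexpD //; try exact: J1N; last by apply: vanishD; exact: J1N.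
    by rewrite -exprVn rmorphXn; ring.
  apply: (@branch_bound (-1) e U T (nu0 ^+ 2)) => //.
  - by rewrite sqrrN expr1n.
  - have := prod2; rewrite PiE swM swap_q => h.
    apply: diag_xI; have -> : x * (U * swap U) = q * U * (p * swap U) by rewrite /xv; ring.
    by rewrite h.
  - apply: (conv_shift_q (f := B * (m * P))); first by do 2 apply: convM => //.
    transitivity (B * Bi * q * beta U); last by rewrite BBi' mul1r.
    by rewrite -Pi_E bPi; ring.
  - have -> : T *+ 2 - cst (-1) * Y *+ 2 = (cst (eps / 2) * G ^+ s + ex (eps / 2)) *+ 2.
      by rewrite rmorphN rmorph1 /T; ring.
    rewrite mulr2n; apply: diagD; apply: diagD; try exact: ex_diag;
    by apply: diagM; [exact: diag_cst|exact: diagX].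
  - by rewrite -nB eqU mB rmorphXn /= phi_nu0 exprVn.
  by rewrite expf_neq0.
have al1 : Pi 1%N 0%N != 0.
  by apply: contraNneq G11 => h0; rewrite h11 be0 h0 mulr0 addr0.
have row : Pi 0%N * swap Pi 0%N = 0.
  rewrite -ps0_mul prod2; apply/funext => -[|j]; rewrite ps_0E; first exact: JG.
  exact: dG.
have : Pi 0%N = 0.
  case: (@ps_mul_eq0 K _ _ _ row) => //.
    by move=> a b /eqP; rewrite mulf_eq0 => /orP[/eqP|/eqP]; [left|right].
  move=> /(congr1 (fun u : ps K => u 1%N)); rewrite ps_0E swapE => /eqP.
  by rewrite (negbTE al1).
move=> /p_factor [U PiE].
have U00 : U 0%N 0%N != 0.
  have : Pi 1%N 0%N = U 0%N 0%N.
    by rewrite PiE; have := bmonoM U 1 0 1 0; rewrite expr0 expr1 mulr1.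
  by move=> <-.
have bPi : beta Pi = p * (B * beta U) by rewrite PiE bM bp; ring.
have cPi : cj (beta Pi) = p * (Bi * cj (beta U)) by rewrite bPi (cjM p) (cjM B) cj_B bmap_p.
have nP : n * P = cj (beta Pi) by rewrite Pi_E (cjM m) cm rP.
have eqU : n * B * beta U = m * Bi * cj (beta U).
  apply: p_cancel; transitivity (n * beta Pi); first by rewrite bPi; ring.
  transitivity (m * (n * P)); first by rewrite Pi_E; ring.
  by rewrite nP cPi; ring.
(* Here n B = e^T with constant 1, and [T] is Y up to a diagonal series. *)
pose T := cst (eps / 2) * G ^+ s - ex (eps / 2) + Y.
have JT : J 1 T by apply: vanishD => //; exact: vanishB.
have nB : n * B = bexp T.
  rewrite nE BE' /T bexpD ?bexpD //; last exact: vanishD.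
  by rewrite -[RHS]mul1r -nu00; ring.
have mB : m * Bi = bexp (- T).
  rewrite mE BiE' /T opprD opprB [ex _ - _]addrC bexpD ?bexpD //; try exact: J1N; last by apply: vanishD => //; exact: J1N.
  by rewrite -[RHS]mul1r -nu00; ring.
apply: (@branch_bound 1 e U T 1) => //.
- exact: expr1n.
- have := prod2; rewrite PiE swM swap_p => h.
  apply: diag_xI; have -> : x * (U * swap U) = p * U * (q * swap U) by rewrite /xv; ring.
  by rewrite h.
- apply: (conv_shift (f := Bi * (m * P))); first by do 2 apply: convM => //.
  transitivity (B * Bi * p * beta U); last by rewrite BBi' mul1r.
  by rewrite -Pi_E bPi; ring.
- have -> : T *+ 2 - cst 1 * Y *+ 2 = (cst (eps / 2) * G ^+ s - ex (eps / 2)) *+ 2.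
    by rewrite rmorph1 /T; ring.
  rewrite mulr2n; apply: diagD; apply: diagB; try exact: ex_diag;
  by apply: diagM; [exact: diag_cst|exact: diagX].
- by rewrite (rmorph1 phi) !(rmorph1 cst) !mul1r -nB eqU mB.
exact: oner_neq0.
Qed.

End Surface.

(** * Dependence on the parameter *)

Section Family.
Variable K : numFieldType.
Notation A := (ps (ps K)).
Implicit Types (F G : K -> A).
Notation p := (@pv K).
Notation q := (@qv K).
Notation x := (@xv K).
Notation cst := (@cst K).
Variable s : nat.
Hypothesis s_gt0 : (0 < s)%N.

(* Each unit of degree in the parameter costs at least [s] in the order in
   [x = pq], with an extra margin [c]; the family is divisible by the [m]-th
   power of the parameter. *)
Definition good_at c m i j (h : K -> K) := exists P : {poly K},
  [/\ P != 0 -> (s * size P + c <= minn i j + s)%N,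
      forall l, (l < m)%N -> P`_l = 0 & forall t, h t = P.[t]].
Definition good c m F := forall i j, good_at c m i j (fun t => F t i j).

Lemma good_at_eq c m i j h h' : (forall t, h t = h' t) -> good_at c m i j h -> good_at c m i j h'.
Proof. by move=> e [P [H1 H2 H3]]; exists P; split=> // t; rewrite -e. Qed.
Lemma good_at0 c m i j : good_at c m i j (fun=> 0).
Proof. by exists 0; split=> [|l _|t]; rewrite ?eqxx ?coef0 ?horner0. Qed.
Lemma good_atD c m i j h h' : good_at c m i j h -> good_at c m i j h' ->
  good_at c m i j (fun t => h t + h' t).
Proof.
move=> [P [H1 H2 H3]] [Q [G1 G2 G3]]; exists (P + Q); split.
- have [->|P0] := eqVneq P 0; first by rewrite add0r.
  have [->|Q0] := eqVneq Q 0; first by rewrite addr0.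
  move=> _; have := H1 P0; have := G1 Q0; have := size_polyD P Q.
  by case: (leqP (size P) (size Q)) => _ le *;
    apply: leq_trans (leq_add (leq_mul (leqnn s) le) (leqnn c)) _.
- by move=> l lt; rewrite coefD H2 // G2 // addr0.
- by move=> t; rewrite H3 G3 hornerD.
Qed.
Lemma good_at_sum c m i j (I : Type) (r : seq I) (h : I -> K -> K) :
  (forall k, good_at c m i j (h k)) -> good_at c m i j (fun t => \sum_(k <- r) h k t).
Proof.
move=> H; elim: r => [|k r IH].
  by apply: good_at_eq (good_at0 c m i j) => t; rewrite big_nil.
by apply: good_at_eq (good_atD (H k) IH) => t; rewrite big_cons.
Qed.
(** The size of a product is the sum of the sizes minus one; the summand [s] on the right of the
    bound compensates for this. *)
Lemma good_atM c m c' m' i j i' j' h h' : good_at c m i j h -> good_at c' m' i' j' h' ->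
  good_at (c + c') (m + m') (i + i') (j + j') (fun t => h t * h' t).
Proof.
move=> [P [H1 H2 H3]] [Q [G1 G2 G3]]; exists (P * Q); split.
- move=> PQ0; have P0 : P != 0 by apply: contraNneq PQ0 => ->; rewrite mul0r.
  have Q0 : Q != 0 by apply: contraNneq PQ0 => ->; rewrite mulr0.
  have := H1 P0; have := G1 Q0; rewrite size_mul //.
  have : (0 < size P)%N by rewrite size_poly_gt0.
  case: (size P) => // a _ hQ hP; rewrite addSn /=.
  move: hQ hP; rewrite !mulnS mulnDr; move: (s * a)%N (s * size Q)%N; lia.
- move=> l lt; rewrite coefM big1 // => k _.
  have [lk|ge] := ltnP k m; first by rewrite H2 // mul0r.
  by rewrite G2 ?mulr0 //; have := ltn_ord k; lia.
- by move=> t; rewrite H3 G3 hornerM.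
Qed.
Lemma good_atW c m c' m' i j i' j' h : (c' <= c)%N -> (m' <= m)%N ->
  (minn i j <= minn i' j')%N -> good_at c m i j h -> good_at c' m' i' j' h.
Proof.
move=> lec lem le [P [H1 H2 H3]]; exists P; split=> //.
  by move=> /H1; lia.
by move=> l lt; apply: H2; lia.
Qed.

Lemma goodW c m c' m' F : (c' <= c)%N -> (m' <= m)%N -> good c m F -> good c' m' F.
Proof. by move=> lec lem H i j; apply: good_atW (H i j). Qed.
Lemma good_eq c m F G : (forall t, F t = G t) -> good c m F -> good c m G.
Proof. by move=> e H i j; apply: good_at_eq (H i j) => t; rewrite e. Qed.
Lemma goodD c m F G : good c m F -> good c m G -> good c m (fun t => F t + G t).
Proof.
by move=> HF HG i j; apply: good_at_eq (good_atD (HF i j) (HG i j)) => t; rewrite !ps_addE.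
Qed.
Lemma good_sum c m (I : Type) (r : seq I) (F : I -> K -> A) :
  (forall k, good c m (F k)) -> good c m (fun t => \sum_(k <- r) F k t).
Proof.
move=> H i j; apply: good_at_eq (good_at_sum r (fun k => H k i j)) => t.
by rewrite bsumE.
Qed.
Lemma goodM c m c' m' F G : good c m F -> good c' m' G ->
  good (c + c') (m + m') (fun t => F t * G t).
Proof.
move=> HF HG i j.
apply: (@good_at_eq _ _ _ _ (fun t => \sum_(a < i.+1) \sum_(b < j.+1) F t a b * G t (i - a)%N (j - b)%N)).
  by move=> t; rewrite bmulE.
apply: good_at_sum => a; apply: good_at_sum => b.
by apply: good_atW (good_atM (HF a b) (HG (i - a)%N (j - b)%N)) => //;
  have := ltn_ord a; have := ltn_ord b; lia.
Qed.
Lemma good_const f : good 0 0 (fun=> f).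
Proof.
move=> i j; exists (f i j)%:P; split=> // [_|t]; last by rewrite hornerC.
by have := size_polyC_leq1 (f i j); have := minn i j; nia.
Qed.
Lemma good_constM c m F f : good c m F -> good c m (fun t => f * F t).
Proof. by move=> H; have := goodM (good_const f) H. Qed.
Lemma goodN c m F : good c m F -> good c m (fun t => - F t).
Proof.
by move=> /(good_constM (- 1)); apply: good_eq => t; rewrite mulN1r.
Qed.
Lemma goodB c m F G : good c m F -> good c m G -> good c m (fun t => F t - G t).
Proof. by move=> HF HG; apply: goodD => //; exact: goodN. Qed.
Lemma goodX c m F n : good c m F -> good (n * c) (n * m) (fun t => F t ^+ n).
Proof.
move=> H; elim: n => [|n IH]; first by have := good_const 1; exact: good_eq.
by rewrite !mulSn; apply: good_eq (goodM H IH) => t; rewrite exprS.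
Qed.
Lemma good_pert_mul F G (F0 G0 : A) : good s 1 (fun t => F t - F0) -> good s 1 (fun t => G t - G0) ->
  good 0 0 F -> good s 1 (fun t => F t * G t - F0 * G0).
Proof.
move=> HF HG H0; apply: good_eq (goodD (goodM H0 HG) (good_constM G0 HF)) => t; ring.
Qed.
Lemma good_pert0 F (F0 : A) : good s 1 (fun t => F t - F0) -> good 0 0 F.
Proof.
move=> /(goodW (leq0n s) (leq0n 1)) H; apply: good_eq (goodD H (good_const F0)) => t.
by rewrite subrK.
Qed.
Lemma good_pert_exp F (F0 : A) n : good s 1 (fun t => F t - F0) ->
  good s 1 (fun t => F t ^+ n - F0 ^+ n).
Proof.
move=> H; elim: n => [|n IH].
  by move=> i j; apply: good_at_eq (good_at0 s 1 i j) => t; rewrite !expr0 subrr.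
apply: good_eq (good_pert_mul H IH (good_pert0 H)) => t; by rewrite !exprS.
Qed.
Lemma good_bexp F : good s 1 F -> (forall t, J 1 (F t)) -> good s 1 (fun t => bexp (F t) - 1).
Proof.
move=> H HJ i j.
apply: (@good_at_eq _ _ _ _ (fun t => (\sum_(k < i + j) cst (k.+1`!)%:R^-1 * F t ^+ k.+1) i j)).
  move=> t; have := @bapp_psum K (fun k => (k`!)%:R^-1) (F t) (i + j).+1 (HJ t) i j (ltnSn _).
  rewrite !ps_subE -/(bexp _) => /eqP; rewrite subr_eq0 => /eqP ->.
  by rewrite big_ord_recl /= !ps_addE invr1 rmorph1 expr0 mulr1 addrAC subrr add0r.
move: i j (i + j)%N => i j n; move: i j.
apply: (good_sum (index_enum _)) => k; apply: good_constM.
by apply: goodW (goodX k.+1 H); rewrite ?muln1 // leq_pmull.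
Qed.
Lemma good_shx c m F : good (c + s) m F -> good c m (fun t => shx s (F t)).
Proof.
move=> H i j; have [P [H1 H2 H3]] := H (i + s)%N (j + s)%N.
by exists P; split=> // /H1; lia.
Qed.
Lemma good_mode c m k F : good c m F -> good c m (fun t => mode k (F t)).
Proof.
move=> H i j; have [e|ne] := eqVneq i j.
  apply: good_at_eq (_ : good_at c m i j (fun t => F t (k + j)%N j)).
    by move=> t; rewrite /mode e eqxx.
  apply: good_atW (H (k + j)%N j) => //; lia.
by apply: good_at_eq (good_at0 c m i j) => t; rewrite mode_diag.
Qed.
Lemma good_inv0 c m wh F : good c m F -> good c m (fun t => inv0 wh (F t)).
Proof.
move=> H i j; case: (ltngtP i j) => lt.
- have := good_constM (wh (j - i)%N) (good_mode (j - i) H).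
  move=> /goodN /(_ i i) H'; apply: (good_at_eq _ (good_atW (leqnn c) (leqnn m) _ H')); last lia.
  by move=> t; rewrite /inv0 lt (_ : (j < i)%N = false) ?ps_oppE ?ps_oppE //; lia.
- have := good_constM (wh (i - j)%N) (good_mode (i - j) H).
  move=> /(_ j j) H'; apply: (good_at_eq _ (good_atW (leqnn c) (leqnn m) _ H')); last lia.
  by move=> t; rewrite /inv0 lt.
by apply: good_at_eq (good_at0 c m i j) => t; rewrite /inv0 lt ltnn.
Qed.

(** The coefficient of p^a q^b is multiplied by u^a v^b - u0^a v0^b, which brings one more factor of
    the parameter and a margin of [s]. *)
Lemma good_subst_pert m F u v u0 v0 : good 0 m F ->
  good s 1 (fun t => u t - u0) -> good s 1 (fun t => v t - v0) ->
  good s m.+1 (fun t => subst (u t * p) (v t * q) (F t) - subst (u0 * p) (v0 * q) (F t)).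
Proof.
move=> HF Hu Hv i j; pose D := (i + j).+1.
pose E t : A := \sum_(a < D) \sum_(b < D)
  (cst (F t a b) * (p ^+ a * q ^+ b)) * (u t ^+ a * v t ^+ b - u0 ^+ a * v0 ^+ b).
apply: (@good_at_eq _ _ _ _ (fun t => E t i j)).
  move=> t; rewrite !ps_subE !substE -!ps_subE.
  suff -> : psum (u t * p) (v t * q) D (F t) - psum (u0 * p) (v0 * q) D (F t) = E t by [].
  rewrite /psum -sumrB; apply: eq_bigr => a _; rewrite /psum_row !mulr_suml -sumrB.
  apply: eq_bigr => b _; rewrite !(nc_id (@J_mp _ _)) !(nc_id (@J_mq _ _)) !exprMn; ring.
move: i j @D @E => i j; move: (i + j).+1 => D; move: i j.
apply: (good_sum (index_enum _)) => a; apply: (good_sum (index_enum _)) => b.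
have H1 : good 0 m (fun t => cst (F t a b) * (p ^+ a * q ^+ b)).
  move=> i j; have [e|ne] := boolP ((i == a) && (j == b)).
    case/andP: e => /eqP -> /eqP ->; apply: good_at_eq (HF a b) => t.
    by rewrite bcstM bmonoE !eqxx mulr1.
  by apply: good_at_eq (good_at0 0 m i j) => t; rewrite bcstM bmonoE (negbTE ne) mulr0.
have H2 : good s 1 (fun t => u t ^+ a * v t ^+ b - u0 ^+ a * v0 ^+ b).
  apply: good_pert_mul; [exact: good_pert_exp|exact: good_pert_exp|].
  exact/good_pert0/good_pert_exp.
by have := goodM H1 H2; rewrite add0n addn1.
Qed.
Lemma good_subst_diag c m F u0 v0 : good c m F ->
  good c m (fun t => subst (u0 * p) (v0 * q) (F t)).
Proof.
move=> HF i j; pose D := (i + j).+1.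
pose E t : A := \sum_(a < D) \sum_(b < D)
  (u0 ^+ a * v0 ^+ b) * (cst (F t a b) * (p ^+ a * q ^+ b)).
apply: (@good_at_eq _ _ _ _ (fun t => E t i j)).
  move=> t; rewrite substE.
  suff -> : psum (u0 * p) (v0 * q) D (F t) = E t by [].
  rewrite /psum; apply: eq_bigr => a _; rewrite /psum_row !mulr_suml.
  apply: eq_bigr => b _; rewrite !(nc_id (@J_mp _ _)) !(nc_id (@J_mq _ _)) !exprMn; ring.
move: i j @D @E => i j; move: (i + j).+1 => D; move: i j.
apply: (good_sum (index_enum _)) => a; apply: (good_sum (index_enum _)) => b.
apply: good_constM => i j; have [e|ne] := boolP ((i == a) && (j == b)).
  case/andP: e => /eqP -> /eqP ->; apply: good_at_eq (HF a b) => t.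
  by rewrite bcstM bmonoE !eqxx mulr1.
by apply: good_at_eq (good_at0 c m i j) => t; rewrite bcstM bmonoE (negbTE ne) mulr0.
Qed.

(** Every positive mode of [Y0] is exactly x^(2s), so the linear term has a nonzero component in all
    modes. *)
Definition Y0 : A := fun i j => ((minn i j == s + s) && (i != j))%:R.
Definition Yt (t : K) : A := cst t * Y0.
Lemma Y0_X : X (s + s) Y0.
Proof. by move=> i j lt; rewrite /Y0 (_ : (_ == _) = false) //; apply/eqP; lia. Qed.
Lemma Yt_X t : X (s + s) (Yt t).
Proof. by apply: (vanishMl minn_wtD); exact: Y0_X. Qed.
Lemma Yt_sym t : swap (Yt t) = Yt t.
Proof.
by apply/funext => i; apply/funext => j; rewrite swapE /Yt !bcstM /Y0 minnC [j == i]eq_sym.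
Qed.
Lemma Yt_J t : J 1 (Yt t). Proof. by apply: Y_J (Yt_X t). Qed.
Lemma Yt_conv t : conv (Yt t).
Proof.
apply: convM; first exact: conv_cst.
apply/conv_bound; exists 1, 1; split=> //; split=> // i j.
by rewrite expr1n mulr1 /Y0; case: andP => _; rewrite ?normr1 ?normr0.
Qed.
Lemma good_Yt : good s 1 Yt.
Proof.
move=> i j; exists (Y0 i j *: 'X); split.
- have [->|ne] := eqVneq (Y0 i j) 0; first by rewrite scale0r eqxx.
  move=> _; rewrite size_scale // size_polyX.
  have : (s + s <= minn i j)%N by rewrite leqNgt; apply: contraNN ne => /Y0_X ->.
  lia.
- by case=> // _; rewrite coefZ coefX mulr0.
by move=> t; rewrite hornerZ hornerX /Yt bcstM mulrC.
Qed.
Variables (nu0 eps : K).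
Hypotheses (nu0_neq0 : nu0 != 0) (eps_neq0 : eps != 0).
Notation nu := (nu nu0 eps s).
Notation nui := (nui nu0 eps s).

Notation B t := (B nu0 eps s (Yt t)).
Notation Bi t := (Bi nu0 eps s (Yt t)).
Lemma good_B : good s 1 (fun t => B t - nui).
Proof.
have H : good s 1 (fun t => bexp (Yt t) - 1) := good_bexp good_Yt Yt_J.
by apply: good_eq (good_constM nui H) => t; rewrite mulrBr mulr1.
Qed.
Lemma good_Bi : good s 1 (fun t => Bi t - nu).
Proof.
have H : good s 1 (fun t => bexp (- Yt t) - 1).
  by apply: good_bexp => [|t]; [exact/goodN/good_Yt|exact/J1N/Yt_J].
by apply: good_eq (good_constM nu H) => t; rewrite mulrBr mulr1.
Qed.

Notation beta t := (beta nu0 eps s (Yt t)).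
Notation rot := (rot nu0 eps s).
Variable wh : nat -> A.
Hypotheses (wh_diag : forall k, diag (wh k))
  (whE : forall k, (0 < k)%N -> (nui ^+ k - nu ^+ k) * wh k = x ^+ s).
Notation step t := (step nu0 eps s (Yt t) wh).
Lemma good_beta_rot m F : good 0 m F -> good s m.+1 (fun t => beta t (F t) - rot (F t)).
Proof. by move=> H; apply: good_subst_pert H good_B good_Bi. Qed.
Lemma good_pert m F : good 0 m F -> good s m.+1 (fun t => pert nu0 eps s (Yt t) (F t)).
Proof.
move=> H; apply: goodB; first exact: good_beta_rot.
exact: good_subst_pert H good_Bi good_B.
Qed.
(** The division by x^s in [step] uses up precisely the margin [s] carried by [Yt] and [pert]. *)
Lemma good_iter n : good 0 1 (fun t => iter n (step t) 0).
Proof.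
elim: n => [|n IH]; first by move=> i j; exact: good_at0.
apply: good_inv0; apply: good_shx; rewrite add0n; apply: goodB.
  by apply: good_eq (goodD (goodN good_Yt) (goodN good_Yt)) => t; rewrite mulr2n.
by apply: goodW (good_pert IH).
Qed.

(* The part of the solution that is linear in the parameter. *)
Definition e1 : A := inv0 wh (shx s (- Y0 *+ 2)).
(** [pert (e t)] is of second order in t, since [e] and the perturbation of the scalings are each of
    first order. So only [e1], moved by the unperturbed rotation, contributes to the linear
    coefficient. *)
Theorem poly_dependence (e : K -> A) : (forall t, step t (e t) = e t) ->
  (forall t n i j, (minn i j < n)%N -> e t i j = iter n (step t) 0 i j) ->
  forall i j, exists P : {poly K}, [/\ (size P <= (i + j).+2)%N, P`_1 = rot e1 i j
    & forall t, beta t (e t) i j = P.[t]].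
Proof.
move=> est eit.
have ge : good 0 1 e.
  move=> i j; apply: good_at_eq (good_iter (minn i j).+1 i j) => t.
  by rewrite (eit t (minn i j).+1).
have sub0 f g : shx s (f - g) = shx s f - shx s g.
  by apply/funext => i; apply/funext => j; rewrite /shx !ps_subE.
have eE t : e t = cst t * e1 - inv0 wh (shx s (pert nu0 eps s (Yt t) (e t))).
  rewrite -[in LHS]est {1}stepE sub0 inv0_sub; congr (_ - _).
  have -> : shx s (- Yt t *+ 2) = cst t * shx s (- Y0 *+ 2).
    apply/funext => i; apply/funext => j.
    rewrite bcstM /shx !mulr2n !ps_addE !ps_oppE /Yt bcstM; ring.
  apply/funext => i; apply/funext => j; rewrite bcstM /e1 /inv0 !(mode_mul _ _ (diag_cst _)).
  case: (ltngtP i j) => _; rewrite ?mulr0 //.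
    by rewrite mulrCA bcstM mulrN.
  by rewrite mulrCA bcstM.
have g2 : good 0 2 (fun t => beta t (e t) - cst t * rot e1).
  have h1 := goodW (leq0n s) (leqnn 2) (good_beta_rot ge).
  have h2 : good 0 2 (fun t => rot (inv0 wh (shx s (pert nu0 eps s (Yt t) (e t))))).
    by apply: good_subst_diag; apply: good_inv0; apply: good_shx; exact: good_pert.
  apply: good_eq (goodB h1 h2) => t; rewrite [X in _ - rot X - _]eE.
  by rewrite {1}rotE rmorphB rmorphM /= subst_cst -rotE; ring.
move=> i j; have [Q [H1 H2 H3]] := g2 i j; exists (rot e1 i j *: 'X + Q); split.
- apply: leq_trans (size_polyD _ _) _; rewrite geq_max; apply/andP; split.
    by apply: leq_trans (size_scale_leq _ _) _; rewrite size_polyX.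
  have [->|Q0] := eqVneq Q 0; first by rewrite size_poly0.
  have := H1 Q0; nia.
- by rewrite coefD coefZ coefX mulr1 H2 // addr0.
move=> t; rewrite hornerD hornerZ hornerX -H3 !ps_subE bcstM; ring.
Qed.

(** Mode k of [e1] is -2 x^(2s) / (nui^k - nu^k) and the rotation multiplies it by nui^k. The result
    is stated without division because e^(k eps x^s) may be in resonance. *)
Lemma mode_rot_e1 k : (0 < k)%N ->
  (cst (nu0 ^+ (k * 2)) * bexp (ex s (eps *+ k)) - 1) * mode k (rot e1) = 2 * x ^+ (s + s).
Proof.
move=> k0; rewrite mode_rot' //; rewrite /e1 (mode_inv0 nu0_neq0 eps_neq0 s_gt0) //.
have -> : mode k (shx s (- Y0 *+ 2)) = - 2 * x ^+ s.
  apply/funext => i; apply/funext => j; rewrite -(rmorph_nat cst) -rmorphN bcstM exprMn bmonoE.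
  rewrite /mode; case: eqP => [->|ne]; last first.
    by rewrite (_ : _ && _ = false) ?mulr0 //; apply/negP => /andP[/eqP ? /eqP ?]; lia.
  rewrite /shx mulr2n !ps_addE !ps_oppE /Y0 andbb.
  rewrite (_ : (minn _ _ == _) && _ = (j == s)); last lia.
  by case: eqP => _ /=; ring.
have nn : nui ^+ k * nu ^+ k = 1 by rewrite -exprMn nui_nu // expr1n.
have e2 : nu ^+ k * nu ^+ k = cst (nu0 ^+ (k * 2)) * bexp (ex s (eps *+ k)).
  rewrite -expr2 -exprM nu_pow //; congr (_ * bexp (ex _ _)).
  by rewrite mulnC mulrnA; congr (_ *+ k); rewrite -[LHS]mulr_natr divfK // pnatr_eq0.
rewrite -e2 exprD.
transitivity (2 * x ^+ s * (nui ^+ k * (1 - nu ^+ k * nu ^+ k) * wh k)); first by ring.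
have -> : nui ^+ k * (1 - nu ^+ k * nu ^+ k) = nui ^+ k - nu ^+ k.
  transitivity (nui ^+ k - (nui ^+ k * nu ^+ k) * nu ^+ k); first by ring.
  by rewrite nn mul1r.
by rewrite whE //; ring.
Qed.

End Family.

(** * Lower bounds for the coefficients of 1 / (L e^y - 1) *)

Lemma card_odd_ord m : #|[pred i : 'I_(m.*2.+1) | odd i]| = m.
Proof.
rewrite -sum1_card big_mkcond /= -(big_mkord xpredT (fun i => if odd i then 1 else 0)).
elim: m => [|m IH]; first by rewrite big_nat1.
by rewrite doubleS big_nat_recr //= big_nat_recr //= IH /= odd_double /= addn0 addn1.
Qed.

Section Riccati.
Variable K : numFieldType.

(* Coefficients of a solution of [G' = (1 + G^2) / 2]. The series
   [f = 1 / (L e^p - 1)] satisfies [f' = - f - f^2], so that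
   [G(y) = -2i (f(iy) + 1/2)] is such a solution; it is real when [|L| = 1]. *)
Definition riccati (G : nat -> K) := forall n,
  n.+1%:R * G n.+1 = ((n == 0)%:R + \sum_(i < n.+1) G i * G (n - i)%N) / 2.

Lemma riccati_ge0 G : riccati G -> 0 <= G 0%N -> forall n, 0 <= G n.
Proof.
move=> HG G0; elim/ltn_ind=> -[//|n] IH.
have : 0 <= n.+1%:R * G n.+1.
  rewrite HG divr_ge0 // addr_ge0 // sumr_ge0 // => i _.
  by rewrite mulr_ge0 // IH //; have := ltn_ord i; lia.
by rewrite pmulr_rge0 // ltr0Sn.
Qed.

(** For n = 2m the convolution contains m products of odd-indexed coefficients, each at least 6^-n.
    The induction closes if (2m + 1) / 6 <= m / 2, which holds for m >= 1; this is the origin of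
    6. *)
Lemma riccati_lower_pos G : riccati G -> 0 <= G 0%N ->
  forall n, odd n -> 6%:R ^- n <= G n.
Proof.
move=> HG G0; have Gge := riccati_ge0 HG G0.
elim/ltn_ind=> -[//|n] IH /= ev.
have n1 : 0 < n.+1%:R :> K by rewrite ltr0Sn.
rewrite -(ler_pM2l n1) HG ler_pdivlMr //.
have [->|n0] := eqVneq n 0%N.
  rewrite /= big_ord1; apply: (@le_trans _ _ 1); last by rewrite lerDl mulr_ge0.
  rewrite mul1r expr1 mulrC ler_pdivrMr ?mul1r ?ltr0n // ler_nat; lia.
rewrite add0r; have [m en] : exists m, n = m.*2.
  by exists n./2; rewrite -[LHS]odd_double_half (negbTE ev).
have m0 : (0 < m)%N by lia.
apply: (@le_trans _ _ (\sum_(i < n.+1 | odd i) G i * G (n - i)%N)); last first.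
  rewrite [leRHS](bigID (fun i : 'I__ => odd i)) /= lerDl sumr_ge0 // => i _.
  by rewrite mulr_ge0.
apply: (@le_trans _ _ (\sum_(i < n.+1 | odd i) 6%:R ^- n)); last first.
  apply: ler_sum => i oi.
  have lti : (i < n)%N.
    by have := ltn_ord i; rewrite ltnS leq_eqVlt => /orP[/eqP e|//]; rewrite e (negbTE ev) in oi.
  have i0 : (0 < i)%N by case: (nat_of_ord i) oi.
  rewrite -[X in _ ^- X](subnK (ltnW lti)) exprD invfM mulrC.
  apply: ler_pM; rewrite ?invr_ge0 ?exprn_ge0 ?ler0n //.
    by apply: IH => //; lia.
  by apply: IH; [lia|rewrite oddB ?(ltnW lti) // (negbTE ev) oi].
rewrite sumr_const (_ : #|_| = m); last by rewrite en; exact: card_odd_ord.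
rewrite exprS invfM -!mulrA [6%:R ^- n * 2]mulrC !mulrA -[leRHS]mulr_natl.
rewrite ler_pM2r ?invr_gt0 ?exprn_gt0 ?ltr0n //.
rewrite mulrAC ler_pdivrMr ?ltr0n // -!natrM ler_nat en; lia.
Qed.

(** If the initial value is negative, -G(-y) solves the same equation and starts positive. *)
Lemma riccati_lower G : riccati G -> G 0%N \is Num.real ->
  forall n, odd n -> 6%:R ^- n <= `|G n|.
Proof.
move=> HG /orP[G0|G0] n on.
  by rewrite ger0_norm; [exact: riccati_lower_pos|exact: (riccati_ge0 HG G0)].
pose H m := (-1) ^+ m.+1 * G m.
have HH : riccati H.
  move=> m; rewrite /H mulrCA HG; have -> : (-1) ^+ m.+2 = (-1) ^+ m :> K by rewrite !exprS; ring.
  rewrite mulrA; congr (_ / 2); rewrite mulrDr; congr (_ + _); first by case: m => [|m] /=; ring.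
  rewrite mulr_sumr; apply: eq_bigr => i _.
  have lei : (i <= m)%N by rewrite -ltnS.
  have -> : (-1) ^+ m = (-1) ^+ i.+1 * (-1) ^+ (m - i).+1 :> K.
    by rewrite -exprD (_ : i.+1 + _ = m.+2)%N ?exprS; [ring|lia].
  ring.
have H0 : 0 <= H 0%N by rewrite /H expr1 mulN1r oppr_ge0.
have -> : `|G n| = H n.
  rewrite -(ger0_norm (riccati_ge0 HH H0 n)) /H normrM normrX normrN1 expr1n mul1r //.
exact: riccati_lower_pos.
Qed.

End Riccati.

Section SmallDivisor.
Variable K : numClosedFieldType.
Notation A := (ps (ps K)).
Notation p := (@pv K).
Notation q := (@qv K).
Notation x := (@xv K).
Notation cst := (@cst K).

Lemma subst_g0 (g f : A) : J 1 g -> subst g 0 f = bapp (fun i => f i 0%N) g.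
Proof.
move=> Jg; apply/funext => i; apply/funext => j; rewrite /bapp !substE.
suff -> : psum g 0 (i + j).+1 f = psum g 0 (i + j).+1 (uni (fun i => f i 0%N)) by [].
apply: eq_bigr => a _; congr (_ * _); apply: eq_bigr => b _.
rewrite nc_id // /uni; case: (nat_of_ord b) => [|b'] //=.
by rewrite expr0n /= !mulr0.
Qed.

Variable L : K.
Hypotheses (L_neq1 : L != 1) (L_norm : `|L| = 1).
Let w : A := cst L * bexp p - 1.
Definition inv_coef n : K := binv w n 0%N.

Let Jp : J 1 p. Proof. exact: J_p. Qed.
Lemma w00 : w 0%N 0%N = L - 1.
Proof. by rewrite /w !ps_subE bcstM bexp_00 // b1E mulr1. Qed.
Lemma w00_neq0 : w 0%N 0%N != 0. Proof. by rewrite w00 subr_eq0. Qed.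

Lemma inv_coefP (g : A) : J 1 g -> (cst L * bexp g - 1) * bapp inv_coef g = 1.
Proof.
move=> Jg; rewrite -subst_g0 //.
have -> : cst L * bexp g - 1 = subst g 0 w.
  by rewrite rmorphB rmorphM rmorph1 /= subst_cst /bexp subst_bapp // subst_p.
by rewrite -rmorphM /= mulbV ?w00_neq0 // rmorph1.
Qed.

Lemma inv_coef0 : inv_coef 0%N = (L - 1)^-1.
Proof. by rewrite /inv_coef binv_00 ?w00_neq0 // w00. Qed.

(** Differentiating w f = 1 with theta w = p (w + 1) gives theta f = -p (f + f^2). *)
Lemma inv_coefS n : n.+1%:R * inv_coef n.+1 =
  - (inv_coef n + \sum_(i < n.+1) inv_coef i * inv_coef (n - i)).
Proof.
have e0 f : w * f = 1 -> theta f = - (p * (f + f * f)).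
  move=> wf; apply: (@bmul_cancel _ w); first exact: w00_neq0.
  have := congr1 (@theta K) wf; rewrite thetaM theta1 /=.
  have -> : theta w = p * (w + 1).
    rewrite /w subrK raddfB /= theta1 subr0 thetaM theta_cst mul0r add0r theta_bexp //.
    have -> : theta p = p; last by ring.
    apply/funext => i; apply/funext => j; rewrite /theta pvE.
    by case: andP => [[/eqP -> /eqP ->]|_]; rewrite ?mulr0 ?mulr1.
  move=> /eqP; rewrite addrC addr_eq0 => /eqP ->.
  have e2 : w * (f + f * f) = w * f + f by rewrite mulrDr mulrA wf mul1r.
  by rewrite mulrN mulrCA e2; ring.
set f := binv w; have e := e0 f (mulbV w00_neq0).
have := congr1 (fun u : A => u n.+1 0%N) e; rewrite /= !ps_oppE.
have := bmonoM (f + f * f) 1 0 n.+1 0; rewrite expr1 expr0 mulr1 => ->.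
rewrite /= !ps_addE subn1 /= /theta addn0 => ->; congr (- (_ + _)).
by rewrite bmulE; apply: eq_bigr => i _; rewrite big_ord1.
Qed.

Lemma inv_coef_lower n : odd n -> 6%:R ^- n / 2 <= `|inv_coef n|.
Proof.
move=> on; pose G n := -2 * 'i * (inv_coef n * 'i ^+ n + (n == 0)%:R / 2) : K.
have i2 : 'i * 'i = -1 :> K by rewrite -expr2 sqrCi.
have GE m : inv_coef m = 'i * G m * (- 'i) ^+ m / 2 - (m == 0)%:R / 2.
  have -> : 'i * G m * (- 'i) ^+ m / 2
      = (- ('i * 'i)) * (inv_coef m * (- ('i * 'i)) ^+ m + (m == 0)%:R / 2 * (- 'i) ^+ m).
    by rewrite -mulrN exprMn /G; field.
  rewrite i2 opprK expr1n !mul1r mulr1.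
  by case: m => [|m] /=; rewrite ?expr0 ?mulr1 ?addrK // !mul0r addr0 subr0.
have HG : riccati G.
  move=> m; rewrite {1}/G /= mul0r addr0 mulrCA (mulrA m.+1%:R) inv_coefS.
  have -> : \sum_(i < m.+1) inv_coef i * inv_coef (m - i) =
     - inv_coef m - (m == 0)%:R / 4 - (- 'i) ^+ m / 4 * \sum_(i < m.+1) G i * G (m - i)%N.
    have d1 (u : nat -> K) : \sum_(i < m.+1) (i == 0 :> nat)%:R * u (m - i)%N = u m.
      by rewrite big_ord_recl /= mul1r subn0 big1 ?addr0 // => i _; rewrite mul0r.
    have d2 (u : nat -> K) : \sum_(i < m.+1) u i * ((m - i)%N == 0)%:R = u m.
      rewrite big_ord_recr /= subnn mulr1 big1 ?add0r // => i _.
      by rewrite subn_eq0 leqNgt ltn_ord mulr0.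
    have e (i : 'I_m.+1) : inv_coef i * inv_coef (m - i) = - (G i * G (m - i)%N) * ((- 'i) ^+ m / 4)
       - ((i == 0 :> nat)%:R * inv_coef (m - i) / 2 + inv_coef i * ((m - i)%N == 0)%:R / 2
          + (i == 0 :> nat)%:R * ((m - i)%N == 0)%:R / 4).
      rewrite !GE; have -> : (- 'i) ^+ m = (- 'i) ^+ i * (- 'i) ^+ (m - i) :> K.
        by rewrite -exprD subnKC // -ltnS.
      set Ji := _ ^+ i; set Jj := _ ^+ _;
      have -> : - (G i * G (m - i)%N) * (Ji * Jj / 4)
        = 'i * 'i * (G i * G (m - i)%N) * (Ji * Jj / 4) by rewrite i2; ring.
      by field.
    rewrite (eq_bigr _ (fun i _ => e i)) sumrB !big_split /= -!mulr_suml sumrN.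
    rewrite d1 d2 (d1 (fun j => (j == 0)%:R)); by field.
  have dI : (m == 0)%:R * 'i ^+ m = (m == 0)%:R :> K.
    by case: m => [|m] /=; rewrite ?mulr1 // !mul0r.
  have JI : (- 'i) ^+ m * 'i ^+ m = 1 :> K by rewrite -exprMn mulNr i2 opprK expr1n.
  set S := \sum_(i < m.+1) G i * G (m - i)%N.
  transitivity (- ('i * 'i) * ((m == 0)%:R * 'i ^+ m + ((- 'i) ^+ m * 'i ^+ m) * S) / 2).
    by rewrite exprS; field.
  by rewrite i2 JI dI opprK !mul1r.
(* On the unit circle 1 / (L - 1) + 1/2 is purely imaginary. *)
have G0 : G 0%N \is Num.real.
  have LL : L^* * L = 1 by rewrite mulrC -normCK L_norm expr1n.
  have L0 : L != 0 by rewrite -normr_eq0 L_norm oner_eq0.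
  have L1 : L - 1 != 0 by rewrite subr_eq0.
  rewrite CrealE /G expr0 mulr1 /= inv_coef0.
  rewrite !(rmorphM, rmorphD, rmorphN, fmorphV, rmorph1, rmorph_nat) /= conjCi.
  have -> : L^* = L^-1 by rewrite -[RHS]mul1r -LL mulfK.
  have e : L^-1 - 1 = - (L - 1) / L by field.
  apply/eqP; rewrite e; field; rewrite ?L0 ?L1 //.
have := riccati_lower HG G0 on.
rewrite /G (_ : (n == 0) = false) /=; last by case: (n) on.
rewrite mul0r addr0 !normrM normrN normrX normCi expr1n !mulr1 normr_nat.
by rewrite ler_pdivrMr ?ltr0n // mulrC.
Qed.

Lemma bapp_ex_coef (c : nat -> K) s (w0 : K) n : (0 < s)%N ->
  bapp c (ex s w0) (s * n)%N (s * n)%N = c n * w0 ^+ n.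
Proof.
move=> s0; have Je := ex_J s0 w0.
have := @bapp_psum _ c _ (s * n + s * n).+1 Je _ _ (ltnSn _).
rewrite ps_subE ps_subE => /eqP; rewrite subr_eq0 => /eqP ->; rewrite bsumE.
have e k : (cst (c k) * ex s w0 ^+ k) (s * n)%N (s * n)%N = c k * w0 ^+ k * (n == k)%:R.
  rewrite /ex exprMn -rmorphXn mulrA -rmorphM bcstM -exprM exprMn bmonoE andbb.
  by rewrite eqn_pmul2l.
under eq_bigr => k _ do rewrite e.
have lt : (n < (s * n + s * n).+1)%N by nia.
rewrite (bigD1 (Ordinal lt)) //= eqxx mulr1 big1 ?addr0 // => k ne.
by rewrite eq_sym -[k == n :> nat]/(k == Ordinal lt) (negbTE ne) mulr0.
Qed.
End SmallDivisor.

Section LinearTerm.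
Variable K : numClosedFieldType.
Variables (nu0 eps : K) (s : nat) (wh : nat -> ps (ps K)).
Hypotheses (s_gt0 : (0 < s)%N) (nu0_norm : `|nu0| = 1) (eps_norm : `|eps| = 1).
Hypotheses (wh_diag : forall k, diag (wh k))
  (whE : forall k, (0 < k)%N ->
    (nui nu0 eps s ^+ k - nu nu0 eps s ^+ k) * wh k = @xv K ^+ s).

(** Substituting k eps x^s for y multiplies the n-th coefficient by k^n in modulus; the 2 of the
    linear term cancels the 1/2 of [inv_coef_lower]. *)
Lemma rot_e1_lower k n : (0 < k)%N -> nu0 ^+ (k * 2) != 1 -> odd n ->
  (k%:R / 6%:R) ^+ n
    <= `|rot nu0 eps s (e1 s wh) (k + (s * n + (s + s)))%N (s * n + (s + s))%N|.
Proof.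
move=> k0 L1 on; set L := nu0 ^+ (k * 2) in L1 *; set w0 := eps *+ k.
have nu00 : nu0 != 0 by rewrite -normr_eq0 nu0_norm oner_eq0.
have eps0 : eps != 0 by rewrite -normr_eq0 eps_norm oner_eq0.
have L_norm : `|L| = 1 by rewrite normrX nu0_norm expr1n.
have := mode_rot_e1 s_gt0 nu00 eps0 wh_diag whE k0; rewrite -/L -/w0 => e.
have Je := ex_J s_gt0 w0.
have eM : mode k (rot nu0 eps s (e1 s wh)) = 2 * @xv K ^+ (s + s) * bapp (inv_coef L) (ex s w0).
  apply: (@bmul_cancel _ (cst L * bexp (ex s w0) - 1)).
    by rewrite !ps_subE bcstM bexp_00 // b1E mulr1 subr_eq0.
  by rewrite e mulrCA inv_coefP // mulr1.
set l := (s * n + (s + s))%N.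
have -> : rot nu0 eps s (e1 s wh) (k + l)%N l = mode k (rot nu0 eps s (e1 s wh)) l l.
  by rewrite /mode eqxx.
rewrite eM -mulrA -(rmorph_nat (@cst K) 2) bcstM [@xv K ^+ _]exprMn bmonoM.
rewrite /l !ltnNge leq_addl /= addnK (bapp_ex_coef L1) // !normrM normr_nat normrX normrMn eps_norm.
rewrite exprMn exprVn mulrA [leLHS]mulrC ler_pM2r ?exprn_gt0 ?ltr0n //.
by rewrite -ler_pdivrMl ?ltr0n // mulrC inv_coef_lower.
Qed.
End LinearTerm.

Lemma leq_exp_ffact n m : (n ^ m <= (n + m) ^_ m)%N.
Proof.
elim: m => [|m IH] //; rewrite expnS addnS ffactSS leq_mul //; lia.
Qed.
Lemma bin_leq_exp2 n k : (k <= n)%N -> ('C(n, k) <= 2 ^ n)%N.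
Proof.
rewrite -ltnS => lt; rewrite -[2%N]/(1 + 1)%N expnDn (bigD1 (Ordinal lt)) //=.
by rewrite !exp1n !muln1 leq_addr.
Qed.
(** n^n is at most the falling factorial (2n)(2n-1)...(n+1) = C(2n, n) n!. *)
Lemma leq_exp_fact n : (n ^ n <= 4 ^ n * n`!)%N.
Proof.
apply: leq_trans (leq_exp_ffact n n) _; rewrite -bin_ffact leq_mul2r; apply/orP; right.
rewrite -[4%N]/(2 ^ 2)%N -expnM mul2n -addnn; apply: bin_leq_exp2; exact: leq_addr.
Qed.

(** * Interpolation and uniform bounds *)

Section Interpolation.
Variable K : numFieldType.

Lemma coef_prod_XsubC_le (I : Type) (r : seq I) (Q : pred I) (u : I -> K) i :
  (forall k, `|u k| <= 1) ->
  `|(\prod_(k <- r | Q k) ('X - (u k)%:P))`_i| <= 2%:R ^+ count Q r.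
Proof.
move=> u1; elim: r i => [|k r IH] i /=.
  by rewrite big_nil coef1 expr0; case: eqP; rewrite ?normr1 ?normr0.
rewrite big_cons; case: ifP => //= _.
rewrite mulrBl coefB coefXM coefCM exprS mulr_natl mulr2n.
apply: le_trans (ler_normB _ _) _; apply: lerD.
  by case: eqP => _; rewrite ?normr0 ?exprn_ge0 ?ler0n.
by rewrite normrM; apply: le_trans (IH i); rewrite ler_piMl.
Qed.

Lemma prod_dist i e : \prod_(l < i + e.+1 | l != i :> nat) `|i%:R - l%:R| = (i`! * e`!)%:R :> K.
Proof.
rewrite big_mkcond; elim: i => [|i IH]; rewrite big_ord_recl /=.
  rewrite mul1r fact0 mul1n; elim: e => [|e IH]; first by rewrite big_ord0.
  rewrite big_ord_recr /= IH factS mulnC natrM; congr (_ * _).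
  by rewrite sub0r normrN normr_nat.
rewrite subr0 normr_nat factS -mulnA natrM -IH; congr (_ * _); apply: eq_bigr => l _.
rewrite /bump /= add1n eqSS; case: ifP => // _; congr `|_|.
by rewrite -![_.+1%:R]natr1; ring.
Qed.

(** Lagrange interpolation at n equidistant nodes in [0, 1]. Each numerator has coefficients at most
    2^n, and k! (n-1-k)! is at least (n-1)! / 2^(n-1); together they give 4^n. *)
Lemma coef_bound (P : {poly K}) n (a h B : K) i : (0 < n)%N ->
  (size P <= n)%N -> 0 < h -> 0 <= a -> a + h * n%:R <= 1 ->
  (forall m, (m < n)%N -> `|P.[a + h * m%:R]| <= B) ->
  `|P`_i| <= n%:R * (B * 4%:R ^+ n / (h ^+ n.-1 * (n.-1)`!%:R)).
Proof.
move=> n0 sP h0 a0 an HB; pose u m := a + h * m%:R.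
have u_inj : injective u.
  move=> m m' /addrI/mulfI => /(_ (lt0r_neq0 h0)) /eqP; rewrite eqr_nat => /eqP //.
have B0 : 0 <= B by apply: le_trans (HB 0%N n0).
rewrite (lagrange_gen n0 u_inj sP) coef_sum.
apply: le_trans (ler_norm_sum _ _ _) _.
rewrite mulr_natl -[X in _ *+ X]card_ord -sumr_const; apply: ler_sum => k _.
rewrite lagrangeE //= mulrA -polyCM coefCM !normrM -mulrA.
apply: (@le_trans _ _ (B * (2%:R ^+ n.-1 / (h ^+ n.-1 * (n.-1)`!%:R) * 2%:R ^+ n))); last first.
  have hf : 0 <= (h ^+ n.-1 * (n.-1)`!%:R)^-1.
    by rewrite invr_ge0 mulr_ge0 ?ler0n // exprn_ge0 // ltW.
  rewrite -[leRHS]mulrA ler_wpM2l // mulrAC ler_wpM2r // -exprD -!natrX ler_nat.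
  by rewrite -[4%N]/(2 ^ 2)%N -expnM leq_exp2l //; lia.
apply: ler_pM; rewrite ?mulr_ge0 //; first exact: HB.
apply: ler_pM => //; last first.
  have cnt : (count [pred j : 'I_n | j != k] (index_enum 'I_n) <= n)%N.
    by rewrite -sum1_count sum1_card -[leqRHS](card_ord n) max_card.
  apply: le_trans (coef_prod_XsubC_le _ _ _ _) _ => [j|].
    have hj : 0 <= h * j%:R by rewrite mulr_ge0 ?ler0n ?ltW.
    rewrite ger0_norm; last exact: addr_ge0.
    apply: le_trans an; by rewrite lerD2l ler_pM2l // ler_nat ltnW.
  by rewrite ler_eXn2l ?ltr1n.
rewrite normfV horner_prod normr_prod.
have -> : \prod_(j < n | j != k) `|('X - (u j)%:P).[u k]| =
    h ^+ n.-1 * (k`! * (n.-1 - k)`!)%:R.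
  have en : n = (k + (n.-1 - k).+1)%N by have := ltn_ord k; lia.
  rewrite -prod_dist -en.
  transitivity (\prod_(j < n | j != k) (h * `|k%:R - j%:R|)).
    apply: eq_bigr => j _; rewrite hornerXsubC /u -[X in _ = X * _](gtr0_norm h0) -normrM; congr `|_|; ring.
  rewrite big_split /=; congr (_ * _); rewrite prodr_const; congr (_ ^+ _).
  by rewrite cardC1 card_ord.
have kn : (k <= n.-1)%N by have := ltn_ord k; lia.
have hn : 0 < h ^+ n.-1 by rewrite exprn_gt0.
rewrite !invfM mulrCA ler_pM2l ?invr_gt0 //.
rewrite ler_pdivlMr ?ltr0n ?fact_gt0 // mulrC ler_pdivrMr ?ltr0n ?muln_gt0 ?fact_gt0 //.
rewrite -!natrX -!natrM ler_nat -(bin_fact kn) leq_mul2r; apply/orP; right.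
exact: bin_leq_exp2.
Qed.

(** With step (b - a) / n the bounds n^n <= 4^n n! and n <= 2^n leave 4 * 4 * 2 = 32 per degree: a
    geometric bound, with no factorial. *)
Lemma coef_bound_interval (P : {poly K}) n (a b B : K) i : (0 < n)%N ->
  (size P <= n)%N -> 0 <= a -> a < b -> b <= 1 ->
  (forall m, (m < n)%N -> `|P.[a + (b - a) / n%:R * m%:R]| <= B) ->
  `|P`_i| <= B * (32%:R / (b - a)) ^+ n.
Proof.
move=> n0 sP a0 ab b1 HB; have ba : 0 < b - a by rewrite subr_gt0.
have n0' : 0 < n%:R :> K by rewrite ltr0n.
set h := (b - a) / n%:R in HB *; have h0 : 0 < h by rewrite divr_gt0.
have hn : h * n%:R = b - a by rewrite /h divfK // lt0r_neq0.
have an : a + h * n%:R <= 1 by rewrite hn addrC subrK.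
have B0 : 0 <= B by apply: le_trans (HB 0%N n0).
apply: le_trans (coef_bound _ n0 sP h0 a0 an HB) _.
rewrite mulrA [n%:R * _]mulrCA -!mulrA ler_wpM2l //.
case: n n0 sP n0' @h HB h0 hn an => // n _ _ n0' h _ h0 hn an /=.
have f0 : 0 < n`!%:R :> K by rewrite ltr0n fact_gt0.
rewrite !mulrA ler_pdivrMr ?mulr_gt0 ?exprn_gt0 // expr_div_n mulrAC ler_pdivlMr ?exprn_gt0 //.
rewrite -hn exprMn exprS !mulrA.
apply: (@le_trans _ _ (4%:R ^+ n.+1 * n.+1%:R ^+ n.+1 * h ^+ n)).
  rewrite [leLHS](_ : _ = (4%:R ^+ n.+1 * n.+1%:R ^+ n.+1 * h ^+ n) * (h * n.+1%:R)); last first.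
    by move: (n.+1%:R : K) => N; rewrite !exprS; ring.
  apply: ler_piMr; first by rewrite !mulr_ge0 ?exprn_ge0 ?ler0n // ltW.
  by rewrite hn; apply: le_trans b1; rewrite gerBl.
rewrite [leRHS]mulrAC ler_pM2r ?exprn_gt0 // -!natrX -!natrM ler_nat.
apply: (@leq_trans (4 ^ n.+1 * (4 ^ n.+1 * n.+1`!))); first by rewrite leq_mul2l leq_exp_fact orbT.
have : (n.+1 <= 2 ^ n.+1)%N by rewrite ltnW // ltn_expl.
rewrite factS => le; have -> : (32 ^ n.+1 = 4 ^ n.+1 * 4 ^ n.+1 * 2 ^ n.+1)%N by rewrite -!expnMn.
by rewrite !mulnA leq_mul2r -!mulnA !leq_mul2l le !orbT.
Qed.
End Interpolation.

(** * Uniform bounds by nested intervals *)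

Section Baire.
Variable R : realType.
Local Notation C := R[i].
Local Notation "x %:C" := (real_complex _ x) : ring_scope.

Lemma normC_real (x : R) : `|x%:C| = `|x|%:C.
Proof. by rewrite normc_def /= expr0n addr0 sqrtr_sqr. Qed.
Lemma normC_exists (c : C) : exists2 m : R, 0 <= m & `|c| = m%:C.
Proof. by rewrite normc_def; exists (Num.sqrt (complex.Re c ^+ 2 + complex.Im c ^+ 2)); rewrite ?sqrtr_ge0. Qed.

Lemma poly_bounded01 (P : {poly C}) : exists2 M : R, 0 < M &
  forall t : R, 0 <= t <= 1 -> `|P.[t%:C]| <= M%:C.
Proof.
elim/poly_ind: P => [|P c [M M0 HM]].
  by exists 1 => // t _; rewrite horner0 normr0 -[0]/(0%:C) lecR.
have [m m0 em] := normC_exists c; exists (M + m); first exact: ltr_wpDr.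
move=> t t01; rewrite !hornerE; apply: le_trans (ler_normD _ _) _.
rewrite em rmorphD /= lerD2r normrM; apply: le_trans (HM t t01).
case/andP: t01 => t0 t1; rewrite ler_piMr // normC_real ger0_norm //.
by rewrite -[1]/(1%:C) lecR.
Qed.

Lemma poly_lipschitz (P : {poly C}) : exists2 L : R, 0 < L &
  forall t u : R, 0 <= t <= 1 -> 0 <= u <= 1 -> `|P.[t%:C] - P.[u%:C]| <= (L * `|t - u|)%:C.
Proof.
elim/poly_ind: P => [|P c [L L0 HL]].
  by exists 1 => // t u _ _; rewrite !horner0 subrr normr0 -[0]/(0%:C) lecR mul1r.
have [M M0 HM] := poly_bounded01 P.
exists (L + M); first exact: addr_gt0.
move=> t u t01 u01; rewrite !hornerE.
have -> : P.[t%:C] * t%:C + c - (P.[u%:C] * u%:C + c) =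
  (P.[t%:C] - P.[u%:C]) * t%:C + P.[u%:C] * (t - u)%:C by rewrite rmorphB /=; ring.
apply: le_trans (ler_normD _ _) _; rewrite !normrM !normC_real.
rewrite mulrDl [X in _ <= X]rmorphD /=; apply: lerD.
  apply: le_trans (HL t u t01 u01); case/andP: t01 => t0 t1.
  by rewrite ler_piMr // ger0_norm // -[1]/(1%:C) lecR.
by rewrite rmorphM /= ler_wpM2r ?HM // -[0]/(0%:C) lecR.
Qed.

(** A Lipschitz bound keeps a strict lower bound valid on a closed interval around [t0], which stays
    inside ]a, b[. *)
Lemma poly_large_interval (P : {poly C}) (a b t0 M : R) : 0 <= a -> b <= 1 -> a < t0 -> t0 < b ->
  M%:C < `|P.[t0%:C]| -> exists c : R * R, [/\ a < c.1, c.1 < c.2, c.2 < b &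
    forall t, c.1 <= t <= c.2 -> M%:C < `|P.[t%:C]|].
Proof.
move=> a0 b1 at0 tb; have [m m0 em] := normC_exists P.[t0%:C]; rewrite em ltcR => Mm.
have [L L0 HL] := poly_lipschitz P.
pose d := Num.min (Num.min ((t0 - a) / 2) ((b - t0) / 2)) ((m - M) / (2 * L)).
have d0 : 0 < d by rewrite !lt_min !divr_gt0 ?subr_gt0 ?mulr_gt0.
have [da db dL] : [/\ d <= (t0 - a) / 2, d <= (b - t0) / 2 & d <= (m - M) / (2 * L)].
  by rewrite /d !ge_min !lexx ?orbT.
exists (t0 - d, t0 + d); split => /=; try lra.
move=> t /andP[ta tb']; have td : `|t0 - t| <= d by rewrite ler_norml; apply/andP; split; lra.
have := HL t0 t; have -> : 0 <= t0 <= 1 by apply/andP; split; lra.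
have -> : 0 <= t <= 1 by apply/andP; split; lra.
move=> /(_ isT isT) le.
have := lerB_normD (P.[t0%:C]) (P.[t%:C] - P.[t0%:C]).
have [m' _ em'] := normC_exists P.[t%:C].
rewrite [X in _ <= `|X|]addrC subrK em em' ltcR distrC => le2.
have : m%:C - (L * `|t0 - t|)%:C <= m'%:C.
  by apply: le_trans le2; rewrite lerD2l lerN2.
rewrite -rmorphB /= lecR => le3.
have : L * `|t0 - t| <= (m - M) / 2.
  apply: (@le_trans _ _ (L * d)); first by rewrite ler_pM2l.
  by move: dL; rewrite ler_pdivlMr ?mulr_gt0 // => ?; lra.
lra.
Qed.

(* Baire: were no bound uniform on a subinterval, nested intervals would lead to
   a point violating every bound. *)
Theorem uniform_coef_bound (I : Type) (Q : I -> {poly C}) (d : I -> nat) :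
  (forall k, (0 < d k)%N) -> (forall k, (size (Q k) <= d k)%N) ->
  (forall t : R, exists n, forall k, `|(Q k).[t%:C]| <= n%:R ^+ d k) ->
  exists n, forall k, `|(Q k)`_1| <= n%:R ^+ d k.
Proof.
move=> d0 sQ H; apply: contrapT => no.
have step n (c : R * R) : exists c' : R * R, 0 <= c.1 -> c.1 < c.2 -> c.2 <= 1 ->
   [/\ c.1 < c'.1, c'.1 < c'.2, c'.2 < c.2 &
    exists k, forall t : R, c'.1 <= t <= c'.2 -> n%:R ^+ d k < `|(Q k).[t%:C]|].
  (* If no such subinterval exists, every [Q k] is bounded by n^(d k) on ]a, b[, and interpolation
     there yields the uniform bound that was denied. *)
  case: c => a b /=; apply: contrapT => no'; apply: no.
  have [[a0 ab b1]|no3] := pselect [/\ 0 <= a, a < b & b <= 1]; last first.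
    by case: no'; exists (0, 0) => *; case: no3.
  have nC k : n%:R ^+ d k = (n%:R ^+ d k)%:C :> C by rewrite rmorphXn rmorph_nat.
  have small k t : a < t -> t < b -> `|(Q k).[t%:C]| <= n%:R ^+ d k.
    move=> ta tb; have [m' _ em'] := normC_exists (Q k).[t%:C].
    rewrite em' nC lecR leNgt; apply/negP => lt.
    have [] := @poly_large_interval (Q k) a b t (n%:R ^+ d k) a0 b1 ta tb.
      by rewrite em' ltcR.
    move=> c' [h1 h2 h3 h4]; apply: no'; exists c' => *; split=> //; exists k => u hu.
    by rewrite nC; exact: h4.
  have node (u v : R) (i j : nat) : u%:C + v%:C / i%:R * j%:R = (u + v / i%:R * j%:R)%:C.
    by rewrite rmorphD /= !rmorphM /= fmorphV /= !rmorph_nat.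
  have ratio (u : R) (i j : nat) : i%:R * (j%:R / u%:C) = (i%:R * (j%:R / u))%:C.
    by rewrite !rmorphM /= fmorphV /= !rmorph_nat.
  (* The nodes are taken in the middle third, strictly inside the interval, where [small]
     applies. *)
  pose a1 := a + (b - a) / 3; pose w := (b - a) / 3.
  have w0 : 0 < w by rewrite /w; lra.
  have N0 : 0 <= n%:R * (32%:R / w) :> R by rewrite mulr_ge0 ?ler0n // divr_ge0 ?ler0n // ltW.
  exists (Num.bound (n%:R * (32%:R / w))) => k.
  have lecC (u v : R) : u <= v -> u%:C <= v%:C by rewrite lecR.
  have ltcC (u v : R) : u < v -> u%:C < v%:C by rewrite ltcR.
  have wC : (a1 + w)%:C - a1%:C = w%:C by rewrite -rmorphB /=; congr _%:C; ring.
  have := @coef_bound_interval C (Q k) (d k) a1%:C (a1 + w)%:C (n%:R ^+ d k) 1 (d0 k) (sQ k).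
  rewrite wC => /(_ (lecC 0 a1 _) (ltcC _ _ _) (lecC _ 1 _)) => le.
  apply: (@le_trans _ _ (n%:R ^+ d k * (32%:R / w%:C) ^+ d k)).
    apply: le; rewrite /a1 /w; try lra.
    move=> m lt; have dk : 0 < (d k)%:R :> R by rewrite ltr0n.
    rewrite node.
    have mw : 0 <= w / (d k)%:R * m%:R by rewrite mulr_ge0 ?ler0n // divr_ge0 // ltW.
    have mw2 : w / (d k)%:R * m%:R <= w.
      by rewrite mulrAC ler_pdivrMr // ler_pM2l // ler_nat ltnW.
    by apply: small; rewrite /a1; move: mw mw2; rewrite /w; lra.
  rewrite -exprMn ratio.
  have -> i : i%:R ^+ d k = (i%:R ^+ d k)%:C :> C by rewrite rmorphXn /= rmorph_nat.
  rewrite -(rmorphXn (real_complex R)) lecR.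
  by rewrite lerXn2r ?nnegrE ?ler0n // ltW // archi_boundP.
have [F HF] := choice (fun nc : nat * (R * R) => step nc.1 nc.2).
pose c := fix c n := if n is m.+1 then F (m, c m) else (0 : R, 1 : R).
have cv n : [/\ 0 <= (c n).1, (c n).1 < (c n).2 & (c n).2 <= 1].
  elim: n => [|n [h1 h2 h3]]; first by split=> /=.
  have [e1 e2 e3 _] := HF (n, c n) h1 h2 h3; split=> //=.
    by apply: le_trans h1 (ltW e1).
  exact: le_trans (ltW e3) h3.
have cS n : [/\ (c n).1 <= (c n.+1).1, (c n.+1).2 <= (c n).2 & exists k, forall t : R,
    (c n.+1).1 <= t <= (c n.+1).2 -> n%:R ^+ d k < `|(Q k).[t%:C]|].
  have [h1 h2 h3] := cv n; have [e1 e2 e3 e4] := HF (n, c n) h1 h2 h3.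
  by split=> //; exact: ltW.
have mono1 n k : (c n).1 <= (c (n + k)%N).1.
  elim: k => [|k IH]; first by rewrite addn0.
  by rewrite addnS; have [h _ _] := cS (n + k)%N; exact: le_trans IH h.
have mono2 n k : (c (n + k)%N).2 <= (c n).2.
  elim: k => [|k IH]; first by rewrite addn0.
  by rewrite addnS; have [_ h _] := cS (n + k)%N; exact: le_trans h IH.
have cross n k : (c n).1 <= (c k).2.
  have [_ h _] := cv (n + k)%N.
  apply: le_trans (mono1 n k) _; apply: le_trans (ltW h) _.
  by rewrite addnC.
(* The supremum of the left endpoints lies in all the intervals and violates every bound n. *)
pose E : set R := fun u => exists n, u = (c n).1.
have ub k : ubound E (c k).2 by move=> _ [n ->]; exact: cross.
have hasE : has_ubound E by exists (c 0%N).2; exact: ub.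
have [n Hn] := H (sup E); have [_ _ [k Hk]] := cS n.
have := Hk (sup E); have := Hn k => le /(_ _)/lt_geF; rewrite le => /(_ _)/negP.
have -> : (c n.+1).1 <= sup E <= (c n.+1).2.
  apply/andP; split; first by apply: ub_le_sup => //; exists n.+1.
  by apply: ge_sup; [exists (c 0%N).1, 0%N|exact: ub].
by move=> /(_ isT).
Qed.
End Baire.

Lemma coef_comp_scaleX (K : comNzRingType) (P : {poly K}) (c : K) :
  (P \Po (c *: 'X))`_1 = P`_1 * c.
Proof.
rewrite comp_polyE coef_sum.
under eq_bigr => i _ do rewrite exprZn !coefZ coefXn.
have [le|lt] := leqP (size P) 1.
  rewrite nth_default // mul0r big1 // => i _.
  have -> : (1 == i :> nat) = false by have := ltn_ord i; lia.
  by rewrite !mulr0.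
rewrite (bigD1 (Ordinal lt)) //= expr1 mulr1 big1 ?addr0 // => i ne.
by rewrite eq_sym -[i == 1 :> nat]/(i == Ordinal lt) (negbTE ne) !mulr0.
Qed.

Lemma size_comp_scaleX (K : idomainType) (P : {poly K}) (c : K) :
  (size (P \Po (c *: 'X)) <= size P)%N.
Proof.
rewrite comp_polyE; apply: leq_trans (size_sum _ _ _) _; apply/bigmax_leqP => i _.
apply: leq_trans (size_scale_leq _ _) _; rewrite exprZn.
by apply: leq_trans (size_scale_leq _ _) _; rewrite size_polyXn.
Qed.

(** For fixed k the exponent of N grows like 2 s m, and k >= 12 N^(2s) leaves a spare factor 2^m,
    which overtakes the constant power [D] once m = 2 D + 1. *)
Lemma exp_growth_contra k s N : (0 < N)%N -> (12 * N ^ (2 * s) <= k)%N -> exists2 m, odd m &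
  (6 ^ m * N ^ (k + (s * m + (s + s)) + (s * m + (s + s))).+2 < k ^ m)%N.
Proof.
move=> N0 lek; pose D := (N ^ (k + 4 * s).+2)%N; exists D.*2.+1 => /=; first by rewrite odd_double.
set m := D.*2.+1.
have -> : ((k + (s * m + (s + s)) + (s * m + (s + s))).+2 = (2 * s) * m + (k + 4 * s).+2)%N.
  by rewrite mulnAC -mulnA [(m * s)%N]mulnC; move: (s * m)%N => u; lia.
rewrite expnD expnM -/D mulnA -expnMn.
apply: (@leq_trans ((12 * N ^ (2 * s)) ^ m)); last by rewrite leq_exp2r.
have -> : (12 * N ^ (2 * s) = 2 * (6 * N ^ (2 * s)))%N by rewrite mulnA.
rewrite [ltnRHS]expnMn mulnC ltn_pmul2r ?expn_gt0 ?muln_gt0 ?expn_gt0 ?N0 //.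
by apply: ltn_trans (ltn_expl m (isT : 1 < 2)%N); rewrite /m ltnS -addnn leq_addr.
Qed.

(** * A parameter with divergent normalisation *)

Section Divergence.
Variable R : realType.
Local Notation C := R[i].
Local Notation "x %:C" := (real_complex _ x) : ring_scope.
Variables (nu0 eps : C) (s : nat).
Hypotheses (s_gt0 : (0 < s)%N) (nu0_norm : `|nu0| = 1) (eps_norm : `|eps| = 1).
Hypotheses (nu0_4 : nu0 ^+ 2 - nu0 ^- 2 != 0).

Lemma nat_bound (c : C) : exists n, `|c| <= n%:R.
Proof.
have [m m0 ->] := normC_exists c; exists (Num.bound m).
by rewrite -(rmorph_nat (real_complex R)) /= lecR ltW // archi_boundP.
Qed.

(** Two consecutive resonances would give nu0^2 = 1. *)
Lemma nonresonant k : exists2 k', (k <= k')%N & (nu0 ^+ (k' * 2) != 1).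
Proof.
have [e|ne] := eqVneq (nu0 ^+ (k * 2)) 1; last by exists k.
exists k.+1 => //; rewrite mulSn exprD e mulr1; apply: contraNneq nu0_4 => ->.
by rewrite invr1 subrr.
Qed.

Theorem divergent_parameter (wh : nat -> ps (ps C)) (e : C -> ps (ps C)) :
  (forall k, diag (wh k)) ->
  (forall k, (0 < k)%N -> (nui nu0 eps s ^+ k - nu nu0 eps s ^+ k) * wh k = @xv C ^+ s) ->
  (forall t, step nu0 eps s (Yt s t) wh (e t) = e t) ->
  (forall t n i j, (minn i j < n)%N -> e t i j = iter n (step nu0 eps s (Yt s t) wh) 0 i j) ->
  exists t : R, ~ exists2 v, conv v & diag (beta nu0 eps s (Yt s ('i * t%:C)) (e ('i * t%:C)) - v).
Proof.
move=> wh_diag whE est eit; apply: contrapT => no.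
have H t : exists2 v, conv v & diag (beta nu0 eps s (Yt s ('i * t%:C)) (e ('i * t%:C)) - v).
  by apply: contrapT => H; apply: no; exists t.
have nu00 : nu0 != 0 by rewrite -normr_eq0 nu0_norm oner_eq0.
have eps0 : eps != 0 by rewrite -normr_eq0 eps_norm oner_eq0.
have poly ij : exists P : {poly C}, [/\ (size P <= (ij.1 + ij.2).+2)%N,
    P`_1 = rot nu0 eps s (e1 s wh) ij.1 ij.2 &
    forall t, beta nu0 eps s (Yt s t) (e t) ij.1 ij.2 = P.[t]].
  by apply: poly_dependence.
have [P HP] := choice poly.
(* Only imaginary parameters i t give a real structure, hence the rescaled variable. Diagonal
   coefficients are replaced by 0 since convergence is known only modulo diagonal series. *)
pose Q (ij : nat * nat) : {poly C} := if ij.1 == ij.2 then 0 else P ij \Po ('i *: 'X).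
have [||t|n Hn] := @uniform_coef_bound R _ Q (fun ij => (ij.1 + ij.2).+2).
- by [].
- move=> ij; rewrite /Q; case: ifP => _; first by rewrite size_poly0.
  by have [le _ _] := HP ij; apply: leq_trans (size_comp_scaleX _ _) le.
- have [v /conv_bound [c [r [c0 [r0 Hv]]]] dv] := H t.
  have [n1 h1] := nat_bound c; have [n2 h2] := nat_bound r.
  (* The exponent i + j + 2 leaves room for the constant [c] besides the ratio [r]. *)
  exists (maxn 1 (maxn n1 n2)); set N := maxn _ _ => -[i j]; rewrite /Q /=.
  case: eqP => [_|/eqP ne]; first by rewrite horner0 normr0 exprn_ge0 ?ler0n.
  rewrite horner_comp hornerZ hornerX.
  have [_ _ HPt] := HP (i, j); rewrite -HPt /=.
  have := dv i j ne; rewrite !ps_subE => /eqP; rewrite subr_eq0 => /eqP ->.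
  apply: le_trans (Hv i j) _; rewrite exprS.
  have cN : c <= N%:R.
    by apply: le_trans (le_trans h1 _); rewrite ?real_ler_norm ?gtr0_real // ler_nat /N !leq_max leqnn ?orbT.
  have rN : r <= N%:R.
    by apply: le_trans (le_trans h2 _); rewrite ?real_ler_norm ?gtr0_real // ler_nat /N !leq_max leqnn ?orbT.
  apply: ler_pM; rewrite ?exprn_ge0 ?(ltW c0) ?(ltW r0) //.
  rewrite exprS; apply: (@le_trans _ _ (N%:R ^+ (i + j))).
    by rewrite lerXn2r ?nnegrE ?ler0n // ltW.
  by rewrite ler_peMl ?exprn_ge0 ?ler0n // ler1n /N leq_max.
have Hn' k m : (0 < k)%N -> nu0 ^+ (k * 2) != 1 -> odd m ->
    (k ^ m <= 6 ^ m * n.+1 ^ (k + (s * m + (s + s)) + (s * m + (s + s))).+2)%N.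
  move=> k0 nr om; have := rot_e1_lower s_gt0 nu0_norm eps_norm wh_diag whE k0 nr om.
  set l := (s * m + (s + s))%N; have := Hn ((k + l)%N, l); rewrite /Q /=.
  rewrite (_ : (k + l == l)%N = false); last lia.
  rewrite coef_comp_scaleX; have [_ -> _] := HP ((k + l)%N, l).
  rewrite normrM normCi mulr1 => le1 le2; have := le_trans le2 le1.
  rewrite expr_div_n ler_pdivrMr ?exprn_gt0 ?ltr0n // -!natrX -natrM ler_nat => le.
  apply: leq_trans le _; rewrite mulnC leq_mul2l leq_exp2r ?leqnSn ?orbT //.
(* The mode is fixed in terms of the uniform bound, and the contradiction arises as the power of x^s
   grows. The successor [n.+1] keeps the base positive. *)
have [k lek nr] := nonresonant (12 * n.+1 ^ (2 * s)).
have k0 : (0 < k)%N by apply: leq_trans lek; rewrite muln_gt0 expn_gt0.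
have [m om] := exp_growth_contra (ltn0Sn n) lek.
by rewrite ltnNge Hn'.
Qed.
End Divergence.

(** * Series and truncated polynomials *)

Section Bridge.
Variable R : realType.
Local Notation C := R[i].
Local Notation A := (ps (ps C)).
Notation p := (@pv C).
Notation q := (@qv C).
Notation cst := (@cst C).
Local Notation conj := (@conjc R : {rmorphism C -> C}).

Definition mon2 (i j : nat) : 'X_{1..2} := [multinom [tuple i; j]].
Definition toA (a : ser R 2) : A := fun i j => a (mon2 i j).
Definition fromA (u : A) : ser R 2 := fun m => u (m 0) (m 1).

Lemma mon2_0 i j : mon2 i j 0 = i. Proof. by []. Qed.
Lemma mon2_1 i j : mon2 i j 1 = j. Proof. by []. Qed.
Lemma mon2K (m : 'X_{1..2}) : mon2 (m 0) (m 1) = m.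
Proof.
by apply/mnmP => -[[|[|//]] lt]; [rewrite -[RHS]/(m _)|]; rewrite /= ?mon2_0 ?mon2_1;
  congr (m _); apply: val_inj.
Qed.
Lemma mdeg_mon2 i j : mdeg (mon2 i j) = (i + j)%N.
Proof. by rewrite mdegE big_ord_recl big_ord1. Qed.
Lemma fromAK u : toA (fromA u) = u. Proof. by []. Qed.
Lemma mon2_inj i j k l : (mon2 i j == mon2 k l) = (i == k) && (j == l).
Proof.
apply/eqP/andP => [e|[/eqP -> /eqP ->]] //.
by rewrite -(mon2_0 i j) -(mon2_1 i j) e.
Qed.
Lemma swapm_mon2 i j : swapm (mon2 i j) = mon2 j i.
Proof.
apply/mnmP => k; rewrite mnmE; case: k => [[|[|//]] lt] /=.
  by rewrite -[RHS]/j -[RHS](mon2_1 i j); congr (mon2 i j _); apply: val_inj.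
by rewrite -[RHS]/i -[RHS](mon2_0 i j); congr (mon2 i j _); apply: val_inj.
Qed.
Lemma toA_cswap a : toA (cswap a) = bmap conj (swap (toA a)).
Proof.
by apply/funext => i; apply/funext => j; rewrite /toA /cswap swapm_mon2 /bmap swapE.
Qed.
Lemma toA_cconj a : toA (cconj a) = bmap conj (toA a).
Proof. by []. Qed.
Lemma mnm0_mon2 : 0%MM = mon2 0 0.
Proof. by rewrite -[LHS]mon2K !mnm0E. Qed.
Lemma mnm1_0 : mnm1 (0 : 'I_2) = mon2 1 0. Proof. by rewrite -[LHS]mon2K !mnm1E. Qed.
Lemma mnm1_1 : mnm1 (1 : 'I_2) = mon2 0 1. Proof. by rewrite -[LHS]mon2K !mnm1E. Qed.

(** Evaluation at (p, q), which stand here for the variables z and w. It turns composition of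
    polynomials into [subst]. *)
Definition iota : {mpoly C[2]} -> A := mmap cst (tnth [tuple p; q]).
Lemma iota_add : additive iota. Proof. exact: mmap_is_additive. Qed.
Lemma iota_mul : multiplicative iota. Proof. exact: mmap_is_multiplicative. Qed.
HB.instance Definition _ := GRing.isAdditive.Build {mpoly C[2]} A iota iota_add.
HB.instance Definition _ := GRing.isMultiplicative.Build {mpoly C[2]} A iota iota_mul.

Lemma mmap1_2 (S : comNzRingType) (u v : S) (m : 'X_{1..2}) :
  mmap1 (tnth [tuple u; v]) m = u ^+ m 0 * v ^+ m 1.
Proof.
rewrite /mmap1 big_ord_recl big_ord1; congr (_ ^+ m _ * _ ^+ m _); exact: val_inj.
Qed.
Lemma iotaE (P : {mpoly C[2]}) i j : iota P i j = P@_(mon2 i j).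
Proof.
rewrite {2}[P]mpolyE /iota /mmap raddf_sum bsumE; apply: eq_bigr => m _ /=.
rewrite mmap1_2 bcstM bmonoE mcoeffZ mcoeffX -[m in RHS]mon2K mon2_inj.
by rewrite mon2K [i == _]eq_sym [j == _]eq_sym.
Qed.
Lemma iota_tr N a : J N.+1 (iota (tr N a) - toA a).
Proof.
move=> i j lt; rewrite !ps_subE iotaE /tr raddf_sum /=.
have lt' : (mdeg (mon2 i j) < N.+1)%N by rewrite mdeg_mon2.
rewrite (bigD1 (BMultinom lt')) //= mcoeffZ mcoeffX eqxx mulr1 big1 ?addr0 ?subrr // => m ne.
rewrite mcoeffZ mcoeffX (_ : (bmnm m == _) = false) ?mulr0 //.
by apply: contraNF ne => /eqP e; apply/eqP/val_inj.
Qed.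
Lemma iota_tr_J1 N a : toA a 0%N 0%N = 0 -> J 1 (iota (tr N a)).
Proof.
move=> a0; apply: J1P; have := @iota_tr N a 0%N 0%N isT.
by rewrite !ps_subE a0 subr0.
Qed.
Lemma iota_comp P (u v : {mpoly C[2]}) : J 1 (iota u) -> J 1 (iota v) ->
  iota (P \mPo [tuple u; v]) = subst (iota u) (iota v) (iota P).
Proof.
move=> Ju Jv; rewrite /comp_mpoly {1}/mmap [in RHS]/iota /mmap !rmorph_sum /=.
apply: eq_bigr => m _; rewrite !mmap1_2 !(rmorphM, rmorphXn) /=.
rewrite subst_cst subst_p // subst_q //; congr (_ * _).
by rewrite /iota mmapC.
Qed.
Lemma iota_X (i : 'I_2) : iota 'X_i = tnth [tuple p; q] i.
Proof. by rewrite /iota mmapX mmap1U. Qed.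
Lemma iota_texp N P (g : A) : J 1 g -> J N.+1 (iota P - g) -> J N.+1 (iota (texp N P) - bexp g).
Proof.
move=> Jg H; have JP : J 1 (iota P).
  by rewrite -(subrK g (iota P)); apply: vanishD => //; apply: vanishW H.
have -> : iota (texp N P) = \sum_(k < N.+1) cst (k`!)%:R^-1 * iota P ^+ k.
  rewrite /texp rmorph_sum; apply: eq_bigr => k _ /=.
  by rewrite -mul_mpolyC rmorphM rmorphXn /= {1}/iota mmapC.
have -> : \sum_(k < N.+1) cst (k`!)%:R^-1 * iota P ^+ k - bexp g =
   - (bexp (iota P) - \sum_(k < N.+1) cst (k`!)%:R^-1 * iota P ^+ k) + (bexp (iota P) - bexp g) by ring.
apply: vanishD; first by apply: vanishN; exact: bapp_psum.
apply: subst_congr => //; first exact: addn_wtD.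
by rewrite subrr.
Qed.

Lemma iota_img N F f : toA F 0%N 0%N = 0 ->
  J N.+1 (iota (img N F f) - subst p (toA F) (toA f)).
Proof.
move=> F0; have eX : iota 'X_(0 : 'I_2) = p by rewrite iota_X.
have -> : iota (img N F f) = subst p (iota (tr N F)) (iota (tr N f)).
  rewrite -eX; apply: iota_comp; [rewrite eX; exact: J_p|exact: iota_tr_J1].
have JF : J 1 (toA F) by exact: J1P.
set g := iota (tr N f); have -> : subst p (iota (tr N F)) g - subst p (toA F) (toA f) =
  (subst p (iota (tr N F)) g - subst p (toA F) g) + subst p (toA F) (g - toA f).
  by rewrite [subst _ _ (g - _)]rmorphB /=; ring.
apply: vanishD; last by apply: subst_J; exact: iota_tr.
apply: subst_congr; rewrite ?subrr //; [exact: addn_wtD|exact: iota_tr|exact: J_p|exact: iota_tr_J1|exact: J_p].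
Qed.
Lemma iota_cimg N F f : toA F 0%N 0%N = 0 ->
  J N.+1 (iota (cimg N F f) - subst q (bmap conj (swap (toA F))) (bmap conj (toA f))).
Proof.
move=> F0; have F0' : toA (cswap F) 0%N 0%N = 0.
  by rewrite toA_cswap /bmap swapE F0 rmorph0.
rewrite /cimg -toA_cswap -toA_cconj.
have eX : iota 'X_(1 : 'I_2) = q by rewrite iota_X.
have -> : iota (tr N (cconj f) \mPo [tuple 'X_(1 : 'I_2); tr N (cswap F)])
   = subst q (iota (tr N (cswap F))) (iota (tr N (cconj f))).
  rewrite -eX; apply: iota_comp; [rewrite eX; exact: J_q|exact: iota_tr_J1].
have JF : J 1 (toA (cswap F)) by exact: J1P.
set f' := cconj f; set F' := cswap F in JF *.
set g := iota (tr N f'); have -> : subst q (iota (tr N F')) g - subst q (toA F') (toA f') =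
  (subst q (iota (tr N F')) g - subst q (toA F') g) + subst q (toA F') (g - toA f').
  by rewrite [subst _ _ (g - _)]rmorphB /=; ring.
apply: vanishD; last by apply: subst_J; exact: iota_tr.
apply: subst_congr; rewrite ?subrr //; [exact: addn_wtD|exact: iota_tr|exact: J_q|exact: iota_tr_J1|exact: J_q].
Qed.

(** Reduces a family of truncated identities to one identity of series; the required congruence is
    checked operation by operation with [iota_cong]. *)
Lemma formally_zeroP (E : nat -> {mpoly C[2]}) (e : A) :
  (forall N, J N.+1 (iota (E N) - e)) -> formally_zero E <-> e = 0.
Proof.
move=> H; have eE N i j : (i + j <= N)%N -> e i j = (E N)@_(mon2 i j).
  move=> le; have := H N i j le; rewrite !ps_subE iotaE => /eqP.
  by rewrite subr_eq0 => /eqP.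
split=> [H0|e0].
  apply/funext => i; apply/funext => j; rewrite (eE (i + j)%N) //.
  by apply: H0; rewrite mdeg_mon2.
move=> N m; rewrite -[m]mon2K mdeg_mon2 => le; rewrite -eE // e0.
by [].
Qed.

Lemma convergentP (a : ser R 2) : convergent a <-> conv (toA a).
Proof.
split=> [[c [r [c0 [r0 H]]]]|/conv_bound [c [r [c0 [r0 H]]]]].
  apply/conv_bound; exists (real_complex R c), (real_complex R r).
  rewrite -[0]/(real_complex R 0) !ltcR; split=> //; split=> // i j.
  by rewrite -rmorphXn -rmorphM /= -mdeg_mon2; exact: H.
have [c' _ ec] := normC_exists c; have [r' _ er] := normC_exists r.
rewrite gtr0_norm // in ec; rewrite gtr0_norm // in er; move: H c0 r0; rewrite ec er => H; rewrite -[0]/(real_complex R 0) !ltcR => c0 r0.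
exists c', r'; split=> //; split=> // m; rewrite -[m]mon2K mdeg_mon2 rmorphM rmorphXn; exact: H.
Qed.

Definition iota_cong N (P : {mpoly C[2]}) (g : A) := J N.+1 (iota P - g).
Lemma iota_congB N P Q g h : iota_cong N P g -> iota_cong N Q h -> iota_cong N (P - Q) (g - h).
Proof.
rewrite /iota_cong => H H'; rewrite rmorphB /=.
rewrite (_ : _ - _ = iota P - g - (iota Q - h)); [exact: vanishB|ring].
Qed.
Lemma iota_congD N P Q g h : iota_cong N P g -> iota_cong N Q h -> iota_cong N (P + Q) (g + h).
Proof.
rewrite /iota_cong => H H'; rewrite rmorphD /=.
rewrite (_ : _ - _ = iota P - g + (iota Q - h)); [exact: vanishD|ring].
Qed.
Lemma iota_congM N P Q g h : iota_cong N P g -> iota_cong N Q h -> iota_cong N (P * Q) (g * h).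
Proof.
rewrite /iota_cong => H H'; rewrite rmorphM /=.
rewrite (_ : _ - _ = (iota P - g) * iota Q + g * (iota Q - h)); last by ring.
by apply: vanishD; [apply: (vanishMr addn_wtD)|apply: (vanishMl addn_wtD)].
Qed.
Lemma iota_congZ N P g c : iota_cong N P g -> iota_cong N (c *: P) (cst c * g).
Proof.
rewrite /iota_cong => H; rewrite -mul_mpolyC rmorphM /= {1}/iota mmapC -mulrBr.
exact: (vanishMl addn_wtD).
Qed.
Lemma iota_congX N P g n : iota_cong N P g -> iota_cong N (P ^+ n) (g ^+ n).
Proof.
move=> H; elim: n => [|n IH]; last by rewrite !exprS; exact: iota_congM.
by rewrite /iota_cong !expr0 rmorph1 subrr.
Qed.

Lemma maps_into_nfP nu0 (eps : C) s (F f1 f2 : ser R 2) : (0 < s)%N ->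
  toA F 0%N 0%N = 0 -> toA f2 0%N 0%N = 0 ->
  maps_into_nf (nu0 ^+ 2) eps s F f1 f2 <->
  nf_rel conj nu0 eps s (toA f1) (toA f2) p q (toA F) (bmap conj (swap (toA F))).
Proof.
move=> s0 F0 f20; rewrite /nf_rel.
set S := subst p (toA F) (toA f1); set g := subst p (toA F) (toA f2).
set Sb := subst q _ (bmap conj (toA f1)); set gb := subst q _ (bmap conj (toA f2)).
set G := cst (- 2^-1) * (g + gb).
set e := (X in _ <-> _ = X).
have JG : J 1 G.
  have Jg : J 1 g by apply: subst_J; exact: J1P.
  have Jgb : J 1 gb by apply: subst_J; apply: bmap_vanish; exact: J1P.
  exact: (vanishMl addn_wtD (cst (- 2^-1)) (vanishD Jg Jgb)).
have Jex c : J 1 (cst c * G ^+ s).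
  by apply: (vanishMl addn_wtD); apply: (vanishW (d := s)) => //; exact: J_pow.
rewrite /maps_into_nf (@formally_zeroP _ (g - e)).
  by split=> [/eqP|->]; rewrite ?subrr // subr_eq0 => /eqP.
move=> N; rewrite -/(iota_cong _ _ _) /=.
have -> : g - e = g - (cst (nu0 ^+ 2) * bexp (cst eps * G ^+ s)
   + cst (nu0 ^- 2) * bexp (cst (- eps) * G ^+ s)) * S * Sb - S ^+ 2 - Sb ^+ 2 by rewrite /e; ring.
have h1 : iota_cong N (img N F f1) S by exact: iota_img.
have h2 : iota_cong N (img N F f2) g by exact: iota_img.
have h3 : iota_cong N (cimg N F f1) Sb by exact: iota_cimg.
have h4 : iota_cong N (cimg N F f2) gb by exact: iota_cimg.
have hx : iota_cong N ((- 2^-1) *: (img N F f2 + cimg N F f2)) G.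
  by apply: iota_congZ; exact: iota_congD.
apply: iota_congB; last exact: iota_congX.
apply: iota_congB; last exact: iota_congX.
apply: iota_congB => //.
apply: iota_congM => //; apply: iota_congM => //; apply: iota_congD; apply: iota_congZ.
  by apply: iota_texp => //; apply: iota_congZ; exact: iota_congX.
by apply: iota_texp => //; apply: iota_congZ; exact: iota_congX.
Qed.
End Bridge.

(** * The constants lambda and epsilon *)

Section Constants.
Variable R : realType.
Local Notation C := R[i].
Local Notation "x %:C" := (real_complex _ x) : ring_scope.

(** [mu] is not real because T^2 - gi T + 1 has negative discriminant; its conjugate is then the
    other root, and the product of the roots is 1. *)
Lemma elliptic_root (gi : R) (mu : C) : 0 <= gi < 2%:R -> mu != 0 -> mu + mu^-1 = gi%:C ->
  conjc mu = mu^-1 /\ mu != mu^-1.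
Proof.
move=> /andP[g0 g2] mu0 e.
have e1 : mu ^+ 2 + 1 = gi%:C * mu by rewrite -e mulrDl mulVf.
have nreal : conjc mu != mu.
  apply/negP => /eqP em; move: e1; case: mu em {mu0 e} => a b [] /eqP.
  rewrite -subr_eq0 -opprD oppr_eq0 -mulr2n mulrn_eq0 /= => /eqP -> [] + _.
  rewrite !mul0r !subr0 => e1.
  by have := sqr_ge0 (a - 1); rewrite sqrrB1 expr2; nra.
have ec : conjc mu ^+ 2 + 1 = gi%:C * conjc mu.
  have := congr1 conjc e1; rewrite rmorphD rmorphXn rmorph1 rmorphM /=.
  by rewrite oppr0.
have : (conjc mu - mu) * (mu * conjc mu - 1) = 0.
  transitivity (mu * (conjc mu ^+ 2 + 1) - conjc mu * (mu ^+ 2 + 1)); first by ring.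
  by rewrite e1 ec; ring.
move=> /eqP; rewrite mulf_eq0 subr_eq0 (negbTE nreal) /= subr_eq0 => /eqP m1.
have ei : conjc mu = mu^-1 by rewrite -[RHS]mulr1 -m1 mulKf.
by split=> //; rewrite -ei eq_sym.
Qed.

(** [nu0] is a fourth root of lambda: the multipliers are handled through [nu], whose square is that
    of the normal form. *)
Lemma unit_sqrt (mu : C) : conjc mu = mu^-1 -> mu != 0 -> exists nu0 : C,
  [/\ nu0 ^+ 2 = mu, `|nu0| = 1 & conjc nu0 = nu0^-1].
Proof.
move=> ei mu0; exists (sqrtC mu); rewrite sqrtCK.
have n1 : `|sqrtC mu| = 1.
  apply/eqP; rewrite -(@pexpr_eq1 _ _ 4) // -[4%N]/(2 * 2)%N exprM -normrX sqrtCK.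
  by rewrite sqr_normc ei divff.
split=> //; have := sqr_normc (sqrtC mu); rewrite n1 expr1n => e.
have s0 : sqrtC mu != 0 by rewrite sqrtC_eq0.
by rewrite -[RHS]mulr1 e mulKf.
Qed.

Lemma imaginary_unit (eps : C) : eps = Complex 0 1 \/ eps = Complex 0 (-1) ->
  `|eps| = 1 /\ conjc eps = - eps.
Proof.
by case=> ->; rewrite normc_def /= expr0n /= ?sqrrN expr1n add0r sqrtr1; split=> //;
  apply/eqP; rewrite eq_complex /= ?opprK oppr0 !eqxx.
Qed.

Lemma conj_imag (t : R) : conjc ('i * t%:C) = - ('i * t%:C).
Proof.
rewrite rmorphM /= -complexiE -mulNr; congr (_ * _); apply/eqP; rewrite eq_complex /=.
  by rewrite oppr0 !eqxx.
by rewrite oppr0 !eqxx.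
Qed.
End Constants.

Local Open Scope complex_scope.

(* gi = gamma^-1 ranges over [0,2) (gamma in ]1/2, oo], gi = 0 iff gamma = oo);
   mu = lambda^(1/2) is a root of mu + mu^-1 = gamma^-1. *)
Theorem mainTheorem4 (R : realType) (gi : R) (s : nat) (mu eps : R[i]) :
  0 <= gi < 2%:R -> (1 <= s)%N ->
  mu != 0 -> mu + mu^-1 = gi%:C ->
  (eps = Complex 0 1 \/ eps = Complex 0 (-1)) ->
  exists F : ser R 2,
    [/\ convergent F, has_form gi F, holomorphically_flat F,
        (exists f1 f2 : ser R 2, formal_diffeo f1 f2 /\ maps_into_nf mu eps s F f1 f2)
      & ~ (exists f1 f2 : ser R 2, biholo f1 f2 /\ maps_into_nf mu eps s F f1 f2)].
Proof.
move=> g02 s0 mu0 emu eeps.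
have [ei mu1] := elliptic_root g02 mu0 emu.
have [nu0 [nu2 nn nc0]] := unit_sqrt ei mu0.
have [ne ce] := imaginary_unit eeps.
have nu00 : nu0 != 0 by rewrite -normr_eq0 nn oner_eq0.
have eps0 : eps != 0 by rewrite -normr_eq0 ne oner_eq0.
have nu4 : nu0 ^+ 2 - nu0 ^- 2 != 0 by rewrite nu2 subr_eq0.
pose phi : {rmorphism R[i] -> R[i]} := @conjc R.
have phiK : involutive phi by exact: conjcK.
have phin c : `|phi c| = `|c| by exact: normcJ.
(* One choice of quotients serves all parameters, as polynomial dependence on the parameter
   requires. *)
have [wh [whd whE]] : exists wh : nat -> ps (ps R[i]), (forall k, diag (wh k)) /\
  forall k, (0 < k)%N -> (nui nu0 eps s ^+ k - nu nu0 eps s ^+ k) * wh k = @xv R[i] ^+ s.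
  by apply: small_divisors.
have YX (t : R[i]) : X (s + s) (Yt s t) := Yt_X s0 t.
have Yc (t : R[i]) : conv (Yt s t) := Yt_conv s t.
have Ysym (t : R[i]) : swap (Yt s t) = Yt s t by apply: Yt_sym.
have sol t := linear_solution nu00 eps0 s0 (Ysym t) (YX t) whd whE.
have [e He] := choice sol.
have [t Ht] : exists t : R, ~ exists2 v, conv v &
    diag (beta nu0 eps s (Yt s ('i * real_complex R t)) (e ('i * real_complex R t)) - v).
  apply: (divergent_parameter s0 nn ne nu4 whd whE) => u.
  - by have [_ H _ _ _] := He u.
  - by have [_ _ H _ _] := He u.
set tau := 'i * real_complex R t in Ht; have ctau : phi tau = - tau by exact: conj_imag.
have Yi : bmap phi (Yt s tau) = - Yt s tau.
  rewrite /Yt rmorphM /= bmap_cst ctau rmorphN mulNr; congr (- (_ * _)).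
  by apply/funext => i; apply/funext => j; rewrite /bmap /Y0 rmorph_nat.
have [esym _ _ ediag eX] := He tau.
move: {YX Yc Ysym} (YX tau) (Yc tau) Yi; set Y := Yt s tau in Ht ediag eX * => YX Yc Yi.
set E := e tau in Ht esym ediag eX.
have [J1 [J2 [JJ1 JJ2 [ZJ WJ] [[Z1 Z2] [lin1 lin2]] cJ]]] :=
  surface_chart phiK phin nc0 nu4 ce s0 YX Yi.
have [cJ1 cJ2] := cJ Yc.
have JZ := Z_J nu0 eps s Y; have JW := W_J nu0 eps s Y.
have chart_inj f g : subst (Zs nu0 eps s Y) (Ws nu0 eps s Y) f =
    subst (Zs nu0 eps s Y) (Ws nu0 eps s Y) g -> f = g.
  move=> /(congr1 (subst J1 J2)); rewrite !subst_comp // ZJ WJ.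
  by rewrite !subst_id.
have ZW : bmap phi (Zs nu0 eps s Y) = Ws nu0 eps s Y by apply: cj_Z.
have WZ : bmap phi (Ws nu0 eps s Y) = Zs nu0 eps s Y by apply: cj_W.
(* A function that is real in the real parameters p, q is real as a series in z1 and its conjugate.
   Applied to p and q it makes the graph function real. *)
have real_chart (u f : ps (ps R[i])) : subst (Zs nu0 eps s Y) (Ws nu0 eps s Y) f = u ->
    bmap phi u = u -> bmap phi (swap f) = f.
  move=> fu uu; apply: chart_inj; rewrite fu -uu -fu bmap_subst ZW WZ.
  have <- : swap (bmap phi f) = bmap phi (swap f).
    by apply/funext => i; apply/funext => j; rewrite /bmap !swapE.
  rewrite /swap subst_comp ?subst_p ?subst_q //; [exact: J_q|exact: J_p].
have rJ1 : bmap phi (swap J1) = J1 by apply: (real_chart _ _ Z1); rewrite bmap_p.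
have rJ2 : bmap phi (swap J2) = J2 by apply: (real_chart _ _ Z2); rewrite bmap_q.
(* This is z2 = -pq with p and q expressed through z1 and its conjugate. *)
pose F := fromA (- (J1 * J2)).
have FE : toA F = - (J1 * J2) by [].
have FZ : subst (Zs nu0 eps s Y) (Ws nu0 eps s Y) (- (J1 * J2)) = - @xv R[i].
  by rewrite rmorphN rmorphM /= Z1 Z2.
have JF : J 1 (- (J1 * J2)) by apply: J1N; apply: (vanishMl addn_wtD).
have F0 : toA F 0%N 0%N = 0 by rewrite FE JF.
have rF : bmap phi (swap (toA F)) = toA F.
  by rewrite FE !rmorphN !rmorphM /= rJ1 rJ2.
exists F; split.
- by apply/convergentP; rewrite FE; apply/convN/convM.
- pose l1 : ps (ps R[i]) := - (cst nu0 * @qv _ + cst nu0^-1 * @pv _).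
  pose l2 : ps (ps R[i]) := cst nu0 * @pv _ + cst nu0^-1 * @qv _.
  have JFq : J 3 (toA F - (@pv _ ^+ 2 * @qv _ ^+ 0 + @pv _ ^+ 0 * @qv _ ^+ 2
      + cst (nu0 ^+ 2 + nu0 ^- 2) * (@pv _ ^+ 1 * @qv _ ^+ 1))).
    have nV : cst nu0 * cst nu0^-1 = 1 :> ps (ps R[i]) by rewrite -rmorphM mulfV // rmorph1.
    have Jl1 : J 1 l1.
      by apply: J1N; apply: vanishD; apply: (vanishMl addn_wtD); [exact: J_q|exact: J_p].
    have -> : toA F - (@pv _ ^+ 2 * @qv _ ^+ 0 + @pv _ ^+ 0 * @qv _ ^+ 2
      + cst (nu0 ^+ 2 + nu0 ^- 2) * (@pv _ ^+ 1 * @qv _ ^+ 1)) = - ((J1 - l1) * J2 + l1 * (J2 - l2)).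
      rewrite FE rmorphD /= rmorphXn /= -exprVn rmorphXn /=.
      transitivity (- (J1 * J2) - (cst nu0 * cst nu0^-1 * (@pv _ ^+ 2 + @qv _ ^+ 2)
         + (cst nu0 ^+ 2 + cst nu0^-1 ^+ 2) * (@pv _ * @qv _)) : ps (ps R[i])).
        by rewrite nV; ring.
      rewrite /l1 /l2; ring.
    apply: vanishN; apply: vanishD.
      exact: (vanishM addn_wtD lin1 JJ2).
    exact: (vanishM addn_wtD Jl1 lin2).
  have FE2 i j : (i + j < 3)%N -> F (mon2 i j) =
      ((i == 2) && (j == 0))%:R + ((i == 0) && (j == 2))%:R
      + (nu0 ^+ 2 + nu0 ^- 2) * ((i == 1) && (j == 1))%:R.
    move=> lt; rewrite -[LHS]/(toA F i j); have := JFq i j lt; rewrite !ps_subE => /eqP.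
    rewrite subr_eq0 => /eqP ->.
    by rewrite !ps_addE bcstM !bmonoE.
  split.
    move=> m; rewrite -[m]mon2K mdeg_mon2 => le; rewrite FE2; last lia.
    case: (m 0) (m 1) le => [|[|i]] [|[|j]] // _; rewrite /= ?mulr0 ?addr0 //.
  split; first by rewrite FE2 //= !add0r mulr1 nu2 emu.
  by split; rewrite FE2 //= ?add0r ?addr0 ?mulr0 ?addr0.
(* [F] is real, so the surface already lies in Im z2 = 0 and the identity map suffices. *)
- exists (fromA (@pv _)), (fromA (@qv _)); split.
    split; last by split; apply/convergentP; rewrite fromAK; [exact: conv_p|exact: conv_q].
    split; first by rewrite /fromA mnm0_mon2 pvE.
    split; first by rewrite /fromA mnm0_mon2 qvE.
    by rewrite /fromA !mnm1_0 !mnm1_1 !pvE !qvE /= mul1r mul0r subr0 oner_eq0.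
  rewrite /maps_into_real_hyperplane.
  apply/(@formally_zeroP _ _ (subst (@pv _) (toA F) (@qv _) -
    subst (@qv _) (bmap phi (swap (toA F))) (bmap phi (@qv _)))).
    by move=> N; apply: iota_congB; [exact: iota_img|exact: iota_cimg].
  by rewrite rF bmap_q !subst_q ?subrr // FE.
- have [f1 [f2 [f10 f20 fd fnf]]] := formal_normalization phiK nc0 nu00 nu4 ce eps0 s0 YX Yi esym ediag eX.
  exists (fromA f1), (fromA f2); split.
    split; first by rewrite /fromA mnm0_mon2.
    split; first by rewrite /fromA mnm0_mon2.
    by rewrite /fromA !mnm1_0 !mnm1_1.
  rewrite -nu2; apply/maps_into_nfP => //; rewrite rF FE !fromAK.
  (* Pulling back by the chart replaces the parameters (p, q) by z1 and its conjugate. *)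
  have := nf_transport s0 J1 J2 JZ JW (J1N (@J_x _)) (J1N (@J_x _)) f20 fnf.
  by rewrite ZJ WJ rmorphN rmorphM /= subst_p // subst_q.
move=> [f1 [f2 [[[f10 [f20 fd]] [cf1 cf2]] fnf]]]; apply: Ht.
rewrite mnm0_mon2 in f10 f20; rewrite !mnm1_0 !mnm1_1 in fd.
move: fnf; rewrite -nu2 => /(maps_into_nfP _ _ _ _) -/(_ s0 F0 f20); rewrite rF FE => fnf.
(* The opposite passage, to the parameters in which [equivalence_bound] is stated. *)
have := nf_transport s0 (Zs nu0 eps s Y) (Ws nu0 eps s Y) (@J_p _) (@J_q _) JF JF f20 fnf.
rewrite subst_p // subst_q // FZ => fnf'.
apply: (equivalence_bound phiK phin nc0 nu00 nu4 ce eps0 s0 YX Yi esym ediag Yc _ _ f10 f20 fd fnf').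
  exact/convergentP.
exact/convergentP.
Qed.
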